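(* For any $n\ge1$ and $z,w\in\mathbb B^n$, $K_{Sz}(z,w)$ equals $$\frac{\Gamma(n)}{2\pi^n}\frac{(1-|w|^2)^n}{|1-\langle z,w\rangle|^{2n}}\sum_{i_1=0}^n\sum_{i_2,j_1=0}^{n-i_1}\frac{(-n)_{i_1+i_2}(-n)_{i_1+j_1}(n)_{i_2}(n)_{j_1}}{i_1!\,i_2!\,j_1!\,(n)_{i_1+i_2+j_1}}\,t_1^{i_1}t_2^{i_2}t_3^{j_1}\,{}_2F_1\!\left(i_2+n,j_1+n;i_1+i_2+j_1+n;t_4\right),$$ where $t_1=|z|^2$, $t_2=\frac{|z|^2-\langle w,z\rangle}{1-\langle w,z\rangle}$, $t_3=\overline{t_2}$, $t_4=1-\frac{(1-|z|^2)(1-|w|^2)}{|1-\langle z,w\rangle|^2}$.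
   Context: $\mathbb B^n$ is the open unit ball of $\mathbb C^n$, $\langle z,w\rangle=\sum_jz_j\bar w_j$, $d\sigma$ the unnormalized surface measure on $\partial\mathbb B^n$, $(a)_j$ the Pochhammer symbol and ${}_2F_1$ the Gauss hypergeometric function. $M$-harmonic functions are those annihilated by $\tilde\Delta=4(1-|z|^2)\sum_{j,k}(\delta_{jk}-z_j\bar z_k)\partial^2/\partial z_j\partial\bar z_k$. $K_{Sz}$ is the $M$-harmonic Szegő kernel, i.e. the reproducing kernel of the space of $M$-harmonic functions on $\mathbb B^n$ with radial boundary values in $L^2(\partial\mathbb B^n,d\sigma)$ (inner product of boundary values in $L^2(d\sigma)$), so that $f(x)=\int_{\partial\mathbb B^n}f(\zeta)K_{Sz}(x,\zeta)d\sigma(\zeta)$; equivalently $K_{Sz}(x,y)=\int_{\partial\mathbb B^n}P(x,\zeta)P(y,\zeta)d\sigma(\zeta)$ with $P(x,\zeta)=\frac{\Gamma(n)}{2\pi^n}\frac{(1-|x|^2)^n}{|1-\langle x,\zeta\rangle|^{2n}}$. *)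

(* Defs.v *)
From HB Require Import structures.
From mathcomp Require Import all_boot all_order all_algebra.
From mathcomp Require Import all_classical all_reals all_analysis.
From mathcomp Require Import complex.

Set Implicit Arguments.
Unset Strict Implicit.
Unset Printing Implicit Defensive.

Import Order.TTheory GRing.Theory Num.Theory.
Local Open Scope ring_scope.
Local Open Scope complex_scope.

Section Defs.
Variable R : realType.
Local Notation C := R[i].

Definition cvec (n : nat) := 'I_n -> C.

Definition cinner n (z w : cvec n) : C := \sum_(j < n) z j * (w j)^*.

Definition sqmod (c : C) : R := (complex.Re c) ^+ 2 + (complex.Im c) ^+ 2.

Definition cnorm2 n (z : cvec n) : R := \sum_(j < n) sqmod (z j).

Definition in_ball n (z : cvec n) : Prop := cnorm2 z < 1.

Definition toC n (x : nat -> R) : cvec n :=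
  fun j => x (2 * j)%N +i* x (2 * j).+1%N.

(* Iterated Lebesgue integral over R^m (coordinates 0..m-1) of a
   nonnegative extended-real function; by Tonelli this is the integral
   against Lebesgue measure on R^m. *)
Fixpoint leb_iter (m : nat) (f : (nat -> R) -> \bar R) : \bar R :=
  match m with
  | 0 => f (fun _ => 0)
  | m'.+1 => (\int[@lebesgue_measure R]_(t in setT)
               leb_iter m' (fun x => f (fun k => if k == m' then t else x k)))%E
  end.

Definition sphere_proj n (z : cvec n) : cvec n :=
  fun j => z j * ((Num.sqrt (cnorm2 z))^-1)%:C.

(* Integral over the unit sphere of C^n = R^{2n} against the unnormalized
   surface measure sigma, via the cone formula
     int_S f dsigma = 2n * int_{B^n \ {0}} f(x/|x|) dV(x). *)
Definition sphere_int n (f : cvec n -> R) : \bar R :=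
  ((2 * n)%:R%:E * leb_iter (2 * n)
     (fun x => if ((0 < cnorm2 (@toC n x)) && (cnorm2 (@toC n x) < 1))%R
               then (f (sphere_proj (@toC n x)))%:E else 0%E))%E.

Definition Gamma_nat (n : nat) : R := (n.-1)`!%:R.

Definition Poisson n (x zeta : cvec n) : R :=
  Gamma_nat n / (2 * pi ^+ n) * (1 - cnorm2 x) ^+ n
  / (sqmod (1 - cinner x zeta)) ^+ n.

Definition K_Sz n (x y : cvec n) : \bar R :=
  sphere_int (fun zeta => Poisson x zeta * Poisson y zeta).

Definition poch (a : R) (j : nat) : R := \prod_(k < j) (a + k%:R).

Definition hyp2F1 (a b c t : R) : R :=
  limn (fun N : nat =>
    \sum_(k < N) (poch a k * poch b k / (poch c k * k`!%:R) * t ^+ k)).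

End Defs.

(* Main.v *)
Require Import Defs.
From HB Require Import structures.
From mathcomp Require Import all_boot all_order all_algebra.
From mathcomp Require Import all_classical all_reals all_analysis.
From mathcomp Require Import complex.
From mathcomp Require Import measurable_realfun ring lra zify.
Import Order.TTheory GRing.Theory Num.Theory.
Import numFieldNormedType.Exports Normc.
Local Open Scope classical_set_scope.
Local Open Scope ring_scope.
Local Open Scope complex_scope.
Set Implicit Arguments.
Unset Strict Implicit.
Unset Printing Implicit Defensive.

(* By the Moebius invariance of the Poisson-Szego kernels, the change of variables
   exchanging 0 and z turns the integral of P(z,.) P(w,.) over the sphere into that
   of |1 - <z,eta>|^(2n) |1 - <w',eta>|^(-2n), where w' is the image of w; then
   <w',z> = t2 and |w'|^2 = t4. Expanding the polynomial |1 - <z,eta>|^(2n) by the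
   binomial theorem and the kernel at w' in powers of <w',eta> and its conjugate,
   and inserting the moments of the sphere, produces the triple sum.
   The moments of the sphere come from Gaussian moments by the layer-cake formula.
   Invariance is checked on products of a holomorphic and an antiholomorphic kernel
   (1 - <p,zeta>)^(-n), where both sides are explicit, and then extended: expanding
   the kernels and polarizing shows that they determine a continuous functional on
   products of kernels. *)

(** * Iterated Lebesgue integrals *)

Section LebesgueScaling.
Context {R : realType}.
Local Open Scope ereal_scope.
Local Notation lambda := (@lebesgue_measure R).

(** The sphere integral of the statement is a multiple of a Lebesgue integral over the ball, while
    it is Gaussian integrals that factor over the coordinates. The bridge is that dilating a
    function homogeneous of degree zero multiplies its ball integral by a power of the radius.
    Invariance is obtained without computing the Jacobian of the Moebius map on the sphere: for one
    kernel of each type both sides follow from the reproducing property. The integrand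
    [P(z,.) P(w,.)], however, contains two kernels of each type, so the identity is extended in each
    of two slots separately, the second time after a conjugation. This works because powers of
    linear forms span the polynomials of a given degree, and because all functions involved lie in a
    class, [sphere_alg], on which the mean is linear and bounded by the sup norm on the sphere. The
    exponent [n] of the kernels makes the coefficients of their binomial series cancel against the
    moments of the sphere; the hypergeometric series are the sums over powers of [|w'|^2] that
    remain. *)

Definition lebesgue_factor (c k : R) : Prop :=
  forall f : R -> \bar R, measurable_fun [set: R] f -> (forall t, 0 <= f t) ->
    \int[lambda]_t f t = k%:E * \int[lambda]_t f (c * t)%R.

(** The pushforward of Lebesgue measure under multiplication by [c], rescaled by [c], gives each
    interval []a, b]] its length; uniqueness of Lebesgue measure does the rest. *)
Lemma lebesgue_factor_pos (c : R) : (0 < c)%R -> lebesgue_factor c c.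
Proof.
move=> c0 f mf f0.
have mc : measurable_fun setT (fun t : measurableTypeR R => c * t : measurableTypeR R)%R.
  exact: (measurable_funM (measurable_cst c) (@measurable_id _ _ setT)).
pose k := NngNum (ltW c0).
pose mu' := mscale k (pushforward lambda (fun t : measurableTypeR R => (c * t)%R : measurableTypeR R)).
have E A : measurable A -> lambda A = mu' mc A.
  move=> mA; apply: (lebesgue_measure_unique (mu := mscale k (pushforward lambda (fun t : measurableTypeR R => (c * t)%R : measurableTypeR R)))) => //= _ [[a b]] _ <-.
  rewrite /mu' /mscale /= /pushforward.
  have -> : (fun t : R => c * t)%R @^-1` `]a, b] = `](a / c)%R, (b / c)%R]%classic.
    by apply/seteqP; split => x /=; rewrite !in_itv /= ltr_pdivrMr // ler_pdivlMr // ![(x * c)%R]mulrC.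
  rewrite !lebesgue_measure_itv /= !lte_fin ltr_pM2r ?invr_gt0 //.
  case: ifP => _; last by rewrite mule0.
  by rewrite -!EFinB -EFinM; congr EFin; field; rewrite gt_eqF.
rewrite (eq_measure_integral (mu' mc)); last by move=> A mA _; exact: E.
rewrite ge0_integral_mscale //=; congr (_ * _).
by rewrite ge0_integral_pushforward.
Qed.

Lemma lebesgue_factor_opp : lebesgue_factor (-1) 1.
Proof.
move=> f mf f0; rewrite mul1e.
have mc : measurable_fun setT (-%R : measurableTypeR R -> measurableTypeR R).
  exact: oppr_measurable.
rewrite (eq_measure_integral (pushforward lambda (-%R : _ -> measurableTypeR R))); last first.
  by move=> A mA _; exact/esym/lebesgue_measureN.
rewrite ge0_integral_pushforward //=.
by apply: eq_integral => x _; rewrite mulN1r.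
Qed.

End LebesgueScaling.

Section ProductSigmaFinite.
Context {R : realType} d1 d2 (T1 : measurableType d1) (T2 : measurableType d2).
Variables (m1 : {sigma_finite_measure set T1 -> \bar R})
          (m2 : {sigma_finite_measure set T2 -> \bar R}).
Local Open Scope ereal_scope.

(* In the library the canonical sigma-finite structure on [m1 \x m2] is
   only inferred for products of subprobabilities. *)
Definition sf_prod : set (T1 * T2) -> \bar R := m1 \x m2.

HB.instance Definition _ := Measure.on sf_prod.

Lemma sf_prod_sigma_finite : sigma_finite [set: T1 * T2] sf_prod.
Proof.
have /sigma_finiteP[F [FT Fnd Foo]] := sigma_finiteT m1.
have /sigma_finiteP[G [GT Gnd Goo]] := sigma_finiteT m2.
exists (fun n => F n `*` G n) => [|k].
  apply/seteqP; split=> // -[x y] _.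
  have [i _ Fx] : (\bigcup_k F k) x by rewrite -FT.
  have [j _ Gy] : (\bigcup_k G k) y by rewrite -GT.
  exists (maxn i j) => //; split => /=.
    by move/subsetPset: (Fnd _ _ (leq_maxl i j)); apply.
  by move/subsetPset: (Gnd _ _ (leq_maxr i j)); apply.
have [mF Fk] := Foo k; have [mG Gk] := Goo k.
split; first exact: measurableX.
by rewrite /sf_prod product_measure1E // lte_mul_pinfty // ge0_fin_numE.
Qed.

HB.instance Definition _ := Measure_isSigmaFinite.Build _ _ _ sf_prod sf_prod_sigma_finite.

End ProductSigmaFinite.

Section IteratedLebesgue.
Context {R : realType}.
Local Open Scope ereal_scope.
Local Notation lambda := (@lebesgue_measure R).

(* Measurability of [F] on the space of real sequences, tested along every
   measurable parametrization of the coordinates: this spares us a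
   sigma-algebra on [nat -> R]. *)
Definition coord_measurable d (U : measurableType d) (F : (nat -> R) -> U) : Prop :=
  forall d' (T : measurableType d') (X : T -> nat -> R),
    (forall k, measurable_fun [set: T] (fun t => X t k)) ->
    measurable_fun [set: T] (fun t => F (X t)).

(** The update made by [leb_iter] at each level, so that [leb_iter m.+1] unfolds to an integral of
    [leb_iter m] over [set_coord m t]. *)
Definition set_coord (m : nat) (t : R) (x : nat -> R) : nat -> R :=
  fun k => if k == m then t else x k.

Lemma coord_measurable_set d (U : measurableType d) (F : (nat -> R) -> U) m t :
  coord_measurable F -> coord_measurable (fun x => F (set_coord m t x)).
Proof.
move=> mF d' T X mX; apply: (mF _ _ (fun s => set_coord m t (X s))) => k.
by rewrite /set_coord; case: eqP => _ //; exact: measurable_cst.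
Qed.

Lemma coord_measurable_scale d (U : measurableType d) (F : (nat -> R) -> U) (c : R) :
  coord_measurable F -> coord_measurable (fun x => F (fun k => c * x k)%R).
Proof.
move=> mF d' T X mX; apply: (mF _ _ (fun s k => c * X s k)%R) => k.
exact: measurable_funM.
Qed.

(** A concrete sigma-finite space with coordinate functions that realizes Lebesgue measure on R^m.
    It turns [leb_iter], meant for nonnegative integrands, into a single integral to which Tonelli,
    linearity and domination apply; the last field also covers signed products. *)
Record leb_model (m : nat) d (T : measurableType d)
    (mu : {sigma_finite_measure set T -> \bar R}) (X : T -> nat -> R) : Prop :=
  LebModel {
  leb_model_meas : forall k, measurable_fun [set: T] (fun t => X t k);
  leb_model_iter : forall F : (nat -> R) -> \bar R, coord_measurable F ->
    (forall x, 0 <= F x) -> leb_iter m F = \int[mu]_t F (X t);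
  leb_model_prod : forall g : nat -> R -> R,
    (forall k, lambda.-integrable [set: R] (EFin \o g k)) ->
    mu.-integrable [set: T] (fun t => (\prod_(k < m) g k (X t k))%:E) /\
    \int[mu]_t (\prod_(k < m) g k (X t k))%:E = (\prod_(k < m) \int[lambda]_t g k t)%R%:E }.

Lemma leb_model0 : @leb_model 0 _ unit (dirac tt) (fun _ _ => 0%R).
Proof.
split=> [k|F mF F0|g gi].
- exact: measurable_cst.
- by rewrite /= integral_dirac // diracT mul1e.
- split; last by rewrite integral_dirac // diracT mul1e !big_ord0.
  apply/integrableP; split; first by apply/measurable_EFinP.
  by rewrite integral_dirac // diracT mul1e /= ltry.
Qed.

Lemma integrable_tensor d1 d2 (T1 : measurableType d1) (T2 : measurableType d2)
    (m1 : {sigma_finite_measure set T1 -> \bar R})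
    (m2 : {sigma_finite_measure set T2 -> \bar R}) (f : T1 -> R) (g : T2 -> R) :
  m1.-integrable [set: T1] (EFin \o f) -> m2.-integrable [set: T2] (EFin \o g) ->
  (m1 \x m2).-integrable [set: T1 * T2] (fun z => (f z.1 * g z.2)%:E) /\
  \int[m1 \x m2]_z (f z.1 * g z.2)%:E = (\int[m1]_x f x * \int[m2]_y g y)%R%:E.
Proof.
move=> fi gi.
have mf : measurable_fun [set: T1] f by have /measurable_EFinP := measurable_int _ fi.
have mg : measurable_fun [set: T2] g by have /measurable_EFinP := measurable_int _ gi.
have mh : measurable_fun [set: T1 * T2] (fun z => (f z.1 * g z.2)%:E).
  apply/measurable_EFinP; apply: measurable_funM.
    exact: (measurableT_comp mf).
  exact: (measurableT_comp mg).
have fin1 : \int[m1]_x (f x)%:E \is a fin_num by exact: integrable_fin_num fi.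
have fin2 : \int[m2]_y (g y)%:E \is a fin_num by exact: integrable_fin_num gi.
have nf : \int[m1]_x `|(f x)%:E| < +oo by have /integrableP[] := fi.
have ng : \int[m2]_x `|(g x)%:E| < +oo by have /integrableP[] := gi.
have ih : (m1 \x m2).-integrable [set: T1 * T2] (fun z => (f z.1 * g z.2)%:E).
  apply/integrable12ltyP => //=.
  rewrite (_ : \int[m1]_x _ = \int[m1]_x (`|(f x)%:E| * \int[m2]_y `|(g y)%:E|)).
    rewrite ge0_integralZr //=.
    - rewrite lte_mul_pinfty ?integral_ge0 //.
      by rewrite ge0_fin_numE // integral_ge0.
    - by apply/measurable_EFinP; apply: measurableT_comp.
    - exact: integral_ge0.
  apply: eq_integral => x _; rewrite -ge0_integralZl //=.
    by apply: eq_integral => y _; rewrite normrM EFinM.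
  by apply/measurable_EFinP; apply: measurableT_comp.
split=> //.
rewrite -(integral12_prod_meas1 ih) /fubini_F /=.
transitivity (\int[m1]_x ((f x)%:E * \int[m2]_y (g y)%:E)).
  apply: eq_integral => x _; rewrite -integralZl //.
by rewrite -(fineK fin2) integralZr // /Rintegral EFinM !fineK.
Qed.

Lemma leb_modelS m d (T : measurableType d)
    (mu : {sigma_finite_measure set T -> \bar R}) (X : T -> nat -> R) :
  leb_model m mu X ->
  leb_model m.+1 (sf_prod lambda mu) (fun p => set_coord m p.1 (X p.2)).
Proof.
case=> mX iX pX.
have mX' k : measurable_fun [set: measurableTypeR R * T]
    (fun p : measurableTypeR R * T => set_coord m p.1 (X p.2) k).
  rewrite /set_coord; case: eqP => _; first exact: measurable_fst.
  exact: (measurableT_comp (mX k)).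
split=> // [F mF F0|g gi].
- rewrite /= fubini_tonelli1 //=; last exact: mF.
  apply: eq_integral => t _.
  by rewrite (iX (fun x => F (set_coord m t x))) //; exact: coord_measurable_set.
- have [pi pE] := pX g gi.
  have [ti tE] := integrable_tensor (m1 := lambda) (gi m) pi.
  have E p : (\prod_(k < m.+1) g k (set_coord m p.1 (X p.2) k))%:E =
      (g m p.1 * \prod_(k < m) g k (X p.2 k))%R%:E.
    rewrite big_ord_recr /= mulrC [set_coord _ _ _ m]/set_coord eqxx; congr (_ * _)%R%:E.
    by apply: eq_bigr => k _; rewrite /set_coord ltn_eqF.
  split; first by under eq_fun do rewrite E.
  rewrite big_ord_recr /= mulrC.
  transitivity (\int[sf_prod lambda mu]_p (g m p.1 * \prod_(k < m) g k (X p.2 k))%R%:E).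
    by apply: eq_integral => p _; exact: E.
  by rewrite tE /Rintegral pE.
Qed.

Lemma leb_model_exists m : exists d (T : measurableType d)
    (mu : {sigma_finite_measure set T -> \bar R}) (X : T -> nat -> R), leb_model m mu X.
Proof.
elim: m => [|m [d [T [mu [X H]]]]].
  by exists _, unit, (dirac tt), (fun _ _ => 0%R); exact: leb_model0.
by eexists _, _, _, _; exact: (leb_modelS H).
Qed.

Lemma leb_iter_ge0 m (F : (nat -> R) -> \bar R) :
  (forall x, 0 <= F x) -> 0 <= leb_iter m F.
Proof.
elim: m F => [|m IH] F F0 /=; first exact: F0.
by apply: integral_ge0 => t _; apply: IH => x; exact: F0.
Qed.

Lemma leb_iter_scale m (F : (nat -> R) -> \bar R) (c k : R) :
  lebesgue_factor c k -> (0 <= k)%R ->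
  coord_measurable F -> (forall x, 0 <= F x) ->
  leb_iter m F = (k ^+ m)%:E * leb_iter m (fun x => F (fun j => c * x j)%R).
Proof.
move=> ck k0; elim: m F => [|m IH] F mF F0.
  rewrite /= expr0 mul1e; congr F; apply/funext => j; by rewrite mulr0.
(* A model of the inner [m] coordinates is needed only to see that the inner iterated integral is
   measurable in the outer variable, being a Tonelli section. *)
have [d [T [mu [X [mX iX _]]]]] := leb_model_exists m.
have mG G : coord_measurable G -> (forall x, 0 <= G x) ->
    measurable_fun [set: R] (fun t => leb_iter m (fun x => G (set_coord m t x))).
  move=> cG G0.
  have -> : (fun t => leb_iter m (fun x => G (set_coord m t x))) =
      fubini_F mu (fun p : measurableTypeR R * T => G (set_coord m p.1 (X p.2))).
    apply/funext => t; rewrite iX //; exact: coord_measurable_set.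
  apply: measurable_fun_fubini_tonelli_F => //.
  apply: cG => j; rewrite /set_coord; case: eqP => _; first exact: measurable_fst.
  exact: (measurableT_comp (mX j)).
rewrite /= (ck (fun t => leb_iter m (fun x => F (set_coord m t x)))) //; last 2 first.
- exact: mG.
- by move=> t; exact: leb_iter_ge0.
rewrite exprSr mulrC EFinM -muleA; congr (_ * _).
rewrite -ge0_integralZl_EFin //; last 3 first.
- by move=> t _; exact: leb_iter_ge0.
- by apply: (mG (fun x => F (fun j => (c * x j)%R))) => //; exact: coord_measurable_scale.
- exact: exprn_ge0.
apply: eq_integral => t _; rewrite (IH (fun x => F (set_coord m (c * t)%R x))) //; last first.
  exact: coord_measurable_set.
congr (_ * leb_iter m _); apply/funext => x; congr F; apply/funext => j.
by rewrite /set_coord; case: eqP.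
Qed.

End IteratedLebesgue.

(** * Layer cake and Gaussian moments *)

Section LayerCake.
Context {R : realType}.
Local Open Scope ereal_scope.
Local Notation lambda := (@lebesgue_measure R).

(** [h] is the tail of the density [k] on the half-line, so that [h (rho x)] is a superposition of
    the indicators of [rho x < t]. *)
Definition tail_integral (k h : R -> R) : Prop :=
  forall s, (0 <= s)%R -> \int[lambda]_t (k t * (s < t)%R%:R)%:E = (h s)%:E.

Lemma tail_integral_FTC (k F : R -> R) (l : R) :
  (forall t, (0 <= t)%R -> (0 <= k t)%R) -> continuous k ->
  (F x @[x --> +oo%R] --> l)%R ->
  (forall t : R, is_derive t 1%R F (k t)) ->
  tail_integral k (fun s => l - F s)%R.
Proof.
move=> k0 ck Fl dF s s0.
have mk : measurable_fun [set: R] k by exact: continuous_measurable_fun.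
transitivity (\int[lambda]_(x in `]s, +oo[) (k x)%:E).
  rewrite [RHS]integral_mkcond; apply: eq_integral => t _.
  rewrite patchE mem_setE in_itv /= andbT.
  by case: ifP => _; rewrite ?mulr1 ?mulr0.
rewrite integral_itv_obnd_cbnd; last by apply/measurable_EFinP; exact: measurable_funTS.
rewrite (@ge0_continuous_FTC2y _ k F s l) ?EFinB //.
- by move=> x sx; apply: k0; exact: le_trans sx.
- exact: continuous_subspaceT.
- by apply: cvg_at_right_filter; apply/differentiable_continuous/derivable1_diffP.
- by move=> x _; rewrite derive1E; exact: derive_val.
Qed.

(** Tonelli applied to the tail representation of [h (rho x)]. With [rho] a norm or a squared norm,
    the inner integrals run over balls. *)
Lemma layer_cake d (T : measurableType d) (mu : {sigma_finite_measure set T -> \bar R})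
    (f : T -> \bar R) (rho : T -> R) (k h : R -> R) :
  measurable_fun [set: T] f -> (forall x, 0 <= f x) ->
  measurable_fun [set: T] rho -> (forall x, (0 <= rho x)%R) ->
  measurable_fun [set: R] k -> (forall t, (0 <= t)%R -> (0 <= k t)%R) ->
  tail_integral k h ->
  \int[mu]_x (f x * (h (rho x))%:E) =
  \int[lambda]_t ((k t)%:E * \int[mu]_x (f x * (rho x < t)%R%:R%:E)).
Proof.
move=> mf f0 mrho rho0 mk k0 kh.
pose G (z : T * measurableTypeR R) := f z.1 * (k z.2 * (rho z.1 < z.2)%R%:R)%:E.
have mlt : measurable_fun [set: T * measurableTypeR R] (fun z => (rho z.1 < z.2)%R).
  apply: measurable_fun_ltr; last exact: measurable_snd.
  exact: (measurableT_comp mrho).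
have mltR : measurable_fun [set: T * measurableTypeR R] (fun z => ((rho z.1 < z.2)%R%:R : R)).
  rewrite (_ : (fun _ => _) = (fun z => if (rho z.1 < z.2)%R then 1%R else 0%R)).
    by apply: measurable_fun_ifT.
  by apply/funext => z; case: ifP.
have kge x t : (0 <= k t * (rho x < t)%R%:R)%R.
  case: ltP => [xt|]; last by rewrite mulr0.
  by rewrite mulr1 k0 // (le_trans (rho0 x)) // ltW.
have mG : measurable_fun [set: T * measurableTypeR R] G.
  apply: emeasurable_funM; first exact: (measurableT_comp mf).
  apply/measurable_EFinP; apply: measurable_funM => //.
  exact: (measurableT_comp mk).
have G0 z : 0 <= G z by rewrite /G mule_ge0 // lee_fin.
have := fubini_tonelli (m1 := mu) (m2 := lambda) G mG G0.
rewrite /fubini_F /fubini_G /G /= => E.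
transitivity (\int[mu]_x \int[lambda]_t (f x * (k t * (rho x < t)%R%:R)%:E)).
  apply: eq_integral => x _; rewrite ge0_integralZl ?kh //.
  - apply/measurable_EFinP; apply: measurable_funM => //.
    exact: (measurableT_comp mltR (measurable_pair1 x)).
  - by move=> t _; rewrite lee_fin.
rewrite E; apply: eq_integral => t _.
(* The sign of [k] is known for [t >= 0] only; for negative [t] the set where [rho x < t] is empty
   and both sides vanish. *)
have [t0|t0] := leP 0%R t.
  rewrite -ge0_integralZl_EFin ?k0 //; last first.
  - apply: emeasurable_funM => //; apply/measurable_EFinP.
    exact: (measurableT_comp mltR (measurable_pair2 t)).
  - by move=> x _; rewrite mule_ge0.
  by apply: eq_integral => x _; rewrite EFinM muleCA.
have E0 x : ((rho x < t)%R = false) by apply/negbTE; rewrite -leNgt (le_trans (ltW t0)).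
by rewrite !integral0_eq ?mule0 // => x _; rewrite E0 ?mulr0 mule0.
Qed.

End LayerCake.

Section OneVariable.
Context {R : realType}.
Local Notation lambda := (@lebesgue_measure R).

Lemma is_derive_pow (n : nat) (t : R) :
  is_derive t (1 : R) (fun x : R => x ^+ n) (n%:R * t ^+ n.-1).
Proof.
have := @is_deriveX R R id n t 1 1 (is_derive_id t 1).
rewrite /GRing.scale /= mulr1.
by rewrite (_ : id ^+ n = (fun x : R => x ^+ n)) //; apply/funext => x; rewrite exprfctE.
Qed.

Lemma is_derive_expN (t : R) : is_derive t (1 : R) (fun x : R => expR (- x)) (- expR (- t)).
Proof.
have := @is_derive1_comp R expR (fun x => - x) t _ _ (is_derive_expR (- t))
  (is_deriveN (is_derive_id t 1)).
by rewrite mulrN1.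
Qed.

Lemma is_derive_powexpN (n : nat) (t : R) : is_derive t (1 : R)
  (fun x : R => x ^+ n * expR (- x))
  (n%:R * t ^+ n.-1 * expR (- t) - t ^+ n * expR (- t)).
Proof.
apply: is_derive_eq; first exact: (is_deriveM (is_derive_pow n t) (is_derive_expN t)).
by rewrite /GRing.scale /=; ring.
Qed.

Lemma continuous_powexpN n : continuous (fun x : R => x ^+ n * expR (- x)).
Proof.
move=> x; apply/differentiable_continuous/derivable1_diffP.
exact: (@ex_derive _ _ _ _ _ _ _ (is_derive_powexpN n x)).
Qed.

Lemma powexpN_cvg0 (n : nat) : x ^+ n * expR (- x) @[x --> +oo] --> (0 : R).
Proof.
have lim0 : (n.+1)`!%:R / x @[x --> +oo] --> (0 : R).
  rewrite -[X in _ --> X](mulr0 (n.+1)`!%:R); apply: cvgMr => //.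
  apply/(@gtr0_cvgV0 _ _ _ _ id) => //; exact: nbhs_pinfty_gt.
apply: (squeeze_cvgr _ (cvg_cst 0) lim0).
near=> x.
have x0 : 0 < x by near: x; exact: nbhs_pinfty_gt.
apply/andP; split; first by rewrite mulr_ge0 ?exprn_ge0 ?expR_ge0 // ltW.
rewrite expRN ler_pdivrMr ?expR_gt0 //.
(* One more power than [n] in the lower bound for the exponential leaves the factor [1 / x] that
   tends to 0. *)
have := @expR_ge1Dxn R x n (ltW x0).
move=> /(le_trans _) - /(_ (x ^+ n.+1 / (n.+1)`!%:R)); rewrite lerDr ler01 => /(_ isT).
rewrite ler_pdivrMr ?ltr0n ?fact_gt0 // exprS => H.
by rewrite mulrAC ler_pdivlMr // mulrC [X in _ <= X]mulrC.
Unshelve. all: by end_near. Qed.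

(** The upper incomplete gamma function, the integral of [t^n e^(-t)] over [t > s], given by the
    recursion that integration by parts would produce. *)
Fixpoint incgamma (n : nat) (s : R) : R :=
  match n with
  | 0 => expR (- s)
  | n'.+1 => s ^+ n * expR (- s) + n%:R * incgamma n' s
  end.

Lemma is_derive_incgamma n t :
  is_derive t (1 : R) (incgamma n) (- (t ^+ n * expR (- t))).
Proof.
elim: n => [|n IH].
  by rewrite expr0 mul1r; exact: is_derive_expN.
apply: is_derive_eq.
  exact: (is_deriveD (is_derive_powexpN n.+1 t) (is_deriveZ n.+1%:R IH)).
by rewrite /GRing.scale /=; ring.
Qed.

Lemma incgamma_cvg0 n : incgamma n x @[x --> +oo] --> (0 : R).
Proof.
elim: n => [|n IH].
  have := powexpN_cvg0 0; apply: cvg_trans; apply: near_eq_cvg.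
  by apply: nearW => x; rewrite expr0 mul1r.
rewrite -[X in _ --> X](addr0 0); apply: cvgD; first exact: powexpN_cvg0.
by rewrite -[X in _ --> X](mulr0 n.+1%:R); apply: cvgMr.
Qed.

Lemma incgamma0 n : incgamma n 0 = n`!%:R.
Proof.
elim: n => [|n IH] /=; first by rewrite oppr0 expR0.
by rewrite expr0n /= mul0r add0r IH factS natrM.
Qed.

Lemma tail_integral_gamma n :
  tail_integral (fun t : R => t ^+ n * expR (- t)) (incgamma n).
Proof.
have -> : incgamma n = (fun s => 0 - (- incgamma n s)).
  by apply/funext => s; rewrite sub0r opprK.
apply: (tail_integral_FTC (F := fun s => - incgamma n s)).
- by move=> t t0; rewrite mulr_ge0 ?exprn_ge0 ?expR_ge0.
- exact: continuous_powexpN.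
- by rewrite -[X in _ --> X]oppr0; apply: cvgN; exact: incgamma_cvg0.
- by move=> t; apply: is_derive_eq; [exact: (is_deriveN (is_derive_incgamma n t))|rewrite opprK].
Qed.

End OneVariable.

Section GaussianMoments.
Context {R : realType}.
Local Notation lambda := (@lebesgue_measure R).

(** The exponent carries no factor 1/2: the product of the weights over the [2 * n] real coordinates
    is then [e^(-|z|^2)]. *)
Definition gauss_pow (k : nat) (x : R) : R := x ^+ k * expR (- x ^+ 2).

Lemma is_derive_gauss (t : R) :
  is_derive t (1 : R) (fun x : R => expR (- x ^+ 2)) (- (2 * t * expR (- t ^+ 2))).
Proof.
have := @is_derive1_comp R expR (fun x => - x ^+ 2) t _ _ (is_derive_expR _)
  (is_deriveN (is_derive_pow 2 t)).
by rewrite expr1 => H; apply: (is_derive_eq H); ring.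
Qed.

Lemma continuous_gauss_pow k : continuous (gauss_pow k).
Proof.
move=> x; apply/differentiable_continuous/derivable1_diffP.
exact: (@ex_derive _ _ _ _ _ _ _ (is_deriveM (is_derive_pow k x) (is_derive_gauss x))).
Qed.

Lemma measurable_gauss_pow k : measurable_fun [set: R] (gauss_pow k).
Proof. by apply: continuous_measurable_fun; exact: continuous_gauss_pow. Qed.

Lemma gauss_pow_even_ge0 k x : 0 <= gauss_pow k.*2 x.
Proof. by rewrite /gauss_pow -muln2 exprM mulr_ge0 ?sqr_ge0 ?expR_ge0. Qed.

Lemma tail_integral_gauss :
  tail_integral (fun t : R => 2 * gauss_pow 1 t) (fun s => expR (- s ^+ 2)).
Proof.
have -> : (fun s : R => expR (- s ^+ 2)) = (fun s => 0 - (- expR (- s ^+ 2))).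
  by apply/funext => s; rewrite sub0r opprK.
apply: (tail_integral_FTC (F := fun s => - expR (- s ^+ 2))).
- by move=> t t0; rewrite mulr_ge0 ?mulr_ge0 ?expR_ge0 // expr1.
- by move=> x; apply: cvgMr; exact: continuous_gauss_pow.
- by rewrite -[X in _ --> X]oppr0; apply: cvgN; exact: cvg_gauss_fun.
- move=> t; apply: (is_derive_eq (is_deriveN (is_derive_gauss t))).
  by rewrite /gauss_pow; ring.
Qed.

Lemma integral_pow_sym (k : nat) (t : R) : 0 < t ->
  (\int[lambda]_x ((x ^+ k.*2)%R%:E * ((`|x| < t)%R%:R : R)%:E) =
   (2 * t ^+ k.*2.+1 / k.*2.+1%:R)%:E)%E.
Proof.
move=> t0.
have mp : measurable_fun [set: R] (fun x : R => x ^+ k.*2).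
  by apply: measurable_funX; exact: measurable_id.
transitivity (\int[lambda]_(x in `](- t)%R, t[) (x ^+ k.*2)%:E)%E.
  rewrite [RHS]integral_mkcond; apply: eq_integral => x _.
  rewrite patchE mem_setE in_itv /= -ltr_norml.
  by case: ifP => _; rewrite ?mule1 ?mule0.
rewrite -(integral_itv_bndoo true false); last first.
  by apply/measurable_EFinP; exact: measurable_funTS.
pose F (x : R) := k.*2.+1%:R^-1 * x ^+ k.*2.+1.
have dF x : is_derive x (1 : R) F (x ^+ k.*2).
  apply: (is_derive_eq (is_deriveZ k.*2.+1%:R^-1 (is_derive_pow k.*2.+1 x))).
  by rewrite /GRing.scale /= mulKf // pnatr_eq0.
have cF : continuous F.
  by move=> x; apply/differentiable_continuous/derivable1_diffP; exact: (@ex_derive _ _ _ _ _ _ _ (dF x)).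
rewrite (@continuous_FTC2 _ (fun x : R => x ^+ k.*2) F).
- rewrite -EFinB /F; congr EFin; rewrite exprNn -signr_odd /= odd_double expr1.
  by field; rewrite ?natr1 ?nat1r pnatr_eq0.
- by rewrite gtrN.
- apply: continuous_subspaceT => x; apply/differentiable_continuous/derivable1_diffP.
  exact: (@ex_derive _ _ _ _ _ _ _ (is_derive_pow k.*2 x)).
- split=> [x _||].
  + exact: (@ex_derive _ _ _ _ _ _ _ (dF x)).
  + by apply: cvg_at_right_filter; exact: cF.
  + by apply: cvg_at_left_filter; exact: cF.
- by move=> x _; rewrite derive1E; exact: derive_val.
Qed.

(** The layer cake plays the part of integration by parts: [e^(-x^2)] is the tail of [2 t e^(-t^2)],
    and the integral of [x^(2k)] over []-t, t[] is [2 t^(2k+1) / (2k+1)]. Their product is, on the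
    half-line, the integrand of the next even moment. *)
Lemma gauss_pow_even_rec (k : nat) :
  (\int[lambda]_x (gauss_pow k.*2 x)%:E =
   (2 / k.*2.+1%:R)%:E * \int[lambda]_x (gauss_pow k.+1.*2 x)%:E)%E.
Proof.
transitivity (\int[lambda]_x ((x ^+ k.*2)%:E * (expR (- `|x| ^+ 2))%:E))%E.
  by apply: eq_integral => x _; rewrite -EFinM real_normK ?num_real.
etransitivity.
  apply: (layer_cake (T := measurableTypeR R) lambda (f := fun x => (x ^+ k.*2)%:E)
    (rho := @Num.norm _ _) (k := fun t => 2 * gauss_pow 1 t) (h := fun s => expR (- s ^+ 2))).
  - by apply/measurable_EFinP; apply: measurable_funX; exact: measurable_id.
  - by move=> x; rewrite lee_fin -muln2 exprM sqr_ge0.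
  - exact: normr_measurable.
  - by [].
  - by apply: measurable_funM => //; exact: measurable_gauss_pow.
  - by move=> t t0; rewrite mulr_ge0 ?mulr_ge0 ?expR_ge0 // expr1.
  - exact: tail_integral_gauss.
rewrite (ge0_symfun_integralT (f := gauss_pow k.+1.*2)); last 3 first.
- by move=> x; exact: gauss_pow_even_ge0.
- exact: continuous_gauss_pow.
- by move=> x /=; rewrite /gauss_pow exprNn -signr_odd odd_double mul1r sqrrN.
have mD : measurable ([set x | 0 <= x] : set (measurableTypeR R)).
  by rewrite -set_itvcy; exact: measurable_itv.
have mg : measurable_fun ([set x | 0 <= x] : set (measurableTypeR R))
    (fun x => (gauss_pow k.+1.*2 x)%:E).
  by apply: measurable_funTS; apply/measurable_EFinP; exact: measurable_gauss_pow.
rewrite -ge0_integralZl_EFin //; last by move=> x _; rewrite lee_fin gauss_pow_even_ge0.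
rewrite -ge0_integralZl_EFin //; last 2 first.
- by move=> x _; rewrite mule_ge0 // lee_fin gauss_pow_even_ge0.
- exact: measurable_funeM.
rewrite [RHS]integral_mkcond; apply: eq_integral => t _.
rewrite patchE (_ : (t \in _) = (0 <= t)); last by apply/idP/idP; rewrite inE.
have [t0|t0|->] := ltrgt0P t.
- rewrite integral_pow_sym // -!EFinM; congr EFin.
  by rewrite /gauss_pow doubleS !exprS expr0; field; rewrite ?natr1 ?nat1r ?pnatr_eq0.
- rewrite integral0_eq ?mule0 // => x _.
  by rewrite ltNge (le_trans (ltW t0)) ?mule0.
- by rewrite /gauss_pow doubleS !exprS !mul0r mulr0 mul0e !mule0.
Qed.

Lemma gauss_pow_even_integral (k : nat) :
  (\int[lambda]_x (gauss_pow k.*2 x)%:E =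
   (Num.sqrt pi * k.*2`!%:R / (4 ^+ k * k`!%:R))%:E)%E.
Proof.
elim: k => [|k IH].
  rewrite expr0 mul1r divr1 mulr1 -integralT_gauss; apply: eq_integral => x _.
  by rewrite /gauss_pow expr0 mul1r.
have := gauss_pow_even_rec k; rewrite IH => E.
have P : (2 / k.*2.+1%:R != 0 :> R) by rewrite mulf_neq0 ?invr_eq0 ?pnatr_eq0.
move/(congr1 (fun e => ((2 / k.*2.+1%:R)^-1)%:E * e)%E) : E.
rewrite muleA -EFinM -EFinM mulVf // mul1e => <-; congr EFin.
rewrite doubleS !factS !natrM exprS.
have -> : k.*2.+2%:R = 2 * k.+1%:R :> R by rewrite -natrM mul2n doubleS.
by field; rewrite ?expf_neq0 ?natr1 ?nat1r ?pnatr_eq0 -?lt0n ?fact_gt0.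
Qed.

Lemma gauss_pow_integrable (k : nat) : lambda.-integrable [set: R] (EFin \o gauss_pow k).
Proof.
have ev j : lambda.-integrable [set: R] (EFin \o gauss_pow j.*2).
  apply/integrableP; split; first by apply/measurable_EFinP; exact: measurable_gauss_pow.
  apply: (@le_lt_trans _ _ (\int[lambda]_x (gauss_pow j.*2 x)%:E)%E).
    rewrite le_eqVlt; apply/orP; left; apply/eqP; apply: eq_integral => x _.
    by rewrite /= ger0_norm // gauss_pow_even_ge0.
  by rewrite gauss_pow_even_integral ltry.
(* Domination by even moments, from [|x|^k <= 1 + x^(2k)]. *)
pose g x := (gauss_pow 0 x + gauss_pow k.*2 x).
apply: (@le_integrable _ (measurableTypeR R) R lambda [set: R] measurableT (EFin \o gauss_pow k) (EFin \o g)) => //.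
- by apply/measurable_EFinP; exact: measurable_gauss_pow.
- move=> x _ /=; rewrite lee_fin /g /gauss_pow -mulrDl !normrM.
  rewrite ler_wpM2r // expr0 -muln2 exprM normrX.
  rewrite [leRHS]ger0_norm ?addr_ge0 ?sqr_ge0 // -[X in _ <= _ + X]real_normK ?num_real // normrX.
  by have := sqr_ge0 (`|x| ^+ k - 1); have := exprn_ge0 k (normr_ge0 x); nra.
- rewrite (_ : EFin \o g = (EFin \o gauss_pow 0) \+ (EFin \o gauss_pow k.*2))%E //.
  by apply: integrableD => //; (exact: (ev 0%N) || exact: ev).
Qed.

Lemma gauss_pow_odd_integral (k : nat) : odd k ->
  \int[lambda]_x gauss_pow k x = 0.
Proof.
move=> ok; rewrite /Rintegral integralE.
(* The reflection [x -> -x] exchanges the positive and the negative part of an odd function. *)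
suff -> : (\int[lambda]_x ((fun x => (gauss_pow k x)%:E)^\- x) =
    \int[lambda]_x ((fun x => (gauss_pow k x)%:E)^\+ x))%E.
  rewrite subee //; have /integrableP[mf fi] := integrable_funepos measurableT (gauss_pow_integrable k).
  rewrite ge0_fin_numE ?integral_ge0 //; apply: le_lt_trans fi.
  by apply: ge0_le_integral => //; [exact: measurableT_comp|move=> x _; exact: lee_abs].
rewrite (lebesgue_factor_opp (f := (fun x => (gauss_pow k x)%:E)^\+)%E) //; last first.
  by apply: measurable_funepos; apply/measurable_EFinP; exact: measurable_gauss_pow.
rewrite mul1e; apply: eq_integral => x _; rewrite funeposE funenegE.
by rewrite mulN1r /gauss_pow sqrrN exprNn -signr_odd ok expr1 mulN1r mulNr EFinN.
Qed.

End GaussianMoments.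

(** * Functions on the sphere and polar integration *)

Section SphereAlgebra.
Context {R : realType} (n : nat).
Local Notation C := R[i].
Implicit Types (z w : cvec R n) (f g : cvec R n -> C).

Lemma num_conjE (c : C) : Num.conj c = conjc c.
Proof. by []. Qed.

Lemma sqmodE (c : C) : sqmod c = normc c ^+ 2.
Proof. by case: c => a b; rewrite /sqmod /= sqr_sqrtr // addr_ge0 ?sqr_ge0. Qed.

Lemma normc_ge0 (c : C) : 0 <= normc c.
Proof. by case: c => a b; exact: sqrtr_ge0. Qed.

Lemma sqmod_ge0 (c : C) : 0 <= sqmod c.
Proof. by rewrite sqmodE sqr_ge0. Qed.

Lemma normc_eq0 (c : C) : (normc c == 0) = (c == 0).
Proof. by apply/eqP/eqP => [/eq0_normc//|->]; exact: normc0. Qed.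

Lemma normc_conjc (c : C) : normc c^* = normc c.
Proof. by case: c => a b; rewrite /= sqrrN. Qed.

Lemma normcX (c : C) k : normc (c ^+ k) = normc c ^+ k.
Proof. by elim: k => [|k IH]; rewrite ?expr0 ?normc1 // !exprS normcM IH. Qed.

Lemma normcR (a : R) : normc a%:C = `|a|.
Proof. by rewrite /= expr0n addr0 sqrtr_sqr. Qed.

Lemma mulcJ (c : C) : c * c^*%C = (sqmod c)%:C.
Proof. by case: c => a b; apply/eqP; rewrite eq_complex /sqmod /= -!expr2; apply/andP; split; apply/eqP; ring. Qed.

Lemma Re_le_normc (c : C) : `|complex.Re c| <= normc c.
Proof.
case: c => a b /=; rewrite -sqrtr_sqr ler_wsqrtr // lerDl sqr_ge0 //.
Qed.

Lemma Im_le_normc (c : C) : `|complex.Im c| <= normc c.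
Proof.
case: c => a b /=; rewrite -sqrtr_sqr ler_wsqrtr // lerDr sqr_ge0 //.
Qed.

Definition on_sphere z : Prop := cnorm2 z = 1.

Inductive sphere_alg : (cvec R n -> C) -> Prop :=
| sphere_alg_cst c : sphere_alg (fun=> c)
| sphere_alg_coord j : sphere_alg (fun z => z j)
| sphere_alg_conj f : sphere_alg f -> sphere_alg (fun z => (f z)^*)
| sphere_alg_add f g : sphere_alg f -> sphere_alg g -> sphere_alg (fun z => f z + g z)
| sphere_alg_mul f g : sphere_alg f -> sphere_alg g -> sphere_alg (fun z => f z * g z)
| sphere_alg_inv f e : sphere_alg f -> 0 < e -> (forall z, on_sphere z -> e <= normc (f z)) ->
    sphere_alg (fun z => (f z)^-1).

Lemma sphere_alg_bounded f : sphere_alg f ->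
  exists2 M, 0 <= M & forall z, on_sphere z -> normc (f z) <= M.
Proof.
elim=> {f} [c|j|f _ [M M0 HM]|f g _ [M M0 HM] _ [N N0 HN]|f g _ [M M0 HM] _ [N N0 HN]|f e _ _ e0 He].
- by exists (normc c) => //; exact: normc_ge0.
- exists 1 => // z; rewrite /on_sphere /cnorm2 => z1.
  rewrite -(ler_pXn2r (n := 2)) ?nnegrE ?normc_ge0 // expr1n -sqmodE -z1.
  rewrite (bigD1 j) //= lerDl sumr_ge0 // => i _; exact: sqmod_ge0.
- by exists M => // z /HM; rewrite normc_conjc.
- exists (M + N) => [|z Sz]; first exact: addr_ge0.
  by apply: le_trans (le_normcD _ _) _; apply: lerD; [exact: HM|exact: HN].
- exists (M * N) => [|z Sz]; first exact: mulr_ge0.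
  by rewrite normcM ler_pM ?normc_ge0 ?HM ?HN.
- exists e^-1 => [|z Sz]; first by rewrite invr_ge0 ltW.
  by rewrite normcV lef_pV2 ?posrE ?He // (lt_le_trans e0) ?He.
Qed.

Definition cmeasurable d (T : measurableType d) (f : T -> C) : Prop :=
  measurable_fun [set: T] (fun t => complex.Re (f t)) /\
  measurable_fun [set: T] (fun t => complex.Im (f t)).

Lemma measurable_fun_ge0_inv d (T : measurableType d) (f : T -> R) :
  measurable_fun [set: T] f -> (forall t, 0 <= f t) ->
  measurable_fun [set: T] (fun t => (f t)^-1).
Proof.
move=> mf f0; have -> : (fun t => (f t)^-1) = (fun t => powR (f t) (-1)).
  by apply/funext => t; rewrite powR_inv1.
exact: (measurableT_comp (measurable_powR (-1)) mf).
Qed.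

Lemma measurable_fun_sqrt d (T : measurableType d) (f : T -> R) :
  measurable_fun [set: T] f -> (forall t, 0 <= f t) ->
  measurable_fun [set: T] (fun t => Num.sqrt (f t)).
Proof.
move=> mf f0; have -> : (fun t => Num.sqrt (f t)) = (fun t => powR (f t) 2^-1).
  by apply/funext => t; rewrite powR12_sqrt.
exact: (measurableT_comp (measurable_powR _) mf).
Qed.

Section Measurability.
Context d (T : measurableType d).

Lemma cmeasurable_add (f g : T -> C) : cmeasurable f -> cmeasurable g ->
  cmeasurable (fun t => f t + g t).
Proof.
move=> [f1 f2] [g1 g2]; split.
- have -> : (fun t => complex.Re (f t + g t)) = (fun t => complex.Re (f t) + complex.Re (g t)).
    by apply/funext => t; case: (f t) (g t) => [? ?] [? ?].
  exact: measurable_funD.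
- have -> : (fun t => complex.Im (f t + g t)) = (fun t => complex.Im (f t) + complex.Im (g t)).
    by apply/funext => t; case: (f t) (g t) => [? ?] [? ?].
  exact: measurable_funD.
Qed.

Lemma cmeasurable_mul (f g : T -> C) : cmeasurable f -> cmeasurable g ->
  cmeasurable (fun t => f t * g t).
Proof.
move=> [f1 f2] [g1 g2]; split.
- have -> : (fun t => complex.Re (f t * g t)) =
      (fun t => complex.Re (f t) * complex.Re (g t) - complex.Im (f t) * complex.Im (g t)).
    by apply/funext => t; case: (f t) (g t) => [? ?] [? ?].
  by apply: measurable_funB; exact: measurable_funM.
- have -> : (fun t => complex.Im (f t * g t)) =
      (fun t => complex.Re (f t) * complex.Im (g t) + complex.Im (f t) * complex.Re (g t)).
    by apply/funext => t; case: (f t) (g t) => [? ?] [? ?].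
  by apply: measurable_funD; exact: measurable_funM.
Qed.

Lemma cmeasurable_conj (f : T -> C) : cmeasurable f -> cmeasurable (fun t => (f t)^*).
Proof.
move=> [f1 f2]; split.
- have -> : (fun t => complex.Re (f t)^*) = (fun t => complex.Re (f t)).
    by apply/funext => t; case: (f t).
  by [].
- have -> : (fun t => complex.Im (f t)^*) = (fun t => - complex.Im (f t)).
    by apply/funext => t; case: (f t).
  exact: measurable_funN.
Qed.

Lemma cmeasurable_real (f : T -> R) : measurable_fun [set: T] f ->
  cmeasurable (fun t => (f t)%:C).
Proof. by move=> mf; split => //=; exact: measurable_cst. Qed.

Lemma cmeasurable_inv (f : T -> C) : cmeasurable f -> cmeasurable (fun t => (f t)^-1).
Proof.
move=> mf; have -> : (fun t => (f t)^-1) =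
    (fun t => (f t)^*%C * ((sqmod (f t))^-1)%:C).
  apply/funext => t; have [->|f0] := eqVneq (f t) 0; first by rewrite invr0 rmorph0 mul0r.
  apply: (mulfI f0); rewrite divff // mulrA mulcJ -rmorphM /= divff //.
  by rewrite sqmodE expf_eq0 /= normc_eq0.
apply: cmeasurable_mul; first exact: cmeasurable_conj.
apply: cmeasurable_real; apply: measurable_fun_ge0_inv => [|t]; last exact: sqmod_ge0.
by case: mf => f1 f2; apply: measurable_funD; exact: measurable_funX.
Qed.

Lemma measurable_sum (I : Type) (s : seq I) (h : I -> T -> R) :
  (forall i, measurable_fun [set: T] (h i)) ->
  measurable_fun [set: T] (fun t => \sum_(i <- s) h i t).
Proof.
move=> mh; elim: s => [|i s IH].
  by under eq_fun do rewrite big_nil; exact: measurable_cst.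
by under eq_fun do rewrite big_cons; exact: measurable_funD.
Qed.

Lemma sphere_alg_cmeasurable f (zeta : T -> cvec R n) :
  (forall j, cmeasurable (fun t => zeta t j)) -> sphere_alg f ->
  cmeasurable (fun t => f (zeta t)).
Proof.
move=> mz; elim=> {f} [c|j|f _ IH|f g _ IHf _ IHg|f g _ IHf _ IHg|f e _ IH _ _].
- by split; exact: measurable_cst.
- exact: mz.
- exact: cmeasurable_conj.
- exact: cmeasurable_add.
- exact: cmeasurable_mul.
- exact: cmeasurable_inv.
Qed.

Lemma measurable_cnorm2_toC (X : T -> nat -> R) :
  (forall k, measurable_fun [set: T] (fun t => X t k)) ->
  measurable_fun [set: T] (fun t => cnorm2 (@toC R n (X t))).
Proof.
move=> mX; apply: measurable_sum => j; rewrite /sqmod /=.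
by apply: measurable_funD; exact: measurable_funX.
Qed.

Lemma cmeasurable_sphere_proj (X : T -> nat -> R) j :
  (forall k, measurable_fun [set: T] (fun t => X t k)) ->
  cmeasurable (fun t => sphere_proj (@toC R n (X t)) j).
Proof.
move=> mX; apply: cmeasurable_mul; first by split; exact: mX.
apply: cmeasurable_real; apply: measurable_fun_ge0_inv => [|t]; last exact: sqrtr_ge0.
apply: measurable_fun_sqrt; first exact: measurable_cnorm2_toC.
by move=> t; apply: sumr_ge0 => i _; exact: sqmod_ge0.
Qed.

End Measurability.

Lemma cnorm2_ge0 z : 0 <= cnorm2 z.
Proof. by apply: sumr_ge0 => j _; exact: sqmod_ge0. Qed.

Lemma sqmodM (c c' : C) : sqmod (c * c') = sqmod c * sqmod c'.
Proof. by rewrite !sqmodE normcM exprMn. Qed.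

Lemma sqmodR (a : R) : sqmod a%:C = a ^+ 2.
Proof. by rewrite /sqmod /= expr0n addr0. Qed.

Lemma cnorm2_scale (a : R) z : cnorm2 (fun j => z j * a%:C) = cnorm2 z * a ^+ 2.
Proof. by rewrite /cnorm2 mulr_suml; apply: eq_bigr => j _; rewrite sqmodM sqmodR. Qed.

Lemma sphere_proj_on_sphere z : 0 < cnorm2 z -> on_sphere (sphere_proj z).
Proof.
move=> z0; rewrite /on_sphere cnorm2_scale exprVn sqr_sqrtr ?cnorm2_ge0 //.
by rewrite divff // gt_eqF.
Qed.

End SphereAlgebra.

Section Radial.
Context {R : realType} (n : nat).
Local Notation C := R[i].
Local Notation lambda := (@lebesgue_measure R).
Implicit Types (x : nat -> R) (f : cvec R n -> R).

Definition seq_norm2 x : R := cnorm2 (@toC R n x).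
Definition seq_proj x : cvec R n := sphere_proj (@toC R n x).

Lemma sum_even_odd (V : zmodType) (F : nat -> V) m :
  \sum_(k < 2 * m) F k = \sum_(j < m) (F (2 * j)%N + F (2 * j).+1).
Proof.
elim: m => [|m IH]; first by rewrite !big_ord0.
by rewrite mulnS !addSn add0n !big_ord_recr /= IH addrA.
Qed.

Lemma seq_norm2E x : seq_norm2 x = \sum_(k < 2 * n) x k ^+ 2.
Proof. by rewrite (sum_even_odd (fun k => x k ^+ 2)). Qed.

Lemma seq_norm2_ge0 x : 0 <= seq_norm2 x.
Proof. exact: cnorm2_ge0. Qed.

Lemma toC_scale (c : R) x j : @toC R n (fun k => c * x k) j = @toC R n x j * c%:C.
Proof. by apply/eqP; rewrite eq_complex /=; apply/andP; split; apply/eqP; ring. Qed.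

Lemma seq_norm2_scale (c : R) x : seq_norm2 (fun k => c * x k) = c ^+ 2 * seq_norm2 x.
Proof. by rewrite !seq_norm2E mulr_sumr; apply: eq_bigr => k _; rewrite exprMn. Qed.

(** Keeping the sign of [c] lets one formula serve both the dilations and the antipodal map. *)
Lemma seq_proj_scale (c : R) x : seq_proj (fun k => c * x k) = (fun j => seq_proj x j * (Num.sg c)%:C).
Proof.
apply/funext => j; rewrite /seq_proj /sphere_proj toC_scale -/(seq_norm2 _) seq_norm2_scale.
rewrite sqrtrM ?sqr_ge0 // sqrtr_sqr -!mulrA; congr (_ * _).
rewrite -!rmorphM /=; congr (_%:C).
have [->|c0] := eqVneq c 0; first by rewrite sgr0 !mul0r mulr0.
by rewrite invfM -{1}[c]mulr_sg_norm -mulrA [`|c| * _]mulrA divff ?normr_eq0 // mul1r mulrC.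
Qed.

Lemma seq_proj_on_sphere x : 0 < seq_norm2 x -> on_sphere (seq_proj x).
Proof. exact: sphere_proj_on_sphere. Qed.

Lemma coord_measurable_seq_norm2 : coord_measurable seq_norm2.
Proof. by move=> d T X mX; exact: measurable_cnorm2_toC. Qed.

Definition sphere_measurable f : Prop := coord_measurable (fun x => f (seq_proj x)).

(** The extension of [f] that is constant along rays, cut to the ball of squared radius [tau]; for
    [tau = 1] this is the integrand of [sphere_int]. The origin is removed because its projection is
    not on the sphere. *)
Definition annular f (tau : R) x : R :=
  if (0 < seq_norm2 x) && (seq_norm2 x < tau) then f (seq_proj x) else 0.

Definition punctured f x : R := if 0 < seq_norm2 x then f (seq_proj x) else 0.

Lemma coord_measurable_punctured f : sphere_measurable f -> coord_measurable (punctured f).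
Proof.
move=> mf d T X mX; apply: measurable_fun_ifT; [|exact: mf|exact: measurable_cst].
apply: measurable_fun_ltr; first exact: measurable_cst.
exact: coord_measurable_seq_norm2.
Qed.

Lemma coord_measurable_annular f tau : sphere_measurable f -> coord_measurable (annular f tau).
Proof.
move=> mf d T X mX; apply: measurable_fun_ifT; [|exact: mf|exact: measurable_cst].
have mN := coord_measurable_seq_norm2 mX.
by apply: measurable_and; apply: measurable_fun_ltr => //; exact: measurable_cst.
Qed.

Definition sphere_ge0 f : Prop := forall z, on_sphere z -> 0 <= f z.

Lemma annular_ge0 f tau x : sphere_ge0 f -> 0 <= annular f tau x.
Proof. by move=> f0; rewrite /annular; case: ifP => // /andP[x0 _]; exact: f0 (seq_proj_on_sphere x0). Qed.

Lemma punctured_ge0 f x : sphere_ge0 f -> 0 <= punctured f x.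
Proof. by move=> f0; rewrite /punctured; case: ifP => // x0; exact: f0 (seq_proj_on_sphere x0). Qed.

(** Dilation by the square root of [tau] in real dimension [2 * n]. *)
Lemma leb_iter_annular f (tau : R) : 0 < tau -> sphere_measurable f -> sphere_ge0 f ->
  leb_iter (2 * n) (fun x => (annular f tau x)%:E) =
  ((tau ^+ n)%:E * leb_iter (2 * n) (fun x => (annular f 1 x)%:E))%E.
Proof.
move=> t0 mf f0; have s0 : 0 < Num.sqrt tau by rewrite sqrtr_gt0.
rewrite (leb_iter_scale _ (lebesgue_factor_pos s0)) ?sqrtr_ge0 //; last 2 first.
- move=> d T X mX; apply/measurable_EFinP; exact: coord_measurable_annular.
- by move=> x; rewrite lee_fin annular_ge0.
rewrite exprM sqr_sqrtr ?ltW //; congr (_ * leb_iter _ _)%E.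
apply/funext => x; congr EFin.
rewrite /annular seq_norm2_scale seq_proj_scale gtr0_sg // sqr_sqrtr ?ltW //.
rewrite pmulr_rgt0 // (_ : (_ < tau) = (seq_norm2 x < 1)); last by rewrite gtr_pMr.
by case: ifP => // _; congr f; apply/funext => j; rewrite mulr1.
Qed.

Context d (T : measurableType d) (mu : {sigma_finite_measure set T -> \bar R})
  (X : T -> nat -> R) (HX : leb_model (2 * n) mu X).

Local Notation mX := (leb_model_meas HX).

Lemma integral_annular f tau : sphere_measurable f -> sphere_ge0 f ->
  leb_iter (2 * n) (fun x => (annular f tau x)%:E) = (\int[mu]_t (annular f tau (X t))%:E)%E.
Proof.
move=> mf f0; apply: (leb_model_iter HX).
  by move=> d' T' X' mX'; apply/measurable_EFinP; exact: coord_measurable_annular.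
by move=> x; rewrite lee_fin annular_ge0.
Qed.

(** Layer cake for the squared norm: the ball of squared radius [t] contributes [t^n] times the unit
    ball, and the integral of [t^(n+N) e^(-t)] over the half-line is [(n+N)!]. *)
Lemma integral_punctured_incgamma f N : sphere_measurable f -> sphere_ge0 f ->
  (\int[mu]_t ((punctured f (X t))%:E * (incgamma N (seq_norm2 (X t)))%:E) =
   ((n + N)`!%:R)%:E * \int[mu]_t (annular f 1 (X t))%:E)%E.
Proof.
move=> mf f0.
have mp : measurable_fun [set: T] (fun t => punctured f (X t)).
  exact: (coord_measurable_punctured mf mX).
etransitivity.
  apply: (layer_cake mu (f := fun t => (punctured f (X t))%:E)
    (rho := fun t => seq_norm2 (X t)) (k := fun t : R => t ^+ N * expR (- t)) (h := incgamma N)).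
  - exact/measurable_EFinP.
  - by move=> t; rewrite lee_fin punctured_ge0.
  - exact: (coord_measurable_seq_norm2 mX).
  - by move=> t; exact: seq_norm2_ge0.
  - by apply: continuous_measurable_fun; exact: continuous_powexpN.
  - by move=> t t0; rewrite mulr_ge0 ?exprn_ge0 ?expR_ge0.
  - exact: tail_integral_gamma.
set A := (\int[mu]_t (annular f 1 (X t))%:E)%E.
transitivity (\int[lambda]_s ((s ^+ (n + N) * expR (- s) * (0 < s)%R%:R)%:E * A))%E.
  apply: eq_integral => s _.
  rewrite (_ : (\int[mu]_x _)%E = \int[mu]_t (annular f s (X t))%:E)%E; last first.
    apply: eq_integral => t _; rewrite -EFinM; congr EFin; rewrite /punctured /annular.
    by case: (0 < _) => /=; case: (_ < s); rewrite ?mulr1 ?mulr0.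
  have [s0|s0] := ltP 0 s.
    rewrite -integral_annular // leb_iter_annular // integral_annular // muleA -EFinM mulr1.
    by congr (_%:E * _)%E; rewrite exprD; ring.
  rewrite mulr0 mul0e integral0_eq ?mule0 // => t _; rewrite /annular.
  case: ifP => // /andP[t0 ts]; have := lt_le_trans (lt_trans t0 ts) s0.
  by rewrite ltxx.
have mg : measurable_fun [set: R] (fun s : R => s ^+ (n + N) * expR (- s) * (0 < s)%R%:R).
  apply: measurable_funM; first by apply: continuous_measurable_fun; exact: continuous_powexpN.
  rewrite (_ : (fun _ => _) = (fun s : R => if 0 < s then 1 else 0)); last first.
    by apply/funext => s; case: ifP.
  by apply: measurable_fun_ifT => //; apply: measurable_fun_ltr.
rewrite ge0_integralZr //.
- by rewrite (tail_integral_gamma (n + N)) // incgamma0.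
- exact/measurable_EFinP.
- move=> s _; rewrite lee_fin; case: ltP => [s0|]; last by rewrite mulr0.
  by rewrite mulr1 mulr_ge0 ?exprn_ge0 ?expR_ge0 // ltW.
- by apply: integral_ge0 => t _; rewrite lee_fin annular_ge0.
Qed.

End Radial.

Section RadialMoments.
Context {R : realType} (n : nat) (n0 : (0 < n)%N).
Local Notation C := R[i].
Implicit Types (f g : cvec R n -> R).
Context d (T : measurableType d) (mu : {sigma_finite_measure set T -> \bar R})
  (X : T -> nat -> R) (HX : leb_model (2 * n) mu X).

Local Notation mX := (leb_model_meas HX).
Local Notation q t := (@seq_norm2 R n (X t)).
Local Notation annX f t := (@annular R n f 1 (X t)).
Local Notation puncX f t := (@punctured R n f (X t)).

Lemma seq_norm2_measurable : measurable_fun [set: T] (fun t => q t).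
Proof. exact: (coord_measurable_seq_norm2 n mX). Qed.

Lemma gauss_weight_integral :
  mu.-integrable [set: T] (fun t => (expR (- q t))%:E) /\
  (\int[mu]_t (expR (- q t))%:E = (pi ^+ n)%:E)%E.
Proof.
have [pi1 pE] := leb_model_prod HX (g := fun=> gauss_pow 0) (fun=> gauss_pow_integrable 0).
have E t : \prod_(k < 2 * n) gauss_pow 0 (X t k) = expR (- q t).
  rewrite seq_norm2E -sumrN expR_sum; apply: eq_bigr => k _.
  by rewrite /gauss_pow expr0 mul1r.
have S : \int[@lebesgue_measure R]_t gauss_pow 0 t = Num.sqrt pi.
  by rewrite /Rintegral (gauss_pow_even_integral 0) /= expr0 !mulr1 invr1 mulr1.
split; first by under eq_fun do rewrite -E.
under eq_integral do rewrite -E.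
by rewrite pE S prodr_const card_ord exprM sqr_sqrtr // pi_ge0.
Qed.

(** The origin is invariant under doubling, so its measure equals [2^(2n)] times itself; it is
    finite by comparison with the Gaussian, hence zero. *)
Lemma norm2_eq0_null : (\int[mu]_t ((q t == 0)%:R)%:E = 0)%E.
Proof.
pose F (x : nat -> R) : \bar R := ((@seq_norm2 R n x == 0)%:R)%:E.
have mF : coord_measurable F.
  move=> d' T' X' mX'; apply/measurable_EFinP.
  rewrite (_ : (fun _ => _) = (fun t => if @seq_norm2 R n (X' t) == 0 then 1 else 0)); last first.
    by apply/funext => t; case: ifP.
  apply: measurable_fun_ifT => //; apply: measurable_fun_eqr => //.
  exact: (coord_measurable_seq_norm2 n mX').
have F0 x : (0 <= F x)%E by rewrite lee_fin ler0n.
have c2 : (0 : R) < 2 by [].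
have := leb_iter_scale (2 * n) (lebesgue_factor_pos c2) (ltW c2) mF F0.
have -> : (fun x => F (fun j => 2 * x j)) = F.
  by apply/funext => x; rewrite /F seq_norm2_scale mulf_eq0 expf_eq0 pnatr_eq0.
rewrite (leb_model_iter HX mF F0) -/(F _).
set v := (\int[mu]_t F (X t))%E.
have vfin : v \is a fin_num.
  rewrite ge0_fin_numE ?integral_ge0 //.
  have [wi wE] := gauss_weight_integral.
  apply: (@le_lt_trans _ _ (\int[mu]_t (expR (- q t))%:E)%E); last by rewrite wE ltry.
  apply: ge0_le_integral => //.
  - exact: (mF _ _ _ mX).
  - by case/integrableP: wi.
  - move=> t _; rewrite lee_fin; case: eqP => [->|_]; last exact: expR_ge0.
    by rewrite oppr0 expR0.
rewrite -(fineK vfin) -EFinM => -[E]; congr EFin; apply/eqP.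
have : (2 ^+ (2 * n) - 1) * fine v = 0 by rewrite mulrBl mul1r -E subrr.
move/eqP; rewrite mulf_eq0 => /orP[|//].
rewrite subr_eq0 gt_eqF // exprn_egt1 ?ltr1n // muln_eq0 negb_or /=.
by rewrite -lt0n.
Qed.

Definition sphere_bounded f : Prop := exists M, forall z, on_sphere z -> `|f z| <= M.

Definition ball_integral f : R := \int[mu]_t annX f t.

Lemma annular_measurable f : sphere_measurable f -> measurable_fun [set: T] (fun t => annX f t).
Proof. by move=> mf; exact: (coord_measurable_annular 1 mf mX). Qed.

Lemma punctured_measurable f : sphere_measurable f -> measurable_fun [set: T] (fun t => puncX f t).
Proof. by move=> mf; exact: (coord_measurable_punctured mf mX). Qed.

Lemma sphere_measurable_cst (c : R) : sphere_measurable (n := n) (fun=> c).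
Proof. by move=> *; exact: measurable_cst. Qed.

Lemma incgamma_ge0 N (s : R) : 0 <= s -> 0 <= incgamma N s.
Proof.
move=> s0; elim: N => [|N IH] /=; first exact: expR_ge0.
by rewrite addr_ge0 ?mulr_ge0 ?exprn_ge0 ?expR_ge0.
Qed.

Lemma measurable_incgamma_q N : measurable_fun [set: T] (fun t => incgamma N (q t)).
Proof.
have mE : measurable_fun [set: T] (fun t => expR (- q t)).
  by have [wi _] := gauss_weight_integral; move: (measurable_int _ wi) => /measurable_EFinP.
elim: N => [//|N IH] /=.
apply: measurable_funD; last exact: measurable_funM.
by apply: measurable_funM => //; apply: measurable_funX; exact: seq_norm2_measurable.
Qed.

(** The volume of the ball is finite because [n!] times it is a Gaussian integral over the punctured
    space, at most [pi^n]. *)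
Lemma annular_one_integrable : mu.-integrable [set: T] (fun t => (annX (fun=> 1) t)%:E).
Proof.
have m1 := sphere_measurable_cst 1.
apply/integrableP; split; first by apply/measurable_EFinP; exact: annular_measurable.
have E := integral_punctured_incgamma HX 0 m1 (fun _ _ => ler01).
rewrite (_ : (\int[mu]_x _)%E = \int[mu]_t (annX (fun=> 1) t)%:E)%E; last first.
  by apply: eq_integral => t _; rewrite /= ger0_norm // annular_ge0.
have [wi wE] := gauss_weight_integral.
have B : ((((n + 0)`!)%:R)%:E * \int[mu]_t (annX (fun=> 1) t)%:E <= (pi ^+ n)%:E :> \bar R)%E.
  rewrite -E -wE; apply: ge0_le_integral => //.
  - by move=> t _; rewrite mule_ge0 // lee_fin ?punctured_ge0 // expR_ge0.
  - apply/measurable_EFinP; apply: measurable_funM; first exact: punctured_measurable.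
    exact: (measurable_incgamma_q 0).
  - by case/integrableP: wi.
  - move=> t _; rewrite -EFinM lee_fin /= ler_piMl ?expR_ge0 //.
    by rewrite /punctured; case: ifP.
rewrite ltNge; apply/negP; rewrite leye_eq => /eqP Ey.
by move: B; rewrite Ey gt0_muley ?lte_fin ?ltr0n ?fact_gt0.
Qed.

Lemma annular_integrable f : sphere_measurable f -> sphere_bounded f ->
  mu.-integrable [set: T] (fun t => (annX f t)%:E).
Proof.
move=> mf [M HM].
apply: (le_integrable measurableT _ _ (integrableZl measurableT M annular_one_integrable)).
  by apply/measurable_EFinP; exact: annular_measurable.
move=> t _; rewrite -EFinM !abse_EFin lee_fin /annular.
case: ifP => [/andP[t0 _]|_]; last by rewrite mulr0.
rewrite mulr1; apply: le_trans (ler_norm _).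
exact: HM (seq_proj_on_sphere t0).
Qed.

End RadialMoments.

Section PolarMoments.
Context {R : realType} (n : nat) (n0 : (0 < n)%N).
Local Notation C := R[i].
Implicit Types (f g : cvec R n -> R).
Context d (T : measurableType d) (mu : {sigma_finite_measure set T -> \bar R})
  (X : T -> nat -> R) (HX : leb_model (2 * n) mu X).

Local Notation mX := (leb_model_meas HX).
Local Notation q t := (@seq_norm2 R n (X t)).
Local Notation annX f t := (@annular R n f 1 (X t)).
Local Notation puncX f t := (@punctured R n f (X t)).


Lemma sphere_measurable_add f g : sphere_measurable f -> sphere_measurable g ->
  sphere_measurable (fun z => f z + g z).
Proof. by move=> mf mg d' T' X' mX'; apply: measurable_funD; [exact: mf|exact: mg]. Qed.

Lemma punctured_incgamma_ge0 f N : sphere_measurable f -> sphere_bounded f -> sphere_ge0 f ->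
  mu.-integrable [set: T] (fun t => (puncX f t * incgamma N (q t))%:E) /\
  \int[mu]_t (puncX f t * incgamma N (q t)) = (n + N)`!%:R * ball_integral mu X f.
Proof.
move=> mf bf f0.
have E := integral_punctured_incgamma HX N mf f0.
have fin : (\int[mu]_t (annX f t)%:E)%E \is a fin_num.
  exact: integrable_fin_num (annular_integrable HX mf bf).
have E' : (\int[mu]_t (puncX f t * incgamma N (q t))%:E =
    ((n + N)`!%:R * ball_integral mu X f)%:E)%E.
  rewrite EFinM /ball_integral /Rintegral fineK // -E.
split; last by rewrite /Rintegral E'.
apply/integrableP; split.
  apply/measurable_EFinP; apply: measurable_funM; first exact: (punctured_measurable HX mf).
  exact: (measurable_incgamma_q HX N).
apply: (@le_lt_trans _ _ (\int[mu]_t (puncX f t * incgamma N (q t))%:E)%E).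
  rewrite le_eqVlt; apply/orP; left; apply/eqP; apply: eq_integral => t _ /=.
  by rewrite ger0_norm // mulr_ge0 ?punctured_ge0 ?incgamma_ge0 ?seq_norm2_ge0.
by rewrite E' ltry.
Qed.

Lemma punctured_incgamma f N : sphere_measurable f -> sphere_bounded f ->
  mu.-integrable [set: T] (fun t => (puncX f t * incgamma N (q t))%:E) /\
  \int[mu]_t (puncX f t * incgamma N (q t)) = (n + N)`!%:R * ball_integral mu X f.
Proof.
move=> mf [M HM].
(* The layer cake is available for nonnegative functions: shift [f] by its bound, then subtract the
   constant again. *)
pose g (z : cvec R n) := f z + `|M|.
have mM := @sphere_measurable_cst R n `|M|.
have mg : sphere_measurable g by exact: sphere_measurable_add.
have bM : sphere_bounded (fun _ : cvec R n => `|M|) by exists `|M| => z _; rewrite normr_id.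
have bg : sphere_bounded g.
  exists (`|M| + `|M|) => z Sz; apply: le_trans (ler_normD _ _) _.
  by rewrite normr_id lerD2r (le_trans (HM z Sz)) ?ler_norm.
have g0 : sphere_ge0 g.
  move=> z Sz; rewrite /g -lerBlDr sub0r.
  by have := HM z Sz; rewrite ler_norml => /andP[H _]; apply: le_trans H; rewrite lerN2 ler_norm.
have [ig eg] := punctured_incgamma_ge0 N mg bg g0.
have [im em] := punctured_incgamma_ge0 N mM bM (fun _ _ => normr_ge0 M).
have E t : puncX f t * incgamma N (q t) =
   puncX g t * incgamma N (q t) - puncX (fun=> `|M|) t * incgamma N (q t).
  by rewrite -mulrBl /punctured /g; case: ifP => _; rewrite ?addrK ?subrr.
split.
  under eq_fun do rewrite E EFinB; exact: integrableB.
under eq_Rintegral do rewrite E.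
rewrite RintegralB // eg em -mulrBr /ball_integral; congr (_ * _).
rewrite -RintegralB //; [|exact: (annular_integrable HX)..].
by apply: eq_Rintegral => t _; rewrite /annular /g; case: ifP => _; rewrite ?addrK ?subrr.
Qed.

(** By the recursion of [incgamma], the weight [q^(N+1) e^(-q)] is
    [incgamma (N+1) - (N+1) incgamma N], and [(n+N+1)! - (N+1) (n+N)! = n (n+N)!]. *)
Lemma radial_moment f N : sphere_measurable f -> sphere_bounded f ->
  mu.-integrable [set: T] (fun t => (puncX f t * (q t ^+ N * expR (- q t)))%:E) /\
  \int[mu]_t (puncX f t * (q t ^+ N * expR (- q t))) =
    (n * (n + N).-1`!)%:R * ball_integral mu X f.
Proof.
move=> mf bf; case: N => [|N].
  have [i e] := punctured_incgamma 0 mf bf.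
  split; first by under eq_fun do rewrite expr0 mul1r.
  under eq_Rintegral do rewrite expr0 mul1r.
  by rewrite e addn0 -{1}(prednK n0) factS prednK.
have [i1 e1] := punctured_incgamma N.+1 mf bf.
have [i0 e0] := punctured_incgamma N mf bf.
have E t : puncX f t * (q t ^+ N.+1 * expR (- q t)) =
   puncX f t * incgamma N.+1 (q t) - N.+1%:R * (puncX f t * incgamma N (q t)).
  by rewrite /=; ring.
have i0' : mu.-integrable [set: T] (EFin \o (fun t => N.+1%:R * (puncX f t * incgamma N (q t)))).
  rewrite (_ : _ \o _ = (fun t => N.+1%:R%:E * (puncX f t * incgamma N (q t))%:E)%E) //.
  exact: integrableZl.
split.
  by under eq_fun do rewrite E EFinB; exact: integrableB.
under eq_Rintegral do rewrite E.
rewrite RintegralB // RintegralZl // e1 e0 mulrA -mulrBl; congr (_ * _).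
rewrite addnS factS /= natrM -mulrBl -natrB; last by rewrite -addnS leq_addl.
by rewrite -natrM; congr (_ * _)%:R; rewrite -addnS addnK.
Qed.

Lemma ball_integral_odd f : sphere_measurable f -> sphere_bounded f ->
  (forall z, f (fun j => - z j) = - f z) -> ball_integral mu X f = 0.
Proof.
move=> mf [M HM] fN.
(* The reflection formula for [leb_iter] concerns nonnegative integrands; [|M| + f] and [|M| - f]
   are nonnegative on the sphere and are exchanged by the antipodal map. *)
pose g (z : cvec R n) := `|M| + f z.
pose h (z : cvec R n) := `|M| - f z.
have mM := @sphere_measurable_cst R n `|M|.
have mg : sphere_measurable g by exact: sphere_measurable_add.
have mh : sphere_measurable h.
  by move=> d' T' X' mX'; apply: measurable_funB; [exact: mM|exact: mf].
have B z : on_sphere z -> - `|M| <= f z <= `|M|.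
  by move=> Sz; rewrite -ler_norml (le_trans (HM z Sz)) ?ler_norm.
have g0 : sphere_ge0 g by move=> z /B; rewrite /g; lra.
have h0 : sphere_ge0 h by move=> z /B; rewrite /h; lra.
have bg : sphere_bounded g.
  by exists (`|M| + `|M|) => z Sz; rewrite /g ler_norml; have := B z Sz; lra.
have bh : sphere_bounded h.
  by exists (`|M| + `|M|) => z Sz; rewrite /h ler_norml; have := B z Sz; lra.
have E : ball_integral mu X g = ball_integral mu X h.
  rewrite /ball_integral /Rintegral -!(integral_annular HX) //.
  rewrite (leb_iter_scale _ (lebesgue_factor_opp)) //; last 2 first.
  - by move=> d' T' X' mX'; apply/measurable_EFinP; exact: coord_measurable_annular.
  - by move=> x; rewrite lee_fin annular_ge0.
  rewrite expr1n mul1e; congr (fine (leb_iter _ _)); apply/funext => x; congr EFin.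
  rewrite /annular seq_norm2_scale seq_proj_scale sqrrN expr1n mul1r.
  case: ifP => // _; rewrite ltr0_sg ?ltrN10 // /g /h -fN; congr (_ + f _).
  by apply/funext => j; rewrite rmorphN1 mulrN1.
have := E; rewrite /ball_integral.
have ig := annular_integrable HX mg bg.
have ih := annular_integrable HX mh bh.
have ef t : annX f t = 2^-1 * (annX g t - annX h t).
  by rewrite /annular /g /h; case: ifP => _; field.
move=> E'; under eq_Rintegral do rewrite ef.
rewrite RintegralZl //; last by apply: (integrableB _ ig ih).
by rewrite RintegralB // E' subrr mulr0.
Qed.

End PolarMoments.

(** * Moments of the sphere *)

Section ComplexIntegral.
Context {R : realType} d (T : measurableType d) (mu : {measure set T -> \bar R}).
Local Notation C := R[i].
Implicit Types f g : T -> C.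

Definition cintegrable f : Prop :=
  mu.-integrable [set: T] (fun t => (complex.Re (f t))%:E) /\
  mu.-integrable [set: T] (fun t => (complex.Im (f t))%:E).

Definition cintegral f : C :=
  (\int[mu]_t complex.Re (f t)) +i* (\int[mu]_t complex.Im (f t)).

Lemma Re_addc (a b : C) : complex.Re (a + b) = complex.Re a + complex.Re b.
Proof. by case: a b => [? ?] [? ?]. Qed.
Lemma Im_addc (a b : C) : complex.Im (a + b) = complex.Im a + complex.Im b.
Proof. by case: a b => [? ?] [? ?]. Qed.
Lemma Re_mulc (a b : C) : complex.Re (a * b) =
  complex.Re a * complex.Re b - complex.Im a * complex.Im b.
Proof. by case: a b => [? ?] [? ?]. Qed.
Lemma Im_mulc (a b : C) : complex.Im (a * b) =
  complex.Re a * complex.Im b + complex.Im a * complex.Re b.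
Proof. by case: a b => [? ?] [? ?]. Qed.

Lemma cintegrableD f g : cintegrable f -> cintegrable g -> cintegrable (fun t => f t + g t).
Proof.
move=> [f1 f2] [g1 g2]; split.
- by under eq_fun do rewrite Re_addc EFinD; exact: integrableD.
- by under eq_fun do rewrite Im_addc EFinD; exact: integrableD.
Qed.

Lemma cintegralD f g : cintegrable f -> cintegrable g ->
  cintegral (fun t => f t + g t) = cintegral f + cintegral g.
Proof.
move=> [f1 f2] [g1 g2]; rewrite /cintegral.
under eq_Rintegral do rewrite Re_addc.
under [X in _ +i* X = _]eq_Rintegral do rewrite Im_addc.
by rewrite !RintegralD.
Qed.

Lemma integrableZR (h : T -> R) (a : R) :
  mu.-integrable [set: T] (fun t => (h t)%:E) -> mu.-integrable [set: T] (fun t => (a * h t)%:E).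
Proof. by move=> ih; under eq_fun do rewrite EFinM; exact: integrableZl. Qed.

Lemma cintegrableZ (c : C) f : cintegrable f -> cintegrable (fun t => c * f t).
Proof.
move=> [f1 f2]; split.
- under eq_fun do rewrite Re_mulc EFinB; apply: integrableB => //; exact: integrableZR.
- under eq_fun do rewrite Im_mulc EFinD; apply: integrableD => //; exact: integrableZR.
Qed.

Lemma cintegralZ (c : C) f : cintegrable f -> cintegral (fun t => c * f t) = c * cintegral f.
Proof.
move=> [f1 f2]; rewrite /cintegral.
under eq_Rintegral do rewrite Re_mulc.
under [X in _ +i* X = _]eq_Rintegral do rewrite Im_mulc.
rewrite RintegralB ?RintegralD ?RintegralZl //; try exact: integrableZR.
by case: c.
Qed.

Lemma cintegrable0 : cintegrable (fun=> 0).
Proof. by split; exact: integrable0. Qed.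

Lemma cintegral0 : cintegral (fun=> 0) = 0.
Proof. by rewrite /cintegral /Rintegral /= integral0. Qed.

Lemma cintegrable_sum (I : Type) (s : seq I) (F : I -> T -> C) :
  (forall i, cintegrable (F i)) -> cintegrable (fun t => \sum_(i <- s) F i t).
Proof.
move=> iF; elim: s => [|i s IH].
  by under eq_fun do rewrite big_nil; exact: cintegrable0.
by under eq_fun do rewrite big_cons; exact: cintegrableD.
Qed.

Lemma cintegral_sum (I : Type) (s : seq I) (F : I -> T -> C) :
  (forall i, cintegrable (F i)) ->
  cintegral (fun t => \sum_(i <- s) F i t) = \sum_(i <- s) cintegral (F i).
Proof.
move=> iF; elim: s => [|i s IH].
  rewrite big_nil -[RHS]cintegral0; congr (cintegral _); apply/funext => t.
  by rewrite big_nil.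
rewrite big_cons -IH -cintegralD //; last exact: cintegrable_sum.
by congr (cintegral _); apply/funext => t; rewrite big_cons.
Qed.

Lemma cintegrable_real (h : T -> R) :
  mu.-integrable [set: T] (fun t => (h t)%:E) -> cintegrable (fun t => (h t)%:C).
Proof. by move=> ih; split => //=; exact: integrable0. Qed.

Lemma cintegral_real (h : T -> R) : cintegral (fun t => (h t)%:C) = (\int[mu]_t h t)%:C.
Proof. by rewrite /cintegral /= /Rintegral integral0. Qed.

End ComplexIntegral.

Section ComplexGaussian.
Context {R : realType}.
Local Notation C := R[i].

(** The moments of the probability density [e^(-x^2) / sqrt pi]. *)
Definition gauss_moment (N : nat) : R :=
  if odd N then 0 else N`!%:R / (4 ^+ N./2 * N./2`!%:R).

Lemma Rintegral_gauss_pow k :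
  \int[@lebesgue_measure R]_x gauss_pow k x = Num.sqrt pi * gauss_moment k.
Proof.
rewrite /gauss_moment; case: ifP => ok; first by rewrite mulr0 gauss_pow_odd_integral.
have -> : k = k./2.*2 by rewrite even_halfK ?ok.
by rewrite /Rintegral gauss_pow_even_integral /= doubleK mulrA.
Qed.

Lemma sum_even_only (V : zmodType) (F : nat -> V) K :
  (forall i, odd i -> F i = 0) -> \sum_(i < K.*2.+1) F i = \sum_(r < K.+1) F r.*2.
Proof.
move=> F0; elim: K => [|K IH]; first by rewrite !big_ord_recr !big_ord0.
rewrite doubleS big_ord_recr big_ord_recr /= IH [RHS]big_ord_recr /=.
by rewrite (F0 K.*2.+1) ?addr0 //= odd_double.
Qed.

Lemma gauss_moment_bin K r : (r <= K)%N ->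
  'C(K.*2, r.*2)%:R * gauss_moment (K.*2 - r.*2) * gauss_moment r.*2 =
  gauss_moment K.*2 * 'C(K, r)%:R :> R.
Proof.
move=> rK; rewrite -doubleB /gauss_moment !odd_double !doubleK.
have f0 m : m`!%:R != 0 :> R by rewrite pnatr_eq0 -lt0n fact_gt0.
have E1 : 'C(K.*2, r.*2)%:R = (K.*2)`!%:R / ((r.*2)`!%:R * ((K - r).*2)`!%:R) :> R.
  apply: (canRL (mulfK _)); first by rewrite mulf_neq0.
  by rewrite -!natrM doubleB bin_fact // leq_double.
have E2 : 'C(K, r)%:R = K`!%:R / (r`!%:R * (K - r)`!%:R) :> R.
  apply: (canRL (mulfK _)); first by rewrite mulf_neq0.
  by rewrite -!natrM bin_fact.
have E3 : 4 ^+ K = 4 ^+ r * 4 ^+ (K - r) :> R by rewrite -exprD subnKC.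
rewrite E1 E2 E3; field; rewrite !f0 ?expf_neq0 //.
Qed.

(** Algebraic form of the rule that variances of independent Gaussians add. [s] is the sum of
    squares of the coefficients treated so far and may be any complex number; no square root of it
    is taken, since odd moments vanish. *)
Lemma gauss_moment_convolution (s p : C) N :
  \sum_(i < N.+1) ('C(N, i)%:R * p ^+ i * (gauss_moment i)%:C *
     ((gauss_moment (N - i))%:C * s ^+ (N - i)./2)) =
  (gauss_moment N)%:C * (s + p ^+ 2) ^+ N./2.
Proof.
have [oN|] := boolP (odd N).
  have -> : gauss_moment N = 0 :> R by rewrite /gauss_moment oN.
  rewrite mul0r big1 // => i _; have iN : (i <= N)%N by rewrite -ltnS.
  by rewrite /gauss_moment oddB // oN; case: (odd i); rewrite /= ?mulr0 ?mul0r ?mulr0.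
move=> /negbTE eN; rewrite -[N](@even_halfK N) ?eN //; set K := N./2.
rewrite (sum_even_only (F := fun i => 'C(K.*2, i)%:R * p ^+ i * (gauss_moment i)%:C *
     ((gauss_moment (K.*2 - i))%:C * s ^+ (K.*2 - i)./2))); last first.
  by move=> i oi; rewrite /gauss_moment oi mulr0 mul0r.
rewrite doubleK exprDn mulr_sumr; apply: eq_bigr => r _.
have rK : (r <= K)%N by rewrite -ltnS.
have -> : p ^+ r.*2 = (p ^+ 2) ^+ r by rewrite -mul2n exprM.
rewrite -doubleB doubleK -[X in _ = _ * X]mulr_natr.
have := gauss_moment_bin rK; rewrite -doubleB => /(congr1 (fun a : R => a%:C)).
rewrite !rmorphM /= !rmorph_nat => E.
transitivity ('C(K.*2, r.*2)%:R * (gauss_moment (K - r).*2)%:C * (gauss_moment r.*2)%:C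
   * (s ^+ (K - r) * (p ^+ 2) ^+ r)); first by ring.
by rewrite E; ring.
Qed.

End ComplexGaussian.

Section GaussianLinearForms.
Context {R : realType} (m : nat) d (T : measurableType d)
  (mu : {sigma_finite_measure set T -> \bar R})
  (X : T -> nat -> R) (HX : leb_model m mu X).
Local Notation C := R[i].

Definition gauss_monomial (e : nat -> nat) (t : T) : R :=
  \prod_(k < m) gauss_pow (e k) (X t k).

Lemma gauss_monomial_set e j i t : (j < m)%N -> e j = 0%N ->
  gauss_monomial (fun k => if k == j then i else e k) t = X t j ^+ i * gauss_monomial e t.
Proof.
move=> jm ej; rewrite /gauss_monomial (bigD1 (Ordinal jm)) //= eqxx.
rewrite [in RHS](bigD1 (Ordinal jm)) //= ej.
rewrite [gauss_pow 0 _]/gauss_pow expr0 mul1r mulrA -/(gauss_pow i (X t j)); congr (_ * _).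
by apply: eq_bigr => k kj; rewrite ifN //; move: kj; rewrite -val_eqE.
Qed.

(** Induction on the number [j] of variables left in the linear form. The monomial [e] stores the
    powers of the variables already split off, and [gauss_monomial] carries the Gaussian weight of
    every coordinate. The coefficients are complex and enter through [p k ^+ 2], without
    conjugation. *)
Lemma gauss_linear_moment (p : nat -> C) j N e : (j <= m)%N ->
  (forall k, (k < j)%N -> e k = 0%N) ->
  cintegrable mu (fun t => (\sum_(k < j) p k * (X t k)%:C) ^+ N * (gauss_monomial e t)%:C) /\
  cintegral mu (fun t => (\sum_(k < j) p k * (X t k)%:C) ^+ N * (gauss_monomial e t)%:C) =
  (gauss_moment N)%:C * (\sum_(k < j) p k ^+ 2) ^+ N./2 *
    (\prod_(k < m) (Num.sqrt pi * gauss_moment (e k)))%:C.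
Proof.
elim: j N e => [|j IH] N e jm e0.
  have [ip ep] := leb_model_prod HX (g := fun k => gauss_pow (e k))
    (fun k => gauss_pow_integrable (e k)).
  have E t : (\sum_(k < 0) p k * (X t k)%:C) ^+ N * (gauss_monomial e t)%:C =
      (N == 0%N)%:R * (gauss_monomial e t)%:C.
    by rewrite big_ord0 expr0n.
  have ir := cintegrable_real ip.
  split; first by under eq_fun do rewrite E; exact: cintegrableZ.
  transitivity ((N == 0%N)%:R * cintegral mu (fun t => (gauss_monomial e t)%:C)).
    by rewrite -cintegralZ //; congr (cintegral _); apply/funext => t; exact: E.
  rewrite cintegral_real /Rintegral ep /= big_ord0 expr0n.
  under eq_bigr do rewrite Rintegral_gauss_pow.
  congr (_ * _); case: N {E} => [|[|N]] /=.
  - by rewrite /gauss_moment /= expr0 fact0 !mulr1 divr1.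
  - by rewrite /gauss_moment /= mul0r.
  - by rewrite mulr0.
have jm' := ltnW jm.
(* The binomial theorem splits off variable [j]; its [i]-th power moves into the monomial, where the
   exponent was still 0. *)
pose ei i k := if k == j then i else e k.
have ei0 i k : (k < j)%N -> ei i k = 0%N.
  by move=> kj; rewrite /ei ltn_eqF // e0 // ltnS ltnW.
pose F (i : 'I_N.+1) t : C := (\sum_(k < j) p k * (X t k)%:C) ^+ (N - i) *
  (gauss_monomial (ei i) t)%:C.
have FE t : (\sum_(k < j.+1) p k * (X t k)%:C) ^+ N * (gauss_monomial e t)%:C =
    \sum_(i < N.+1) 'C(N, i)%:R * p j ^+ i * F i t.
  rewrite big_ord_recr /= exprDn mulr_suml; apply: eq_bigr => i _.
  rewrite /F gauss_monomial_set ?e0 // exprMn rmorphM /= rmorphXn -mulr_natl.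
  by ring.
have iF i : cintegrable mu (F i) by have [] := IH (N - i)%N (ei i) jm' (ei0 i).
have iF' (i : 'I_N.+1) : cintegrable mu (fun t => 'C(N, i)%:R * p j ^+ i * F i t).
  exact: cintegrableZ.
split; first by under eq_fun do rewrite FE; exact: cintegrable_sum.
transitivity (cintegral mu (fun t => \sum_(i < N.+1) 'C(N, i)%:R * p j ^+ i * F i t)).
  by congr (cintegral _); apply/funext => t; exact: FE.
rewrite cintegral_sum // [\sum_(k < j.+1) _]big_ord_recr /= -gauss_moment_convolution mulr_suml.
apply: eq_bigr => i _; rewrite cintegralZ //.
have [_ ->] := IH (N - i)%N (ei i) jm' (ei0 i).
rewrite (bigD1 (Ordinal jm)) //= /ei eqxx [in RHS](bigD1 (Ordinal jm)) //= e0 //.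
rewrite (eq_bigr (fun k : 'I_m => Num.sqrt pi * gauss_moment (e k))); last first.
  by move=> k kj; rewrite ifN //; move: kj; rewrite -val_eqE.
have -> : gauss_moment 0 = 1 :> R by rewrite /gauss_moment /= expr0 fact0 !mulr1 divr1.
by rewrite !rmorphM /= !rmorph1; ring.
Qed.

Lemma gauss_form_moment (p : nat -> C) N :
  cintegral mu (fun t => (\sum_(k < m) p k * (X t k)%:C) ^+ N *
    (expR (- \sum_(k < m) X t k ^+ 2))%:C) =
  (gauss_moment N)%:C * (\sum_(k < m) p k ^+ 2) ^+ N./2 * (Num.sqrt pi ^+ m)%:C.
Proof.
have [_] := @gauss_linear_moment p m N (fun=> 0%N) (leqnn m) (fun _ _ => erefl).
rewrite prodr_const card_ord.
have -> : gauss_moment 0 = 1 :> R by rewrite /gauss_moment /= expr0 fact0 !mulr1 divr1.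
rewrite mulr1 => <-; congr (cintegral _); apply/funext => t; congr (_ * _%:C).
rewrite -sumrN expR_sum; apply: eq_bigr => k _.
by rewrite /gauss_pow expr0 mul1r.
Qed.

End GaussianLinearForms.

(** The difference would be a nonzero polynomial of degree below [N] with [N] distinct integer
    roots. This is the tool for every polarization below: a parameter is sampled at the natural
    numbers, which conjugation fixes. *)
Lemma poly_coef_ext (F : numFieldType) (N : nat) (c c' : nat -> F) :
  (forall k : nat, \sum_(a < N) c a * k%:R ^+ a = \sum_(a < N) c' a * k%:R ^+ a) ->
  forall a, (a < N)%N -> c a = c' a.
Proof.
move=> H a aN; pose p := \poly_(i < N) (c i - c' i).
have pk k : root p (k%:R : F).
  rewrite /root horner_poly; under eq_bigr do rewrite mulrBl.
  by rewrite big_split /= sumrN H subrr.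
suff p0 : p = 0.
  have /(congr1 (fun r : {poly F} => r`_a)) := p0.
  by rewrite coef_poly aN coef0 => /eqP; rewrite subr_eq0 => /eqP.
apply/eqP/negPn/negP => pn0.
have := @max_poly_roots F p [seq k%:R | k <- iota 0 N] pn0.
have -> : all (root p) [seq k%:R | k <- iota 0 N] by apply/allP => x /mapP[k _ ->].
have -> : uniq [seq (k%:R : F) | k <- iota 0 N].
  by rewrite map_inj_uniq ?iota_uniq // => i j /eqP; rewrite eqr_nat => /eqP.
by move=> /(_ isT isT); rewrite size_map size_iota ltnNge size_poly.
Qed.

Section SphereFunctional.
Context {R : realType} (n : nat) (n0 : (0 < n)%N).
Local Notation C := R[i].
Implicit Types (f g : cvec R n -> C) (p w : cvec R n).
Context d (T : measurableType d) (mu : {sigma_finite_measure set T -> \bar R})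
  (X : T -> nat -> R) (HX : leb_model (2 * n) mu X).

Local Notation mX := (leb_model_meas HX).
Local Notation q t := (@seq_norm2 R n (X t)).

Definition cannular f (t : T) : C :=
  if (0 < q t) && (q t < 1) then f (@seq_proj R n (X t)) else 0.
Definition cpunctured f (t : T) : C := if 0 < q t then f (@seq_proj R n (X t)) else 0.

Definition ball_cint f : C := cintegral mu (cannular f).

Lemma sphere_alg_Re f : sphere_alg f -> sphere_measurable (fun z => complex.Re (f z)).
Proof.
by move=> mf d' T' X' mX'; have [] := sphere_alg_cmeasurable
  (fun j => @cmeasurable_sphere_proj R n _ _ X' j mX') mf.
Qed.

Lemma sphere_alg_Im f : sphere_alg f -> sphere_measurable (fun z => complex.Im (f z)).
Proof.
by move=> mf d' T' X' mX'; have [] := sphere_alg_cmeasurable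
  (fun j => @cmeasurable_sphere_proj R n _ _ X' j mX') mf.
Qed.

Lemma sphere_alg_Re_bounded f : sphere_alg f -> sphere_bounded (fun z => complex.Re (f z)).
Proof.
move=> /sphere_alg_bounded[M _ HM]; exists M => z Sz.
exact: le_trans (Re_le_normc _) (HM z Sz).
Qed.

Lemma sphere_alg_Im_bounded f : sphere_alg f -> sphere_bounded (fun z => complex.Im (f z)).
Proof.
move=> /sphere_alg_bounded[M _ HM]; exists M => z Sz.
exact: le_trans (Im_le_normc _) (HM z Sz).
Qed.

Lemma Re_cannular f t : complex.Re (cannular f t) = annular (fun z => complex.Re (f z)) 1 (X t).
Proof. by rewrite /cannular /annular; case: ifP. Qed.

Lemma Im_cannular f t : complex.Im (cannular f t) = annular (fun z => complex.Im (f z)) 1 (X t).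
Proof. by rewrite /cannular /annular; case: ifP. Qed.

Lemma Re_cpunctured f t : complex.Re (cpunctured f t) = punctured (fun z => complex.Re (f z)) (X t).
Proof. by rewrite /cpunctured /punctured; case: ifP. Qed.

Lemma Im_cpunctured f t : complex.Im (cpunctured f t) = punctured (fun z => complex.Im (f z)) (X t).
Proof. by rewrite /cpunctured /punctured; case: ifP. Qed.

Lemma cannular_integrable f : sphere_alg f -> cintegrable mu (cannular f).
Proof.
move=> af; split.
- under eq_fun do rewrite Re_cannular.
  exact: (annular_integrable HX (sphere_alg_Re af) (sphere_alg_Re_bounded af)).
- under eq_fun do rewrite Im_cannular.
  exact: (annular_integrable HX (sphere_alg_Im af) (sphere_alg_Im_bounded af)).
Qed.

Lemma ball_cintE f : ball_cint f =
  (ball_integral mu X (fun z => complex.Re (f z))) +i* (ball_integral mu X (fun z => complex.Im (f z))).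
Proof.
rewrite /ball_cint /cintegral /ball_integral; congr (_ +i* _); apply: eq_Rintegral => t _.
  exact: Re_cannular.
exact: Im_cannular.
Qed.

Lemma ball_cintD f g : sphere_alg f -> sphere_alg g ->
  ball_cint (fun z => f z + g z) = ball_cint f + ball_cint g.
Proof.
move=> af ag; rewrite /ball_cint -cintegralD //; try exact: cannular_integrable.
by congr (cintegral _); apply/funext => t; rewrite /cannular; case: ifP; rewrite ?addr0.
Qed.

Lemma ball_cintZ (c : C) f : sphere_alg f -> ball_cint (fun z => c * f z) = c * ball_cint f.
Proof.
move=> af; rewrite /ball_cint -cintegralZ //; try exact: cannular_integrable.
by congr (cintegral _); apply/funext => t; rewrite /cannular; case: ifP; rewrite ?mulr0.
Qed.

Lemma sphere_alg_sum (I : Type) (s : seq I) (F : I -> cvec R n -> C) :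
  (forall i, sphere_alg (F i)) -> sphere_alg (fun z => \sum_(i <- s) F i z).
Proof.
move=> aF; elim: s => [|i s IH].
  by under eq_fun do rewrite big_nil; exact: sphere_alg_cst.
by under eq_fun do rewrite big_cons; exact: sphere_alg_add.
Qed.

Lemma sphere_alg_exp f k : sphere_alg f -> sphere_alg (fun z => f z ^+ k).
Proof.
move=> af; elim: k => [|k IH].
  by under eq_fun do rewrite expr0; exact: sphere_alg_cst.
by under eq_fun do rewrite exprS; exact: sphere_alg_mul.
Qed.

Lemma sphere_alg_cinner_l p : sphere_alg (fun z => cinner p z).
Proof.
apply: sphere_alg_sum => j; apply: sphere_alg_mul; first exact: sphere_alg_cst.
by apply: sphere_alg_conj; exact: sphere_alg_coord.
Qed.

Lemma sphere_alg_cinner_r p : sphere_alg (fun z => cinner z p).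
Proof.
by apply: sphere_alg_sum => j; apply: sphere_alg_mul; [exact: sphere_alg_coord|exact: sphere_alg_cst].
Qed.

Lemma ball_cint_sum (I : Type) (s : seq I) (F : I -> cvec R n -> C) :
  (forall i, sphere_alg (F i)) ->
  ball_cint (fun z => \sum_(i <- s) F i z) = \sum_(i <- s) ball_cint (F i).
Proof.
move=> aF; elim: s => [|i s IH].
  rewrite big_nil /ball_cint -[RHS](cintegral0 mu); congr (cintegral _ _).
  by apply/funext => t; rewrite /cannular big_nil; case: ifP.
rewrite big_cons -IH -ball_cintD //; last exact: sphere_alg_sum.
by congr ball_cint; apply/funext => z; rewrite big_cons.
Qed.

Lemma radial_cmoment f K : sphere_alg f ->
  cintegral mu (fun t => cpunctured f t * (q t ^+ K * expR (- q t))%:C) =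
  (n * (n + K).-1`!)%:R * ball_cint f.
Proof.
move=> af.
have [_ e1] := radial_moment n0 HX K (sphere_alg_Re af) (sphere_alg_Re_bounded af).
have [_ e2] := radial_moment n0 HX K (sphere_alg_Im af) (sphere_alg_Im_bounded af).
rewrite ball_cintE -[_%:R in RHS](rmorph_nat (real_complex R)).
apply/eqP; rewrite eq_complex /= !mul0r subr0 addr0 -e1 -e2; apply/andP.
have ReMR (c : C) r : complex.Re (c * r%:C) = complex.Re c * r by rewrite Re_mulc mulr0 subr0.
have ImMR (c : C) r : complex.Im (c * r%:C) = complex.Im c * r by rewrite Im_mulc mulr0 add0r.
split; apply/eqP; apply: eq_Rintegral => t _.
  by rewrite ReMR Re_cpunctured.
by rewrite ImMR Im_cpunctured.
Qed.

(** The constant is the inverse of the volume [pi^n / n!] of the ball, so that the mean of 1 is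
    1. *)
Definition sphere_mean f : C := (n`!%:R / pi ^+ n)%:C * ball_cint f.

Lemma sphere_meanD f g : sphere_alg f -> sphere_alg g ->
  sphere_mean (fun z => f z + g z) = sphere_mean f + sphere_mean g.
Proof. by move=> af ag; rewrite /sphere_mean ball_cintD // mulrDr. Qed.

Lemma sphere_meanZ (c : C) f : sphere_alg f -> sphere_mean (fun z => c * f z) = c * sphere_mean f.
Proof. by move=> af; rewrite /sphere_mean ball_cintZ // mulrCA. Qed.

Lemma ball_integral_le (h : cvec R n -> R) M : sphere_measurable h ->
  (forall z, on_sphere z -> `|h z| <= M) ->
  `|ball_integral mu X h| <= M * ball_integral mu X (fun _ : cvec R n => 1).
Proof.
move=> mh HM; have bh : sphere_bounded h by exists M.
have ih := annular_integrable HX mh bh.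
have i1 := annular_one_integrable HX.
apply: le_trans (le_normr_Rintegral _ ih) _ => //.
rewrite /ball_integral -RintegralZl //; apply: le_Rintegral => //.
- exact: (integrable_norm ih).
- exact: integrableZR.
- move=> t _; rewrite /annular; case: ifP => [/andP[t0 _]|_]; last by rewrite normr0 mulr0.
  by rewrite mulr1; exact: HM (seq_proj_on_sphere t0).
Qed.

Lemma normc_le_ReIm (c : C) : normc c <= `|complex.Re c| + `|complex.Im c|.
Proof.
have {1}-> : c = (complex.Re c)%:C + (complex.Im c)%:C * 'i.
  by case: c => a b; apply/eqP; rewrite eq_complex /=; apply/andP; split; apply/eqP; ring.
apply: le_trans (le_normcD _ _) _; rewrite normcM !normcR.
by rewrite (_ : normc 'i = 1) ?mulr1 //= expr0n add0r expr1n sqrtr1.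
Qed.

Lemma sphere_mean_bound : exists2 K, 0 <= K & forall f M, sphere_alg f ->
  (forall z, on_sphere z -> normc (f z) <= M) -> normc (sphere_mean f) <= K * M.
Proof.
pose V := ball_integral mu X (fun _ : cvec R n => 1).
have V0 : 0 <= V.
  by apply: Rintegral_ge0 => t _; apply: annular_ge0 => z _; exact: ler01.
have k0 : 0 <= n`!%:R / pi ^+ n :> R by rewrite divr_ge0 ?exprn_ge0 ?pi_ge0.
exists (n`!%:R / pi ^+ n * (V + V)) => [|f M af HM]; first by rewrite mulr_ge0 ?addr_ge0.
rewrite /sphere_mean normcM normcR ger0_norm // -[leRHS]mulrA ler_wpM2l //.
apply: le_trans (normc_le_ReIm _) _; rewrite ball_cintE /= mulrDl -![V * M]mulrC.
apply: lerD.
  apply: ball_integral_le; first exact: sphere_alg_Re.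
  by move=> z Sz; exact: le_trans (Re_le_normc _) (HM z Sz).
apply: ball_integral_le; first exact: sphere_alg_Im.
by move=> z Sz; exact: le_trans (Im_le_normc _) (HM z Sz).
Qed.

(** The factor [2 pi^n / (n-1)!] is the area of the sphere: [2n] from the cone formula times the
    volume of the ball. *)
Lemma sphere_int_mean (g : cvec R n -> R) : sphere_alg (fun z => (g z)%:C) -> sphere_ge0 g ->
  sphere_int g = (2 * pi ^+ n / (n.-1)`!%:R * complex.Re (sphere_mean (fun z => (g z)%:C)))%:E.
Proof.
move=> ag g0; have mg : sphere_measurable g := sphere_alg_Re ag.
have bg : sphere_bounded g := sphere_alg_Re_bounded ag.
have fin : (\int[mu]_t (annular g 1 (X t))%:E)%E \is a fin_num.
  exact: integrable_fin_num (annular_integrable HX mg bg).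
rewrite /sphere_int.
have -> : leb_iter (2 * n) (fun x => if (0 < cnorm2 (@toC R n x)) && (cnorm2 (@toC R n x) < 1)
    then (g (sphere_proj (@toC R n x)))%:E else 0%E) =
    leb_iter (2 * n) (fun x => (annular g 1 x)%:E).
  by congr (leb_iter _ _); apply/funext => x; rewrite /annular /seq_norm2; case: ifP.
rewrite (integral_annular HX) // -(fineK fin) -EFinM; congr EFin.
rewrite /sphere_mean ball_cintE /= mul0r subr0 -/(ball_integral mu X g) mulrA; congr (_ * _).
have -> : n`!%:R = n%:R * (n.-1)`!%:R :> R by rewrite -natrM -{1}(prednK n0) factS prednK.
rewrite natrM; field.
by rewrite expf_neq0 ?gt_eqF ?pi_gt0 //= pnatr_eq0 -lt0n fact_gt0.
Qed.

End SphereFunctional.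

Section SphereMoments.
Context {R : realType} (n : nat) (n0 : (0 < n)%N).
Local Notation C := R[i].
Implicit Types (p w : cvec R n).
Context d (T : measurableType d) (mu : {sigma_finite_measure set T -> \bar R})
  (X : T -> nat -> R) (HX : leb_model (2 * n) mu X).

Local Notation q t := (@seq_norm2 R n (X t)).
Local Notation B := (ball_cint mu X).

Definition cvec_ext p (j : nat) : C := if insub j is Some i then p i else 0.

Lemma cvec_extE p (j : 'I_n) : cvec_ext p j = p j.
Proof. by rewrite /cvec_ext valK. Qed.

(* Coefficients of [alpha <p, zeta> + <zeta, w>] in the real coordinates of zeta. *)
Definition form_coef (alpha : C) p w (k : nat) : C :=
  if odd k then 'i * ((cvec_ext w k./2)^* - alpha * cvec_ext p k./2)
  else alpha * cvec_ext p k./2 + (cvec_ext w k./2)^*.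

Lemma form_coef_sum alpha p w (x : nat -> R) :
  \sum_(k < 2 * n) form_coef alpha p w k * (x k)%:C =
  alpha * cinner p (@toC R n x) + cinner (@toC R n x) w.
Proof.
rewrite (sum_even_odd (fun k => form_coef alpha p w k * (x k)%:C)).
rewrite mulr_sumr -big_split /=; apply: eq_bigr => j _.
rewrite /form_coef /= oddM /= mul2n doubleK uphalf_double !cvec_extE.
have -> : @toC R n x j = (x j.*2)%:C + 'i * (x j.*2.+1)%:C.
  by rewrite /toC mul2n; apply/eqP; rewrite eq_complex /=; apply/andP; split; apply/eqP; ring.
have -> : forall a b : R, Num.conj (a%:C + 'i * b%:C : C) = a%:C - 'i * b%:C.
  by move=> a b; apply/eqP; rewrite eq_complex /=; apply/andP; split; apply/eqP; ring.
by ring.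
Qed.

(** The factor ['i] in the odd coefficients gives [(a + b)^2 - (b - a)^2 = 4 a b] in each complex
    coordinate, so only the cross term between [p] and [w] survives. *)
Lemma form_coef_sqr alpha p w :
  \sum_(k < 2 * n) form_coef alpha p w k ^+ 2 = 4 * alpha * cinner p w.
Proof.
rewrite (sum_even_odd (fun k => form_coef alpha p w k ^+ 2)).
rewrite mulr_sumr; apply: eq_bigr => j _.
rewrite /form_coef /= oddM /= mul2n doubleK uphalf_double !cvec_extE.
have i2 : 'i ^+ 2 = -1 :> C by exact: sqrCi.
by rewrite exprMn i2; ring.
Qed.

Lemma cinner_sphere_proj_r p (z : cvec R n) :
  cinner p (sphere_proj z) = cinner p z * ((Num.sqrt (cnorm2 z))^-1)%:C.
Proof.
by rewrite /cinner mulr_suml; apply: eq_bigr => j _; rewrite /sphere_proj !num_conjE rmorphM /= oppr0 mulrA.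
Qed.

Lemma cinner_sphere_proj_l p (z : cvec R n) :
  cinner (sphere_proj z) p = cinner z p * ((Num.sqrt (cnorm2 z))^-1)%:C.
Proof.
by rewrite /cinner mulr_suml; apply: eq_bigr => j _; rewrite /sphere_proj mulrAC.
Qed.

Lemma sphere_alg_form alpha p w : sphere_alg (fun z => alpha * cinner p z + cinner z w).
Proof.
apply: sphere_alg_add; last exact: sphere_alg_cinner_r.
by apply: sphere_alg_mul; [exact: sphere_alg_cst|exact: sphere_alg_cinner_l].
Qed.

Lemma punctured_gauss_weight :
  \int[mu]_t ((if 0 < q t then 1 else 0) * expR (- q t)) = pi ^+ n.
Proof.
have [wi wE] := gauss_weight_integral HX.
have z0 := norm2_eq0_null n0 HX.
have mz : measurable_fun [set: T] (fun t => (q t == 0)%:R : R).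
  rewrite (_ : (fun _ => _) = (fun t => if q t == 0 then 1 else 0)); last first.
    by apply/funext => t; case: ifP.
  apply: measurable_fun_ifT => //; apply: measurable_fun_eqr => //.
  exact: (seq_norm2_measurable HX).
have iz : mu.-integrable [set: T] (fun t => ((q t == 0)%:R)%:E).
  apply/integrableP; split; first exact/measurable_EFinP.
  rewrite (_ : (\int[mu]_x _)%E = 0%E) ?ltry // -[RHS]z0.
  by apply: eq_integral => t _; rewrite /= ger0_norm.
have E t : (if 0 < q t then 1 else 0) * expR (- q t) = expR (- q t) - (q t == 0)%:R.
  have := seq_norm2_ge0 n (X t); rewrite le_eqVlt eq_sym.
  case: eqP => [-> _|_ /= ->]; first by rewrite ltxx mul0r oppr0 expR0 subrr.
  by rewrite mul1r subr0.
under eq_Rintegral do rewrite E.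
by rewrite RintegralB // /Rintegral wE z0 subr0.
Qed.

(** The Gaussian moment of one linear form evaluated twice: in coordinates on the right, in polar
    form on the left, where homogeneity of degree [2K] produces the radial weight [q^K]. *)
Lemma ball_cint_form alpha p w K :
  (n * (n + K).-1`!)%:R * B (fun z => (alpha * cinner p z + cinner z w) ^+ K.*2) =
  (gauss_moment K.*2)%:C * (4 * alpha * cinner p w) ^+ K * (pi ^+ n)%:C.
Proof.
rewrite -(radial_cmoment n0 HX); last by apply: sphere_alg_exp; exact: sphere_alg_form.
have := gauss_form_moment HX (form_coef alpha p w) K.*2.
rewrite form_coef_sqr doubleK exprM sqr_sqrtr ?pi_ge0 // => <-.
have pw t : q t = 0 -> \sum_(k < 2 * n) form_coef alpha p w k * (X t k)%:C = 0.
  rewrite seq_norm2E => /eqP; rewrite psumr_eq0; last by move=> k _; exact: sqr_ge0.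
  move=> /allP H; apply: big1 => k _.
  have := H k (mem_index_enum _); rewrite /= sqrf_eq0 => /eqP ->.
  by rewrite rmorph0 mulr0.
(* For [K = 0] the integrand does not vanish at the origin, and the puncture is harmless only
   because the origin is null. For positive [K] the form itself vanishes there. *)
case: K => [|K].
  transitivity ((pi ^+ n)%:C : C).
    rewrite -punctured_gauss_weight -cintegral_real; congr (cintegral _ _).
    apply/funext => t; rewrite /cpunctured expr0 mul1r !expr0 rmorphM /=.
    by case: ifP; rewrite ?rmorph1 ?rmorph0.
  have [_ wE] := gauss_weight_integral HX.
  transitivity ((\int[mu]_t expR (- q t))%:C : C); first by rewrite /Rintegral wE.
  rewrite -cintegral_real; congr (cintegral _ _); apply/funext => t.
  by rewrite expr0 mul1r seq_norm2E.
congr (cintegral _ _); apply/funext => t; rewrite /cpunctured.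
case: ifP => [t0|/negbT]; last first.
  rewrite -leNgt => t0; have q0 : q t = 0 by apply/le_anti; rewrite t0 seq_norm2_ge0.
  by rewrite pw // expr0n /= !mul0r.
rewrite form_coef_sum cinner_sphere_proj_r cinner_sphere_proj_l -/(seq_norm2 n (X t)).
rewrite mulrA -mulrDl exprMn -mulrA -seq_norm2E; congr (_ * _).
rewrite -rmorphXn -rmorphM /=; congr (_%:C).
rewrite mulrA -[K.+1.*2]mul2n exprM exprVn sqr_sqrtr ?seq_norm2_ge0 //.
by rewrite exprVn mulVf ?mul1r // expf_neq0 // gt_eqF.
Qed.

Lemma ball_cint_odd (f : cvec R n -> C) : sphere_alg f -> (forall z, f (fun j => - z j) = - f z) -> B f = 0.
Proof.
move=> af fN; rewrite ball_cintE.
rewrite (ball_integral_odd HX (sphere_alg_Re af) (sphere_alg_Re_bounded af)); last first.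
  by move=> z; rewrite fN; case: (f z).
rewrite (ball_integral_odd HX (sphere_alg_Im af) (sphere_alg_Im_bounded af)) //.
by move=> z; rewrite fN; case: (f z).
Qed.

Lemma cinnerN_r p z : cinner p (fun j => - z j) = - cinner p z.
Proof. by rewrite /cinner -sumrN; apply: eq_bigr => j _; rewrite rmorphN mulrN. Qed.

Lemma cinnerN_l p z : cinner (fun j => - z j) p = - cinner z p.
Proof. by rewrite /cinner -sumrN; apply: eq_bigr => j _; rewrite mulNr. Qed.

(** Odd total degree is killed by the antipodal map. In even degree [2K], the moment of
    [alpha <p, .> + <., w>] contains [alpha] only as [alpha^K]; comparing coefficients of [alpha]
    leaves the single mixed moment with [a = b = K]. *)
Lemma ball_cint_monomial p w a b :
  B (fun z => cinner p z ^+ a * cinner z w ^+ b) =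
  if a == b then (pi ^+ n * a`!%:R / (n * (n + a).-1`!)%:R)%:C * cinner p w ^+ a else 0.
Proof.
have am a' b' : sphere_alg (fun z => cinner p z ^+ a' * cinner z w ^+ b').
  by apply: sphere_alg_mul; apply: sphere_alg_exp;
    [exact: sphere_alg_cinner_l|exact: sphere_alg_cinner_r].
have [oab|eab] := boolP (odd (a + b)).
  rewrite ifN; last by apply: contraTneq oab => ->; rewrite addnn odd_double.
  apply: ball_cint_odd => // z.
  by rewrite cinnerN_r cinnerN_l (exprNn (cinner p z)) (exprNn (cinner z w)) mulrACA -exprD -signr_odd oab expr1 mulN1r.
pose K := (a + b)./2; have EK : (a + b = K.*2)%N by rewrite /K even_halfK.
have aK : (a < K.*2.+1)%N by rewrite -EK ltnS leq_addr.
have c0 : (n * (n + K).-1`!)%:R != 0 :> C.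
  by rewrite pnatr_eq0 muln_eq0 negb_or -!lt0n n0 fact_gt0.
pose c i : C := 'C(K.*2, i)%:R * B (fun z => cinner p z ^+ i * cinner z w ^+ (K.*2 - i)).
pose c' i : C := (i == K)%:R * ((n * (n + K).-1`!)%:R^-1 * ((gauss_moment K.*2)%:C *
  (4 * cinner p w) ^+ K * (pi ^+ n)%:C)).
have H (k : nat) : \sum_(i < K.*2.+1) c i * k%:R ^+ i = \sum_(i < K.*2.+1) c' i * k%:R ^+ i.
  transitivity (B (fun z => (k%:R * cinner p z + cinner z w) ^+ K.*2)).
    have -> : (fun z => (k%:R * cinner p z + cinner z w) ^+ K.*2) =
        (fun z => \sum_(i < K.*2.+1) ('C(K.*2, i)%:R * k%:R ^+ i) *
           (cinner p z ^+ i * cinner z w ^+ (K.*2 - i))).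
      apply/funext => z; rewrite addrC exprDn; apply: eq_bigr => i _.
      by rewrite exprMn -mulr_natl; ring.
    rewrite (ball_cint_sum HX); last first.
      by move=> i; apply: sphere_alg_mul => //; exact: sphere_alg_cst.
    by apply: eq_bigr => i _; rewrite (ball_cintZ HX) // /c mulrAC.
  have KK : (K < K.*2.+1)%N by rewrite ltnS -addnn leq_addr.
  rewrite (bigD1 (Ordinal KK)) //= big1 ?addr0; last first.
    by move=> i iK; rewrite /c' (_ : (i == K :> nat) = false) ?mul0r //; apply/negbTE.
  rewrite /c' eqxx mul1r -[LHS](mulKf c0) ball_cint_form.
  have -> : (4 * k%:R * cinner p w) ^+ K = (4 * cinner p w) ^+ K * k%:R ^+ K.
    by rewrite -exprMn; congr (_ ^+ _); ring.
  by ring.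
have := poly_coef_ext H aK; rewrite /c /c' -EK addKn.
have -> : (a == K) = (a == b).
  by rewrite -(inj_eq double_inj) -EK -addnn eqn_add2l.
have b0 : 'C(a + b, a)%:R != 0 :> C by rewrite pnatr_eq0 -lt0n bin_gt0 leq_addr.
case: eqP => [ab|_]; last first.
  by rewrite mul0r => /eqP; rewrite mulf_eq0 (negbTE b0) => /eqP.
have Ka : K = a by apply: double_inj; rewrite -EK -ab addnn.
subst b; rewrite Ka mul1r addnn => E.
have f0 m : m`!%:R != 0 :> C by rewrite pnatr_eq0 -lt0n fact_gt0.
have E1 : 'C(a.*2, a)%:R = (a.*2)`!%:R / (a`!%:R * a`!%:R) :> C.
  apply: (canRL (mulfK _)); first by rewrite mulf_neq0.
  by rewrite -!natrM -[X in (_ * (_ * X`!))%N](addKn a) addnn bin_fact // -addnn leq_addr.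
move: b0 E; rewrite addnn E1 => b0 E; apply: (mulfI b0); rewrite E.
rewrite /gauss_moment odd_double doubleK !rmorphM /= !fmorphV !rmorphM /= !rmorphXn !rmorph_nat exprMn.
move: c0; rewrite Ka natrM mulf_eq0 negb_or => /andP[n1 n2].
by field; rewrite !f0 n1 ?expf_neq0 ?pnatr_eq0.
Qed.

Lemma sphere_mean_monomial p w a b :
  sphere_mean mu X (fun z => cinner p z ^+ a * cinner z w ^+ b) =
  if a == b then ('C((n + a).-1, a)%:R)^-1 * cinner p w ^+ a else 0.
Proof.
rewrite /sphere_mean ball_cint_monomial; case: eqP => _; last by rewrite mulr0.
rewrite mulrA -rmorphM /=; congr (_ * _).
have f0 m : m`!%:R != 0 :> R by rewrite pnatr_eq0 -lt0n fact_gt0.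
have E1 : 'C((n + a).-1, a)%:R = ((n + a).-1)`!%:R / (a`!%:R * (n.-1)`!%:R) :> R.
  apply: (canRL (mulfK _)); first by rewrite mulf_neq0.
  by rewrite -!natrM (_ : n.-1 = (n + a).-1 - a)%N ?bin_fact //; lia.
have E2 : n`!%:R = n%:R * (n.-1)`!%:R :> R by rewrite -natrM -{1}(prednK n0) factS prednK.
have pn : pi ^+ n != 0 :> R by rewrite expf_neq0 // gt_eqF // pi_gt0.
have nn : n%:R != 0 :> R by rewrite pnatr_eq0 -lt0n.
rewrite -(rmorph_nat (real_complex R)) -fmorphV /=; congr (_%:C).
rewrite E1 E2 natrM; field.
by rewrite !f0 pn nn.
Qed.

End SphereMoments.

(** * The normalized integral as a functional *)

Section MeanFunctional.
Context {R : realType} (n : nat).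
Local Notation C := R[i].
Implicit Types (f g : cvec R n -> C) (l : (cvec R n -> C) -> C).

(** Everything is required on [sphere_alg] only, where integrability is guaranteed, and the bound
    looks at values on the sphere only. *)
Record sup_linear l : Prop := SupLinear {
  sup_linearD : forall f g, sphere_alg f -> sphere_alg g ->
    l (fun z => f z + g z) = l f + l g;
  sup_linearZ : forall c f, sphere_alg f -> l (fun z => c * f z) = c * l f;
  sup_linear_bound : exists2 K, 0 <= K & forall f M, sphere_alg f ->
    (forall z, on_sphere z -> normc (f z) <= M) -> normc (l f) <= K * M }.

(* [sphere_int] only integrates nonnegative functions; the properties below are
   all that is needed of its complex-linear, normalized version. *)
Record is_sphere_mean l : Prop := IsSphereMean {
  sphere_mean_linear : sup_linear l;
  sphere_mean_mono : forall p w a b,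
    l (fun z => cinner p z ^+ a * cinner z w ^+ b) =
    if a == b then ('C((n + a).-1, a)%:R)^-1 * cinner p w ^+ a else 0;
  sphere_mean_real : forall g : cvec R n -> R, complex.Im (l (fun z => (g z)%:C)) = 0;
  sphere_mean_int : forall g : cvec R n -> R, sphere_alg (fun z => (g z)%:C) ->
    (forall z, on_sphere z -> 0 <= g z) ->
    sphere_int g = (2 * pi ^+ n / (n.-1)`!%:R * complex.Re (l (fun z => (g z)%:C)))%:E }.

Lemma sphere_mean_exists : (0 < n)%N -> exists l, is_sphere_mean l.
Proof.
move=> n0; have [d [T [mu [X HX]]]] := @leb_model_exists R (2 * n).
exists (@sphere_mean R n d T mu X); split.
- split.
  + exact: (sphere_meanD HX).
  + exact: (sphere_meanZ HX).
  + exact: (sphere_mean_bound HX).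
- exact: (sphere_mean_monomial n0 HX).
- move=> g; rewrite /sphere_mean ball_cintE /= mul0r addr0 /ball_integral.
  by rewrite /Rintegral integral0_eq ?mulr0 // => t _; rewrite /annular; case: ifP.
- by move=> g ag g0; exact: (sphere_int_mean n0 HX).
Qed.

Lemma sup_linear_sum l (I : Type) (s : seq I) (F : I -> cvec R n -> C) : sup_linear l ->
  (forall i, sphere_alg (F i)) ->
  l (fun z => \sum_(i <- s) F i z) = \sum_(i <- s) l (F i).
Proof.
move=> Hl aF; elim: s => [|i s IH].
  transitivity (0 * l (fun=> 0)); last by rewrite mul0r big_nil.
  rewrite -(sup_linearZ Hl); last exact: sphere_alg_cst.
  by congr l; apply/funext => z; rewrite big_nil mul0r.
rewrite big_cons -IH -(sup_linearD Hl) //; last exact: sphere_alg_sum.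
by congr l; apply/funext => z; rewrite big_cons.
Qed.

Lemma sup_linearB l f g : sup_linear l -> sphere_alg f -> sphere_alg g ->
  l (fun z => f z - g z) = l f - l g.
Proof.
move=> Hl af ag; rewrite -[in RHS]mulN1r -(sup_linearZ Hl) // -(sup_linearD Hl) //.
  by congr l; apply/funext => z; rewrite mulN1r.
by apply: sphere_alg_mul => //; exact: sphere_alg_cst.
Qed.

Lemma sphere_algB f g : sphere_alg f -> sphere_alg g -> sphere_alg (fun z => f z - g z).
Proof.
move=> af ag; have -> : (fun z => f z - g z) = (fun z => f z + (-1) * g z).
  by apply/funext => z; rewrite mulN1r.
by apply: sphere_alg_add => //; apply: sphere_alg_mul => //; exact: sphere_alg_cst.
Qed.

(** The sup bound with [M = 0]: such a functional sees only the values on the sphere, which is what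
    allows identities whose denominators may vanish elsewhere. *)
Lemma sup_linear_eq l f g : sup_linear l -> sphere_alg f -> sphere_alg g ->
  (forall z, on_sphere z -> f z = g z) -> l f = l g.
Proof.
move=> Hl af ag fg; have [K K0 HK] := sup_linear_bound Hl.
have H z : on_sphere z -> normc (f z - g z) <= 0 by move=> /fg ->; rewrite subrr normc0.
have := HK _ 0 (sphere_algB af ag) H; rewrite mulr0 (sup_linearB Hl) // => N.
apply/eqP; rewrite -subr_eq0 -normc_eq0; apply/eqP/le_anti.
by rewrite N normc_ge0.
Qed.

Definition ccvg (u : nat -> C) (c : C) : Prop := (fun M => normc (u M - c)) @ \oo --> (0 : R).

Lemma ccvg_bound (u : nat -> C) c (e : nat -> R) :
  (forall M, normc (u M - c) <= e M) -> e @ \oo --> (0 : R) -> ccvg u c.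
Proof.
move=> H e0; apply: (squeeze_cvgr _ (cvg_cst 0) e0).
by apply: nearW => M; rewrite normc_ge0 H.
Qed.

Lemma ccvg_unique (u : nat -> C) c c' : ccvg u c -> ccvg u c' -> c = c'.
Proof.
move=> h h'.
have h2 : (fun M => normc (u M - c) + normc (u M - c')) @ \oo --> (0 : R).
  by rewrite -[X in _ --> X]addr0; exact: cvgD.
have H : ccvg (fun=> c - c') 0.
  apply: (ccvg_bound _ h2) => M; rewrite subr0 /=.
  have -> : c - c' = (u M - c') - (u M - c) by ring.
  by apply: le_trans (le_normcD _ _) _; rewrite normcN addrC.
apply/eqP; rewrite -subr_eq0 -normc_eq0 -[c - c']subr0; apply/eqP.
by rewrite -(cvg_lim _ H) // lim_cst.
Qed.

Lemma ccvg_eventually (u : nat -> C) c N : (forall M, (N <= M)%N -> u M = c) -> ccvg u c.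
Proof.
move=> H; apply: cvg_near_cst.
by exists N => // M /= NM; rewrite H // subrr normc0.
Qed.

Lemma ccvg_ext (u u' : nat -> C) c : u =1 u' -> ccvg u c -> ccvg u' c.
Proof. by move=> E; have -> : u' = u by apply/funext => M; rewrite E. Qed.

Lemma ccvgD (u v : nat -> C) c c' : ccvg u c -> ccvg v c' -> ccvg (fun M => u M + v M) (c + c').
Proof.
move=> h h'.
have h2 : (fun M => normc (u M - c) + normc (v M - c')) @ \oo --> (0 : R).
  by rewrite -[X in _ --> X]addr0; exact: cvgD.
apply: (ccvg_bound _ h2) => M; rewrite /=.
by rewrite (_ : _ - _ = (u M - c) + (v M - c')) ?le_normcD //; ring.
Qed.

Lemma ccvgZ (u : nat -> C) c a : ccvg u c -> ccvg (fun M => a * u M) (a * c).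
Proof.
move=> h; have h2 : (fun M => normc a * normc (u M - c)) @ \oo --> (0 : R).
  by rewrite -[X in _ --> X](mulr0 (normc a)); exact: cvgMr.
by apply: (ccvg_bound _ h2) => M; rewrite -mulrBr normcM.
Qed.

Lemma ccvg_sum (I : Type) (s : seq I) (u : I -> nat -> C) (c : I -> C) :
  (forall i, ccvg (u i) (c i)) -> ccvg (fun M => \sum_(i <- s) u i M) (\sum_(i <- s) c i).
Proof.
move=> H; elim: s => [|i s IH].
  by rewrite big_nil; apply: (@ccvg_eventually _ _ 0) => M _; rewrite big_nil.
by rewrite big_cons; apply: ccvg_ext (ccvgD (H i) IH) => M; rewrite big_cons.
Qed.

Lemma ccvg_real (u : nat -> R) (a : R) : u @ \oo --> a -> ccvg (fun M => (u M)%:C) a%:C.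
Proof.
move=> h; have h1 : (fun M => u M - a) @ \oo --> (0 : R).
  by rewrite -(subrr a); apply: cvgB => //; exact: cvg_cst.
apply: (ccvg_bound (e := fun M => `|u M - a|)).
  by move=> M; rewrite -rmorphB normcR.
by rewrite -(normr0 R); exact: cvg_norm.
Qed.

Lemma sup_linear_cvg l f (F : nat -> cvec R n -> C) (e : nat -> R) : sup_linear l ->
  sphere_alg f -> (forall M, sphere_alg (F M)) ->
  (forall M z, on_sphere z -> normc (F M z - f z) <= e M) -> e @ \oo --> (0 : R) ->
  ccvg (fun M => l (F M)) (l f).
Proof.
move=> Hl af aF H e0; have [K K0 HK] := sup_linear_bound Hl.
have h2 : (fun M => K * e M) @ \oo --> (0 : R).
  by rewrite -[X in _ --> X](mulr0 K); exact: cvgMr.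
apply: (ccvg_bound _ h2) => M; rewrite -(sup_linearB Hl) //.
by apply: HK; [exact: sphere_algB|move=> z; exact: H].
Qed.

End MeanFunctional.

(** * The binomial series of [(1 - c)^(-N)], with coefficients [mbin N a] *)

Definition mbin (N a : nat) : nat := 'C((N + a).-1, a).

Lemma mbin0 N : mbin N 0 = 1%N.
Proof. by rewrite /mbin bin0. Qed.

Lemma mbin0S a : mbin 0 a.+1 = 0%N.
Proof. by rewrite /mbin /= bin_small. Qed.

Lemma mbinS N a : mbin N.+1 a.+1 = (mbin N.+1 a + mbin N a.+1)%N.
Proof. by rewrite /mbin addSn /= addnS binS addnC. Qed.

Lemma mbin_gt0 N a : (0 < N)%N -> (0 < mbin N a)%N.
Proof. by case: N => // N _; rewrite /mbin bin_gt0 addSn /= leq_addl. Qed.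

Section BinomialSeries.
Context {R : realType}.
Local Notation C := R[i].

Definition bin_sum (F : comNzRingType) (N M : nat) (c : F) : F :=
  \sum_(a < M.+1) (mbin N a)%:R * c ^+ a.

(** Multiplication by [1 - c] telescopes by Pascal's rule [mbinS]. Bounds and convergence are then
    obtained by induction on the exponent [N]. *)
Lemma bin_sumS (F : comNzRingType) N M (c : F) :
  (1 - c) * bin_sum N.+1 M c = bin_sum N M c - (mbin N.+1 M)%:R * c ^+ M.+1.
Proof.
elim: M => [|M IH].
  by rewrite /bin_sum !big_ord_recr !big_ord0 /= !mbin0 expr0 expr1; ring.
rewrite /bin_sum big_ord_recr [in RHS]big_ord_recr /= mulrDr -!/(bin_sum _ _ _) IH.
by rewrite mbinS natrD !exprS; ring.
Qed.

Lemma bin_sum0 (F : comNzRingType) M (c : F) : bin_sum 0 M c = 1.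
Proof.
rewrite /bin_sum big_ord_recl mbin0 expr0 mulr1 big1 ?addr0 // => i _.
by rewrite /= mbin0S mul0r.
Qed.

Lemma bin_sum_le N M (r : R) : 0 <= r < 1 -> bin_sum N M r <= (1 - r) ^- N.
Proof.
move=> /andP[r0 r1]; have r1' : 0 < 1 - r by rewrite subr_gt0.
elim: N => [|N IH]; first by rewrite bin_sum0 expr0 invr1.
rewrite exprS invfM mulrC ler_pdivlMr // mulrC bin_sumS.
by apply: le_trans IH; rewrite gerBl mulr_ge0 ?exprn_ge0.
Qed.

Lemma mbin_exp_cvg0 N (r : R) : 0 <= r < 1 -> (fun M => (mbin N M)%:R * r ^+ M) @ \oo --> (0 : R).
Proof.
move=> r01; apply: cvg_series_cvg_0.
apply: nondecreasing_is_cvgn.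
  apply/nondecreasing_seqP => M; rewrite /series /= big_nat_recr //= lerDl.
  by case/andP: r01 => r0 _; rewrite mulr_ge0 ?exprn_ge0.
exists ((1 - r) ^- N) => _ [M _ <-]; apply: le_trans (bin_sum_le N M r01).
rewrite /series /= big_mkord /bin_sum big_ord_recr /= lerDl.
by case/andP: r01 => r0 _; rewrite mulr_ge0 ?exprn_ge0.
Qed.

Lemma normc_1B (c : C) (r : R) : normc c <= r -> 1 - r <= normc (1 - c).
Proof.
move=> cr; rewrite lerBlDr; apply: le_trans (_ : normc (1 - c) + normc c <= _).
  by rewrite -{1}(@normc1 R) -{1}(subrK c 1) le_normcD.
by rewrite lerD2l.
Qed.

(** The error for exponent [N + 1] is the error for [N] minus the last term of the telescoping,
    divided by [1 - c], whose modulus is at least [1 - r]. *)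
Lemma bin_series_uniform N (r : R) : 0 <= r < 1 -> exists2 e : nat -> R,
  e @ \oo --> (0 : R) &
  forall M (c : C), normc c <= r -> normc (bin_sum N M c - (1 - c) ^- N) <= e M.
Proof.
move=> r01; have /andP[r0 r1] := r01; have r1' : 0 < 1 - r by rewrite subr_gt0.
elim: N => [|N [e e0 He]].
  exists (fun=> 0); first exact: cvg_cst.
  by move=> M c _; rewrite bin_sum0 expr0 invr1 subrr normc0.
exists (fun M => (1 - r)^-1 * (e M + r * ((mbin N.+1 M)%:R * r ^+ M))).
  rewrite -[X in _ --> X](mulr0 (1 - r)^-1); apply: cvgMr.
  rewrite -[X in _ --> X](addr0 0); apply: cvgD => //.
  by rewrite -[X in _ --> X](mulr0 r); apply: cvgMr; exact: mbin_exp_cvg0.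
move=> M c cr; have B := normc_1B cr.
have c1 : 1 - c != 0 by rewrite -normc_eq0 gt_eqF // (lt_le_trans r1').
have -> : bin_sum N.+1 M c - (1 - c) ^- N.+1 =
    (1 - c)^-1 * ((bin_sum N M c - (1 - c) ^- N) - (mbin N.+1 M)%:R * c ^+ M.+1).
  have -> : (1 - c) ^- N.+1 = (1 - c)^-1 * (1 - c) ^- N by rewrite exprS invfM.
  apply: (mulfI c1); rewrite mulrBr bin_sumS !mulrA divff // !mul1r.
  by ring.
rewrite normcM normcV ler_pM ?invr_ge0 ?normc_ge0 //.
  by rewrite lef_pV2 ?posrE // (lt_le_trans r1').
apply: le_trans (le_normcD _ _) _; rewrite normcN lerD ?He //.
rewrite normcM normcX -(rmorph_nat (real_complex R)) normcR ger0_norm // mulrCA -exprS.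
by rewrite ler_wpM2l // lerXn2r // nnegrE ?normc_ge0.
Qed.

Lemma bin_series_ccvg N (c : C) : normc c < 1 -> ccvg (fun M => bin_sum N M c) ((1 - c) ^- N).
Proof.
move=> c1; have r01 : 0 <= normc c < 1 by rewrite normc_ge0.
have [e e0 He] := bin_series_uniform N r01.
by apply: (ccvg_bound _ e0) => M; exact: He.
Qed.

(** If all coefficients before [m] vanish, the bound at radius 1/2 makes the part beyond [m] of
    order [r^(m+1)]. Dividing by [r^m] and letting [r] tend to 0 gives [c m = 0]. *)
Lemma power_series_zero (c : nat -> C) (B : R) :
  (forall M, \sum_(a < M.+1) normc (c a) * 2^-1 ^+ a <= B) ->
  (forall r : R, 0 < r < 1 -> ccvg (fun M => \sum_(a < M.+1) c a * r%:C ^+ a) 0) ->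
  forall a, c a = 0.
Proof.
move=> HB Hc; elim/ltn_ind => m IH.
have B0 : 0 <= B by apply: le_trans (HB 0); apply: sumr_ge0 => i _; rewrite mulr_ge0 ?normc_ge0 ?exprn_ge0 ?invr_ge0.
have tail (r : R) M : 0 < r <= 2^-1 -> (m <= M)%N ->
    normc (\sum_(a < M.+1) c a * r%:C ^+ a - c m * r%:C ^+ m) <= r ^+ m.+1 * (2 ^+ m.+1 * B).
  move=> /andP[r0 r2] mM.
  have mM' : (m < M.+1)%N by rewrite ltnS.
  rewrite (bigD1 (Ordinal mM')) //= addrAC subrr add0r.
  have T : normc (\sum_(i < M.+1 | i != Ordinal mM') c i * r%:C ^+ i) <=
      \sum_(i < M.+1 | i != Ordinal mM') normc (c i * r%:C ^+ i).
    elim/big_ind2: _ => // [|x1 x2 y1 y2 h1 h2]; first by rewrite normc0.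
    by apply: le_trans (le_normcD _ _) _; exact: lerD.
  apply: (le_trans T); rewrite mulrA -exprMn.
  apply: le_trans (_ : (r * 2) ^+ m.+1 * \sum_(a < M.+1) normc (c a) * 2^-1 ^+ a <= _); last first.
    by rewrite ler_wpM2l ?exprn_ge0 ?mulr_ge0 // ltW.
  rewrite mulr_sumr [leRHS](bigD1 (Ordinal mM')) //=.
  apply: le_trans (_ : \sum_(i < M.+1 | i != Ordinal mM')
     (r * 2) ^+ m.+1 * (normc (c i) * 2^-1 ^+ i) <= _); last first.
    by rewrite lerDr mulr_ge0 ?mulr_ge0 ?normc_ge0 ?exprn_ge0 ?mulr_ge0 ?invr_ge0 // ltW.
  apply: ler_sum => i im; have [lt_im|] := ltnP i m.
    by rewrite IH // mul0r normc0 mul0r mulr0.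
  rewrite leq_eqVlt => /orP[/eqP mi|mi]; first by move: im; rewrite -val_eqE /= -mi eqxx.
  rewrite normcM normcX normcR (ger0_norm (ltW r0)) mulrCA ler_wpM2l ?normc_ge0 //.
  rewrite -(subnK mi) exprD [2^-1 ^+ _]exprD [leRHS]mulrA [leRHS]mulrAC.
  rewrite exprMn -[X in _ <= X * _]mulrA -exprMn divff // expr1n mulr1 mulrC.
  by rewrite ler_wpM2l ?exprn_ge0 ?(ltW r0) // lerXn2r ?nnegrE ?invr_ge0 ?(ltW r0).
have key (r : R) : 0 < r <= 2^-1 -> normc (c m) <= r * (2 ^+ m.+1 * B).
  move=> r02; have /andP[r0 r2] := r02.
  have r1 : 0 < r < 1 by rewrite r0 (le_lt_trans r2) // invf_lt1 ?ltr1n.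
  rewrite -(ler_pM2l (exprn_gt0 m r0)) [leRHS]mulrA -exprSr.
  have -> : r ^+ m * normc (c m) = normc (c m * r%:C ^+ m).
    by rewrite normcM normcX normcR gtr0_norm // mulrC.
  have h := Hc r r1.
  have h2 : (fun M => normc (\sum_(a < M.+1) c a * r%:C ^+ a - 0) + r ^+ m.+1 * (2 ^+ m.+1 * B))
      @ \oo --> (0 + r ^+ m.+1 * (2 ^+ m.+1 * B) : R).
    by apply: cvgD h (cvg_cst _).
  rewrite add0r in h2; rewrite -(cvg_lim _ h2) //.
  apply: limr_ge; first by apply/cvg_ex; eexists; exact: h2.
  exists m => // M /= mM; rewrite subr0.
  set S := \sum_(a < M.+1) _.
  have -> : c m * r%:C ^+ m = S - (S - c m * r%:C ^+ m) by ring.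
  apply: le_trans (le_normcD _ _) _; rewrite normcN lerD2l.
  exact: tail.
apply/eqP; rewrite -normc_eq0; apply/eqP/le_anti; rewrite normc_ge0 andbT.
apply/ler_addgt0Pl => eps eps0; rewrite addr0.
(* The added 1 makes [D] positive even when [B = 0], so that [eps / D] is an admissible radius. *)
pose D := 2 ^+ m.+1 * B + 1.
have D0 : 0 < D by rewrite ltr_wpDl ?mulr_ge0 ?exprn_ge0.
have := key (Num.min 2^-1 (eps / D)).
rewrite lt_min invr_gt0 ltr0n divr_gt0 //= ge_min lexx /= => /(_ isT) H.
apply: le_trans H _; apply: le_trans (_ : Num.min 2^-1 (eps / D) * D <= _).
  rewrite ler_wpM2l ?lerDl // le_min invr_ge0 ler0n divr_ge0 // ltW //.
by rewrite -ler_pdivlMr // ge_min lexx orbT.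
Qed.

End BinomialSeries.

(** * Kernels *)

Section HermitianForm.
Context {R : realType} (n : nat).
Local Notation C := R[i].
Implicit Types (p q z w : cvec R n).

Lemma cinnerC p q : (cinner p q)^* = cinner q p.
Proof.
rewrite /cinner rmorph_sum; apply: eq_bigr => j _ /=.
by rewrite rmorphM /= mulrC; congr (_ * _); exact: conjcK.
Qed.

Lemma cinner_lincomb_l (a b : C) p q z :
  cinner (fun j => a * p j + b * q j) z = a * cinner p z + b * cinner q z.
Proof.
by rewrite /cinner !mulr_sumr -big_split; apply: eq_bigr => j _ /=; rewrite mulrDl !mulrA.
Qed.

Lemma cinner_lincomb_r (a b : C) p q z :
  cinner z (fun j => a * p j + b * q j) = a^*%C * cinner z p + b^*%C * cinner z q.
Proof. by rewrite -!(cinnerC _ z) cinner_lincomb_l rmorphD !rmorphM. Qed.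

Lemma cinner_self z : cinner z z = (cnorm2 z)%:C.
Proof.
rewrite /cinner /cnorm2 rmorph_sum; apply: eq_bigr => j _ /=.
exact: mulcJ.
Qed.

Lemma sqmodJ (c : C) : sqmod c^* = sqmod c.
Proof. by rewrite !sqmodE normc_conjc. Qed.

Lemma cnorm2_eq0 z : cnorm2 z = 0 -> forall j, z j = 0.
Proof.
move=> /eqP; rewrite psumr_eq0; last by move=> j _; exact: sqmod_ge0.
move=> /allP H j; have := H j (mem_index_enum _); rewrite /= sqmodE sqrf_eq0 normc_eq0.
by move=> /eqP.
Qed.

Lemma cauchy_schwarz p q : sqmod (cinner p q) <= cnorm2 p * cnorm2 q.
Proof.
have [q0|q0] := eqVneq (cnorm2 q) 0.
  rewrite q0 mulr0 (_ : cinner p q = 0) ?sqmodE ?normc0 ?expr0n //.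
  by rewrite /cinner big1 // => j _; rewrite (cnorm2_eq0 q0) conjC0 mulr0.
have Qp : 0 < cnorm2 q by rewrite lt_neqAle eq_sym q0 cnorm2_ge0.
set c := cinner p q; set Q := cnorm2 q.
have : 0 <= cnorm2 (fun j => Q%:C * p j + (- c) * q j) by exact: cnorm2_ge0.
suff -> : cnorm2 (fun j => Q%:C * p j + (- c) * q j) = Q * (cnorm2 p * Q - sqmod c).
  by rewrite pmulr_rge0 // subr_ge0.
apply: complexI; rewrite -cinner_self cinner_lincomb_l !cinner_lincomb_r.
rewrite !cinner_self -/Q -/c -[cinner q p]cinnerC -/c rmorphN conjc_real.
by rewrite !rmorphM rmorphB rmorphM /= -mulcJ; ring.
Qed.

Lemma sphere_cinner_le p z : on_sphere z -> normc (cinner p z) <= Num.sqrt (cnorm2 p).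
Proof.
move=> Sz; rewrite -(ler_pXn2r (n := 2)) ?nnegrE ?normc_ge0 ?sqrtr_ge0 //.
by rewrite -sqmodE sqr_sqrtr ?cnorm2_ge0 // (le_trans (cauchy_schwarz _ _)) // Sz mulr1.
Qed.

Lemma sphere_cinner_le_r p z : on_sphere z -> normc (cinner z p) <= Num.sqrt (cnorm2 p).
Proof. by move=> Sz; rewrite -cinnerC normc_conjc; exact: sphere_cinner_le. Qed.

Lemma in_ball_sqrt p : in_ball p -> 0 <= Num.sqrt (cnorm2 p) < 1.
Proof. by move=> pb; rewrite sqrtr_ge0 -[X in _ < X]sqrtr1 ltr_sqrt. Qed.

Lemma in_ball_cinner_lt1 p q : in_ball p -> in_ball q -> normc (cinner p q) < 1.
Proof.
move=> pb qb; rewrite -(ltr_pXn2r (n := 2)) ?nnegrE ?normc_ge0 // expr1n -sqmodE.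
apply: le_lt_trans (cauchy_schwarz _ _) _.
by rewrite -[ltRHS]mulr1 ltr_pM ?cnorm2_ge0.
Qed.

Lemma normc_lt1_neq0 (c : C) : normc c < 1 -> 1 - c != 0.
Proof.
move=> c1; rewrite -normc_eq0 gt_eqF // (lt_le_trans _ (normc_1B (lexx _))) //.
by rewrite subr_gt0.
Qed.

Lemma sphere_cinner_neq0 p z : in_ball p -> on_sphere z -> 1 - cinner p z != 0.
Proof.
move=> pb Sz; apply: normc_lt1_neq0; apply: le_lt_trans (sphere_cinner_le p Sz) _.
by case/andP: (in_ball_sqrt pb).
Qed.

(** The Cauchy-Szegő kernel, holomorphic in [p] and antiholomorphic in [z]; [cokern] is its
    conjugate. *)
Definition kern p z : C := (1 - cinner p z) ^- n.
Definition cokern p z : C := (1 - cinner z p) ^- n.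

Lemma sphere_alg_1Binv p : in_ball p -> sphere_alg (fun z => (1 - cinner p z)^-1).
Proof.
move=> pb; have /andP[r0 r1] := in_ball_sqrt pb.
apply: (@sphere_alg_inv _ _ _ (1 - Num.sqrt (cnorm2 p))); rewrite ?subr_gt0 //.
  by apply: sphere_algB; [exact: sphere_alg_cst|exact: sphere_alg_cinner_l].
by move=> z Sz; apply: normc_1B; exact: sphere_cinner_le.
Qed.

Lemma sphere_alg_1Binv_r p : in_ball p -> sphere_alg (fun z => (1 - cinner z p)^-1).
Proof.
move=> pb; have -> : (fun z => (1 - cinner z p)^-1) = (fun z => ((1 - cinner p z)^-1)^*).
  by apply/funext => z; rewrite fmorphV rmorphB rmorph1 /= -cinnerC.
exact: sphere_alg_conj (sphere_alg_1Binv pb).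
Qed.

Lemma sphere_alg_kern p : in_ball p -> sphere_alg (kern p).
Proof.
move=> pb; rewrite (_ : kern p = (fun z => ((1 - cinner p z)^-1) ^+ n)).
  by apply: sphere_alg_exp; exact: sphere_alg_1Binv.
by apply/funext => z; rewrite exprVn.
Qed.

Lemma sphere_alg_cokern p : in_ball p -> sphere_alg (cokern p).
Proof.
move=> pb; rewrite (_ : cokern p = (fun z => ((1 - cinner z p)^-1) ^+ n)).
  by apply: sphere_alg_exp; exact: sphere_alg_1Binv_r.
by apply/funext => z; rewrite exprVn.
Qed.

Lemma cokernE p z : cokern p z = (kern p z)^*.
Proof. by rewrite /cokern /kern fmorphV rmorphXn rmorphB rmorph1 /= -cinnerC. Qed.

Lemma sphere_alg_bin_sum N M f : sphere_alg f -> @sphere_alg R n (fun z => bin_sum N M (f z)).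
Proof.
move=> af; apply: sphere_alg_sum => a; apply: sphere_alg_mul; first exact: sphere_alg_cst.
exact: sphere_alg_exp.
Qed.

Context (l : (cvec R n -> C) -> C).

(** Absorbing a fixed factor into the functional makes it possible to expand the kernels of a
    product one at a time. *)
Lemma sup_linear_mulr f : sup_linear l -> sphere_alg f -> sup_linear (fun g => l (fun z => g z * f z)).
Proof.
move=> Hl af; have [K K0 HK] := sup_linear_bound Hl; have [N N0 HN] := sphere_alg_bounded af.
split.
- move=> g h ag ah; rewrite -(sup_linearD Hl); try exact: sphere_alg_mul.
  by congr l; apply/funext => z; rewrite mulrDl.
- move=> c g ag; rewrite -(sup_linearZ Hl); try exact: sphere_alg_mul.
  by congr l; apply/funext => z; rewrite mulrA.
- exists (K * N) => [|g M ag HM]; first exact: mulr_ge0.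
  rewrite -mulrA [N * M]mulrC; apply: HK; first exact: sphere_alg_mul.
  by move=> z Sz; rewrite normcM ler_pM ?normc_ge0 ?HM ?HN.
Qed.

Lemma sup_linear_kern p : sup_linear l -> in_ball p ->
  ccvg (fun M => \sum_(a < M.+1) (mbin n a)%:R * l (fun z => cinner p z ^+ a)) (l (kern p)).
Proof.
move=> Hl pb; have [e e0 He] := bin_series_uniform n (in_ball_sqrt pb).
have am a : sphere_alg (fun z => cinner p z ^+ a).
  by apply: sphere_alg_exp; exact: sphere_alg_cinner_l.
have aF M : sphere_alg (fun z => bin_sum n M (cinner p z)).
  by apply: sphere_alg_bin_sum; exact: sphere_alg_cinner_l.
have := sup_linear_cvg Hl (sphere_alg_kern pb) aF
  (fun M z Sz => He M _ (sphere_cinner_le p Sz)) e0.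
apply: ccvg_ext => M; rewrite /bin_sum (sup_linear_sum _ Hl); last first.
  by move=> a; apply: sphere_alg_mul => //; exact: sphere_alg_cst.
by apply: eq_bigr => a _; rewrite (sup_linearZ Hl).
Qed.

Lemma sup_linear_cokern p : sup_linear l -> in_ball p ->
  ccvg (fun M => \sum_(a < M.+1) (mbin n a)%:R * l (fun z => cinner z p ^+ a)) (l (cokern p)).
Proof.
move=> Hl pb; have [e e0 He] := bin_series_uniform n (in_ball_sqrt pb).
have am a : sphere_alg (fun z => cinner z p ^+ a).
  by apply: sphere_alg_exp; exact: sphere_alg_cinner_r.
have aF M : sphere_alg (fun z => bin_sum n M (cinner z p)).
  by apply: sphere_alg_bin_sum; exact: sphere_alg_cinner_r.
have := sup_linear_cvg Hl (sphere_alg_cokern pb) aF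
  (fun M z Sz => He M _ (sphere_cinner_le_r p Sz)) e0.
apply: ccvg_ext => M; rewrite /bin_sum (sup_linear_sum _ Hl); last first.
  by move=> a; apply: sphere_alg_mul => //; exact: sphere_alg_cst.
by apply: eq_bigr => a _; rewrite (sup_linearZ Hl).
Qed.

End HermitianForm.

Lemma ccvg_sum_one (R : realType) (c : R[i]) (u : nat -> R[i]) b : (forall a, a != b -> u a = 0) -> u b = c ->
  ccvg (fun M => \sum_(a < M.+1) u a) c.
Proof.
move=> u0 ub; apply: (@ccvg_eventually _ _ _ b) => M bM.
have bM' : (b < M.+1)%N by rewrite ltnS.
rewrite (bigD1 (Ordinal bM')) //= big1 ?addr0 // => a ab; apply: u0.
by move: ab; rewrite -val_eqE.
Qed.

Section KernelPairing.
Context {R : realType} (n : nat) (n0 : (0 < n)%N).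
Local Notation C := R[i].
Implicit Types (p q z w : cvec R n).
Context (l : (cvec R n -> C) -> C).

(** The reproducing property. Orthogonality keeps the diagonal terms, and one of the two
    coefficients [mbin n b] cancels the inverse binomial of the moment, leaving the binomial series
    of [<p, q>]. *)
Lemma mean_kern_cokern p q : is_sphere_mean l -> in_ball p -> in_ball q ->
  l (fun z => kern p z * cokern q z) = (1 - cinner p q) ^- n.
Proof.
move=> Hl pb qb; have Hs := sphere_mean_linear Hl.
have mn b : (mbin n b)%:R != 0 :> C by rewrite pnatr_eq0 -lt0n mbin_gt0.
have E b : l (fun z => kern p z * cinner z q ^+ b) = cinner p q ^+ b.
  have ab : sphere_alg (fun z => cinner z q ^+ b).
    by apply: sphere_alg_exp; exact: sphere_alg_cinner_r.
  apply: (ccvg_unique (sup_linear_kern (sup_linear_mulr Hs ab) pb)).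
  apply: (ccvg_sum_one (b := b) (u := fun a => (mbin n a)%:R * l (fun z => cinner p z ^+ a * cinner z q ^+ b))) => [a ab'|].
    by rewrite (sphere_mean_mono Hl) (negbTE ab') mulr0.
  by rewrite (sphere_mean_mono Hl) eqxx mulrA divff // mul1r.
have := sup_linear_cokern (sup_linear_mulr Hs (sphere_alg_kern pb)) qb.
have -> : l (fun z => cokern q z * kern p z) = l (fun z => kern p z * cokern q z).
  by congr l; apply/funext => z; rewrite mulrC.
move=> H; apply: (ccvg_unique H).
have := bin_series_ccvg n (in_ball_cinner_lt1 pb qb).
apply: ccvg_ext => M; apply: eq_bigr => b _; rewrite -E; congr (_ * l _).
by apply/funext => z; rewrite mulrC.
Qed.

(* Continuous functionals are determined on products of kernels by their
   values on kernels: expand in powers, extract coefficients, polarize. *)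
Lemma kern_kill_mul z w : sup_linear l -> (forall p, in_ball p -> l (kern p) = 0) ->
  in_ball z -> in_ball w -> l (fun x => kern z x * kern w x) = 0.
Proof.
move=> Hl H0 zb wb.
have am p a : sphere_alg (fun x => cinner p x ^+ a).
  by apply: sphere_alg_exp; exact: sphere_alg_cinner_l.
have scal (c : C) p x : cinner (fun j => c * p j) x = c * cinner p x.
  by rewrite -[RHS]addr0 -(mul0r (cinner p x)) -cinner_lincomb_l; congr cinner; apply/funext => j; rewrite mul0r addr0.
have scaln (c : C) p : cnorm2 (fun j => c * p j) = sqmod c * cnorm2 p.
  by rewrite /cnorm2 mulr_sumr; apply: eq_bigr => j _; rewrite sqmodM.
(* Along the dilates [r p] the hypothesis says that a power series in [r] vanishes on []0, 1[],
   hence so does each coefficient. *)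
have small p a : in_ball p -> l (fun x => cinner p x ^+ a) = 0.
  move=> pb; have [K K0 HK] := sup_linear_bound Hl.
  have mn : (mbin n a)%:R != 0 :> C by rewrite pnatr_eq0 -lt0n mbin_gt0.
  apply: (mulfI mn); rewrite mulr0; move: a {mn}.
  apply: (@power_series_zero R _ (K * (1 - 2^-1) ^- n)).
    move=> M; apply: le_trans (_ : K * bin_sum n M 2^-1 <= _); last first.
      rewrite ler_wpM2l // bin_sum_le // invr_ge0 ler0n /= invf_lt1 ?ltr1n //.
    rewrite /bin_sum mulr_sumr; apply: ler_sum => a _; rewrite mulrA ler_wpM2r ?exprn_ge0 ?invr_ge0 //.
    rewrite normcM -(rmorph_nat (real_complex R)) normcR ger0_norm // mulrC ler_wpM2r //.
    rewrite -[leRHS]mulr1; apply: HK => // x Sx; rewrite normcX exprn_ile1 ?normc_ge0 //.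
    by apply: le_trans (sphere_cinner_le p Sx) _; case/andP: (in_ball_sqrt pb) => _ /ltW.
  move=> r /andP[r0 r1].
  have rb : in_ball (fun j => r%:C * p j).
    rewrite /in_ball scaln sqmodR; apply: le_lt_trans pb.
    by rewrite ler_piMl ?cnorm2_ge0 // exprn_ile1 // ltW.
  have := sup_linear_kern Hl rb; rewrite (H0 _ rb).
  apply: ccvg_ext => M; apply: eq_bigr => a _.
  have -> : (fun x => cinner (fun j => r%:C * p j) x ^+ a) = (fun x => r%:C ^+ a * cinner p x ^+ a).
    by apply/funext => x; rewrite scal exprMn.
  by rewrite (sup_linearZ Hl) // mulrA mulrAC.
(* The points [k z + w] used for polarization leave the ball; homogeneity brings them back. With
   [s = 1 / (1 + |p|^2)] the squared norm of [s p] is [s (1 - s) < 1]. *)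
have all p a : l (fun x => cinner p x ^+ a) = 0.
  pose s := (1 + cnorm2 p)^-1.
  have s1 : 0 < 1 + cnorm2 p by rewrite ltr_wpDr ?cnorm2_ge0.
  have s0 : 0 < s by rewrite invr_gt0.
  have sb : in_ball (fun j => s%:C * p j).
    rewrite /in_ball scaln sqmodR expr2 -mulrA.
    have E : s * cnorm2 p = 1 - s.
      by rewrite /s; field; rewrite gt_eqF.
    have sle : s <= 1 by rewrite /s invf_le1 // lerDl cnorm2_ge0.
    by rewrite E; nra.
  have sn : s%:C ^+ a != 0 by rewrite expf_neq0 //; apply/eqP => /complexI /eqP; rewrite gt_eqF.
  apply: (mulfI sn); rewrite mulr0 -(sup_linearZ Hl) // -(small _ a sb); congr l.
  by apply/funext => x; rewrite scal exprMn.
(* Polarization: these are, up to binomial coefficients, the coefficients of the powers of [k] in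
   [l] applied to the power [a + b] of [<k z + w, .>]. *)
have mix a b : l (fun x => cinner z x ^+ a * cinner w x ^+ b) = 0.
  pose N := (a + b)%N; have aN : (a < N.+1)%N by rewrite ltnS leq_addr.
  pose c i := 'C(N, i)%:R * l (fun x => cinner z x ^+ i * cinner w x ^+ (N - i)).
  have am2 i j : sphere_alg (fun x => cinner z x ^+ i * cinner w x ^+ j).
    exact: sphere_alg_mul.
  have Hc (k : nat) : \sum_(i < N.+1) c i * k%:R ^+ i = \sum_(i < N.+1) 0 * k%:R ^+ i.
    rewrite [RHS]big1 => [|i _]; last by rewrite mul0r.
    transitivity (l (fun x => cinner (fun j => k%:R * z j + 1 * w j) x ^+ N)); last exact: all.
    have -> : (fun x => cinner (fun j => k%:R * z j + 1 * w j) x ^+ N) =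
        (fun x => \sum_(i < N.+1) ('C(N, i)%:R * k%:R ^+ i) *
           (cinner z x ^+ i * cinner w x ^+ (N - i))).
      apply/funext => x; rewrite cinner_lincomb_l mul1r addrC exprDn.
      by apply: eq_bigr => i _; rewrite exprMn -mulr_natl; ring.
    rewrite (sup_linear_sum _ Hl); last first.
      by move=> i; apply: sphere_alg_mul => //; exact: sphere_alg_cst.
    by apply: eq_bigr => i _; rewrite (sup_linearZ Hl) // /c mulrAC.
  have := poly_coef_ext (c' := fun=> 0) Hc aN; rewrite /c /N addKn => /eqP.
  rewrite mulf_eq0 pnatr_eq0 -leqn0 leqNgt bin_gt0 leq_addr /=.
  by move=> /eqP.
have step p (f : cvec R n -> C) : sphere_alg f -> in_ball p ->
    (forall a, l (fun x => cinner p x ^+ a * f x) = 0) -> l (fun x => kern p x * f x) = 0.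
  move=> af pb Hf; apply: (ccvg_unique (sup_linear_kern (sup_linear_mulr Hl af) pb)).
  by apply: (@ccvg_eventually _ _ _ 0) => M _; rewrite big1 // => a _; rewrite Hf mulr0.
apply: (step _ (kern w)) => //; first exact: sphere_alg_kern.
move=> a; have -> : (fun x => cinner z x ^+ a * kern w x) = (fun x => kern w x * cinner z x ^+ a).
  by apply/funext => x; rewrite mulrC.
apply: (step _ (fun x => cinner z x ^+ a)) => // b; rewrite -[RHS](mix a b); congr l.
by apply/funext => x; rewrite mulrC.
Qed.

End KernelPairing.

(** * Moebius invariance *)

Section ConjugationRules.
Context {R : realType}.
Implicit Types a b : R[i].

Lemma conjcM a b : (a * b)^* = a^*%C * b^*%C. Proof. exact: rmorphM. Qed.
Lemma conjcD a b : (a + b)^* = a^*%C + b^*%C. Proof. exact: rmorphD. Qed.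
Lemma conjcN a : (- a)^* = - a^*%C. Proof. exact: rmorphN. Qed.
Lemma conjcV a : (a^-1)^* = (a^*%C)^-1. Proof. exact: fmorphV. Qed.
Lemma conjc_one : (1 : R[i])^* = 1. Proof. exact: rmorph1. Qed.

Definition conjcE := (conjcM, conjcD, conjcN, conjcV, conjc_one).
End ConjugationRules.

Section Moebius.
Context {R : realType} (n : nat) (n0 : (0 < n)%N).
Local Notation C := R[i].
Implicit Types (p q w : cvec R n).
Context (z : cvec R n) (zb : in_ball z).

Let sigma : C := (Num.sqrt (1 - cnorm2 z))%:C.

Lemma cnorm2_sigma : (cnorm2 z)%:C = 1 - sigma ^+ 2.
Proof.
rewrite -rmorphXn /= sqr_sqrtr; last by rewrite subr_ge0 ltW.
by rewrite rmorphB rmorph1 subKr.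
Qed.

Lemma sigma_add1_neq0 : 1 + sigma != 0.
Proof.
rewrite -(rmorph1 (real_complex R)) -rmorphD; apply/eqP => /complexI /eqP.
by rewrite gt_eqF // ltr_wpDr ?sqrtr_ge0.
Qed.

Lemma sigmaJ : sigma^* = sigma.
Proof. exact: conjc_real. Qed.

Lemma cinner_zz : cinner z z = 1 - sigma ^+ 2.
Proof. by rewrite cinner_self cnorm2_sigma. Qed.

(* The involutive automorphism of the ball exchanging 0 and z. *)
Definition moebius_a p : C := (1 - cinner p z / (1 + sigma)) / (1 - cinner p z).
Definition moebius_b p : C := - sigma / (1 - cinner p z).
(** The usual formula decomposes [p] along [z] and its orthogonal complement. Here [1 / (1 + sigma)]
    replaces [(1 - sigma) / |z|^2], so that [z = 0] is no exception. *)
Definition moebius p : cvec R n := fun j => moebius_a p * z j + moebius_b p * p j.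

Lemma moebius_aJ p : (moebius_a p)^* = (1 - cinner z p / (1 + sigma)) / (1 - cinner z p).
Proof.
by rewrite /moebius_a !conjcE cinnerC sigmaJ.
Qed.

Lemma moebius_bJ p : (moebius_b p)^* = - sigma / (1 - cinner z p).
Proof.
by rewrite /moebius_b !conjcE cinnerC sigmaJ.
Qed.

(** Moves the map from the variable to the parameter: a kernel composed with the map is again a
    kernel, up to elementary factors. *)
Lemma moebius_r p q : 1 - cinner p z != 0 -> 1 - cinner z q != 0 ->
  1 - cinner p (moebius q) = (1 - cinner p z) * (1 - cinner (moebius p) q) / (1 - cinner z q).
Proof.
move=> h1 h2; rewrite cinner_lincomb_r cinner_lincomb_l moebius_aJ moebius_bJ.
by rewrite /moebius_a /moebius_b; field; rewrite h1 h2 sigma_add1_neq0.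
Qed.

Lemma moebius_l p q : 1 - cinner p z != 0 -> 1 - cinner z q != 0 ->
  1 - cinner (moebius p) q = (1 - cinner z q) * (1 - cinner p (moebius q)) / (1 - cinner p z).
Proof.
move=> h1 h2; rewrite moebius_r //; field; rewrite h1 h2 //.
Qed.

Lemma moebius_moebius p q : 1 - cinner p z != 0 -> 1 - cinner z q != 0 ->
  1 - cinner (moebius p) (moebius q) =
  sigma ^+ 2 * (1 - cinner p q) / ((1 - cinner p z) * (1 - cinner z q)).
Proof.
move=> h1 h2; rewrite cinner_lincomb_r !cinner_lincomb_l moebius_aJ moebius_bJ cinner_zz.
by rewrite /moebius_a /moebius_b; field; rewrite h1 h2 sigma_add1_neq0.
Qed.

Lemma moebius_z p : 1 - cinner p z != 0 ->
  cinner (moebius p) z = (1 - sigma ^+ 2 - cinner p z) / (1 - cinner p z).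
Proof.
move=> h1; rewrite cinner_lincomb_l cinner_zz /moebius_a /moebius_b.
by field; rewrite h1 sigma_add1_neq0.
Qed.

Lemma cinner_neq0C p q : 1 - cinner p q != 0 -> 1 - cinner q p != 0.
Proof.
by rewrite -(cinnerC p q) -(rmorph1 (@conjc R)) -rmorphB conjc_eq0 rmorph1.
Qed.

Lemma one_minus_moebius p : 1 - cinner p z != 0 ->
  1 - cnorm2 (moebius p) = (1 - cnorm2 z) * (1 - cnorm2 p) / sqmod (1 - cinner p z).
Proof.
move=> h1; apply: complexI; rewrite rmorphB rmorph1 /= -cinner_self moebius_moebius //; last first.
  exact: cinner_neq0C.
rewrite cinner_self !rmorphM fmorphV /= -mulcJ !rmorphB !rmorph1 /= cinnerC cnorm2_sigma.
by congr (_ * _ / _); ring.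
Qed.

Lemma sqmod_gt0 (c : C) : c != 0 -> 0 < sqmod c.
Proof. by move=> c0; rewrite sqmodE exprn_gt0 // lt_neqAle eq_sym normc_eq0 c0 normc_ge0. Qed.

Lemma moebius_sphere p : on_sphere p -> on_sphere (moebius p).
Proof.
move=> Sp; have h1 := cinner_neq0C (sphere_cinner_neq0 zb Sp).
have := one_minus_moebius h1; rewrite Sp subrr mulr0 mul0r => /eqP.
by rewrite subr_eq0 eq_sym => /eqP.
Qed.

Lemma in_ball_cinner_neq0 p q : in_ball p -> in_ball q -> 1 - cinner p q != 0.
Proof. by move=> pb qb; apply: normc_lt1_neq0; exact: in_ball_cinner_lt1. Qed.

Lemma moebius_ball p : in_ball p -> in_ball (moebius p).
Proof.
move=> pb; have h1 := in_ball_cinner_neq0 pb zb.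
rewrite /in_ball -subr_gt0 one_minus_moebius // divr_gt0 ?sqmod_gt0 //.
by rewrite mulr_gt0 ?subr_gt0.
Qed.

Lemma sphere_alg_moebius f : sphere_alg f -> sphere_alg (fun p => f (moebius p)).
Proof.
have a1 : sphere_alg (fun p => cinner p z) by exact: sphere_alg_cinner_r.
have ai : sphere_alg (fun p => (1 - cinner p z)^-1) by exact: sphere_alg_1Binv_r.
elim=> {f} [c|j|f _ IH|f g _ IHf _ IHg|f g _ IHf _ IHg|f e _ IH e0 He].
- exact: sphere_alg_cst.
- apply: sphere_alg_add; apply: sphere_alg_mul; try exact: sphere_alg_cst; try exact: sphere_alg_coord.
    apply: sphere_alg_mul => //; apply: sphere_algB; first exact: sphere_alg_cst.
    by apply: sphere_alg_mul => //; exact: sphere_alg_cst.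
  by apply: sphere_alg_mul => //; exact: sphere_alg_cst.
- exact: sphere_alg_conj.
- exact: sphere_alg_add.
- exact: sphere_alg_mul.
- by apply: (sphere_alg_inv IH e0) => p Sp; apply: He; exact: moebius_sphere.
Qed.

Context (l : (cvec R n -> C) -> C) (Hl : is_sphere_mean l).
Let Hs := sphere_mean_linear Hl.

(** Multiplied by [(1 - |z|^2)^n] this is the Poisson kernel at [z] up to normalization, the density
    that the change of variables introduces on the sphere. *)
Definition moebius_weight p : C := kern z p * cokern z p.

Lemma sphere_alg_weight : sphere_alg moebius_weight.
Proof. by apply: sphere_alg_mul; [exact: sphere_alg_kern|exact: sphere_alg_cokern]. Qed.

(** The failure of invariance for the product [f g]. It is written as a function of two factors
    because it is extended in one of them while the other stays fixed. *)
Definition moebius_defect (f g : cvec R n -> C) : C :=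
  l (fun p => f p * g p) -
  sigma ^+ 2 ^+ n * l (fun p => f (moebius p) * (g (moebius p) * moebius_weight p)).

Lemma moebius_defect_kern p q : in_ball p -> in_ball q ->
  moebius_defect (kern p) (cokern q) = 0.
Proof.
move=> pb qb; rewrite /moebius_defect (mean_kern_cokern n0 Hl) //.
have h1 := in_ball_cinner_neq0 pb zb; have h2 := in_ball_cinner_neq0 zb qb.
have h3 := in_ball_cinner_neq0 (moebius_ball pb) (moebius_ball qb).
have h4 := in_ball_cinner_neq0 pb qb.
(* What remains outside the kernels at the image points: the weight cancels exactly the factors that
   depend on the variable. *)
pose c := ((1 - cinner p z) * (1 - cinner z q)) ^- n.
have ak : sphere_alg (fun x => kern (moebius p) x * cokern (moebius q) x).
  apply: sphere_alg_mul; first exact/sphere_alg_kern/moebius_ball.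
  exact/sphere_alg_cokern/moebius_ball.
rewrite (sup_linear_eq Hs (g := fun x => c * (kern (moebius p) x * cokern (moebius q) x))).
- rewrite (sup_linearZ Hs) // (mean_kern_cokern n0 Hl); try exact: moebius_ball.
  rewrite moebius_moebius // /c.
  have s0 : sigma != 0.
    apply/eqP => /complexI /eqP; rewrite sqrtr_eq0 leNgt => /negP; apply.
    by rewrite subr_gt0.
  rewrite -!exprVn -!exprMn; apply/eqP; rewrite subr_eq0; apply/eqP; congr (_ ^+ _).
  by field; rewrite h1 h2 h4 s0.
- apply: sphere_alg_mul; first exact: (sphere_alg_moebius (sphere_alg_kern pb)).
  apply: sphere_alg_mul; first exact: (sphere_alg_moebius (sphere_alg_cokern qb)).
  exact: sphere_alg_weight.
- by apply: sphere_alg_mul => //; exact: sphere_alg_cst.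
- move=> x Sx; have h5 := sphere_cinner_neq0 zb Sx; have h6 := cinner_neq0C h5.
  have h7 := sphere_cinner_neq0 (moebius_ball pb) Sx.
  have h8 := cinner_neq0C (sphere_cinner_neq0 (moebius_ball qb) Sx).
  rewrite /kern /cokern /moebius_weight /c /kern /cokern (@moebius_r p x) // (@moebius_l x q) //.
  rewrite -!exprVn -!exprMn; congr (_ ^+ _).
  by field; rewrite h1 h2 h5 h6 h7 h8.
Qed.

Lemma sup_linear_sub (c : C) (l1 l2 : (cvec R n -> C) -> C) : sup_linear l1 -> sup_linear l2 ->
  sup_linear (fun f => l1 f - c * l2 f).
Proof.
move=> H1 H2; have [K1 K10 B1] := sup_linear_bound H1; have [K2 K20 B2] := sup_linear_bound H2.
split.
- by move=> f g af ag; rewrite (sup_linearD H1) // (sup_linearD H2) //; ring.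
- by move=> a f af; rewrite (sup_linearZ H1) // (sup_linearZ H2) //; ring.
- exists (K1 + normc c * K2) => [|f M af HM]; first by rewrite addr_ge0 ?mulr_ge0 ?normc_ge0.
  apply: le_trans (le_normcD _ _) _; rewrite normcN normcM mulrDl lerD ?B1 //.
  by rewrite -mulrA ler_wpM2l ?normc_ge0 ?B2.
Qed.

Lemma sup_linear_moebius (l1 : (cvec R n -> C) -> C) : sup_linear l1 ->
  sup_linear (fun f => l1 (fun p => f (moebius p))).
Proof.
move=> H1; have [K K0 B] := sup_linear_bound H1; split.
- by move=> f g af ag; rewrite (sup_linearD H1) //; exact: sphere_alg_moebius.
- by move=> a f af; rewrite (sup_linearZ H1) //; exact: sphere_alg_moebius.
- exists K => // f M af HM; apply: B; first exact: sphere_alg_moebius.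
  by move=> p Sp; apply: HM; exact: moebius_sphere.
Qed.

Lemma sup_linear_defect g : sphere_alg g -> sup_linear (fun f => moebius_defect f g).
Proof.
move=> ag; apply: sup_linear_sub; first exact: sup_linear_mulr.
apply: (sup_linear_moebius (l1 := fun f => l (fun p => f p * (g (moebius p) * moebius_weight p)))).
apply: sup_linear_mulr => //; apply: sphere_alg_mul; last exact: sphere_alg_weight.
exact: sphere_alg_moebius.
Qed.

Lemma moebius_defectC f g : moebius_defect f g = moebius_defect g f.
Proof.
rewrite /moebius_defect; congr (l _ - _ * l _); apply/funext => p; first by rewrite mulrC.
by rewrite mulrCA.
Qed.

(** Conjugating both argument and value keeps linearity and exchanges kernels with cokernels, so
    [kern_kill_mul] also applies to the antiholomorphic slot. *)
Lemma sup_linear_conj (l1 : (cvec R n -> C) -> C) : sup_linear l1 ->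
  sup_linear (fun f => (l1 (fun p => (f p)^*))^*).
Proof.
move=> H1; have [K K0 B] := sup_linear_bound H1; split.
- move=> f g af ag; rewrite -rmorphD -(sup_linearD H1); try exact: sphere_alg_conj.
  by congr (conjc (l1 _)); apply/funext => p; rewrite rmorphD.
- move=> a f af; rewrite -[a in RHS]conjcK -rmorphM -(sup_linearZ H1); try exact: sphere_alg_conj.
  by congr (conjc (l1 _)); apply/funext => p; rewrite rmorphM.
- exists K => // f M af HM; rewrite normc_conjc; apply: B; first exact: sphere_alg_conj.
  by move=> p Sp; rewrite normc_conjc; exact: HM.
Qed.

Lemma moebius_defect_main w : in_ball w ->
  moebius_defect (fun x => kern z x * kern w x) (fun x => cokern z x * cokern w x) = 0.
Proof.
move=> wb.
have E1 q : in_ball q -> moebius_defect (fun x => kern z x * kern w x) (cokern q) = 0.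
  move=> qb; apply: (kern_kill_mul n0 (sup_linear_defect (sphere_alg_cokern qb))) => // p pb.
  exact: moebius_defect_kern.
pose g x := kern z x * kern w x.
have ag : sphere_alg g by apply: sphere_alg_mul; exact: sphere_alg_kern.
(* Second slot: the product of two kernels is now the fixed factor, and the vanishing on single
   cokernels is [E1]. *)
have H2 := sup_linear_conj (sup_linear_defect ag).
have E2 : conjc (moebius_defect (fun x => conjc (kern z x * kern w x)) g) = 0.
  apply: (kern_kill_mul n0 H2) => // p pb; rewrite moebius_defectC.
  by rewrite (_ : (fun x => _) = cokern p) ?E1 ?rmorph0 //; apply/funext => x; rewrite cokernE.
move/eqP: E2; rewrite conjc_eq0 moebius_defectC => /eqP <-; congr moebius_defect.
by apply/funext => x; rewrite !cokernE rmorphM.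
Qed.

(** The map sends [z] to 0, so the kernel at [z] becomes a positive power of [1 - <z, x>] over a
    constant; the kernel at [w] yields another such power. The weight removes one of the two, and
    likewise for the conjugates, so a polynomial times the kernels at the image of [w] remains. *)
Lemma sphere_mean_moebius w : in_ball w ->
  l (fun x => kern z x * kern w x * (cokern z x * cokern w x)) =
  (sigma ^+ 2 * ((1 - cinner w z) * (1 - cinner z w))) ^- n *
  l (fun x => (1 - cinner z x) ^+ n * (1 - cinner x z) ^+ n *
    (kern (moebius w) x * cokern (moebius w) x)).
Proof.
move=> wb; move/eqP: (moebius_defect_main wb); rewrite /moebius_defect subr_eq0 => /eqP ->.
have h1 := in_ball_cinner_neq0 wb zb; have h2 := in_ball_cinner_neq0 zb wb.
have wb' := moebius_ball wb.
have s0 : sigma != 0.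
  apply/eqP => /complexI /eqP; rewrite sqrtr_eq0 leNgt => /negP; apply.
  by rewrite subr_gt0.
(* Each of the two kernels at [z] contributes a factor [sigma^2] in the base; one is cancelled by
   the constant in front of the transformed mean. *)
pose c := (sigma ^+ 2 * (sigma ^+ 2 * ((1 - cinner w z) * (1 - cinner z w)))) ^- n.
have aH : sphere_alg (fun x => (1 - cinner z x) ^+ n * (1 - cinner x z) ^+ n *
    (kern (moebius w) x * cokern (moebius w) x)).
  apply: sphere_alg_mul; apply: sphere_alg_mul.
  - apply: sphere_alg_exp; apply: sphere_algB; first exact: sphere_alg_cst.
    exact: sphere_alg_cinner_l.
  - apply: sphere_alg_exp; apply: sphere_algB; first exact: sphere_alg_cst.
    exact: sphere_alg_cinner_r.
  - exact: sphere_alg_kern.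
  - exact: sphere_alg_cokern.
rewrite (sup_linear_eq Hs (g := fun x => c * ((1 - cinner z x) ^+ n * (1 - cinner x z) ^+ n *
    (kern (moebius w) x * cokern (moebius w) x)))).
- rewrite (sup_linearZ Hs) // mulrA; congr (_ * _); rewrite /c -!exprVn -!exprMn; congr (_ ^+ _).
  by field; rewrite s0 h1 h2.
- apply: sphere_alg_mul.
    by apply: (sphere_alg_moebius (f := fun x => kern z x * kern w x)); apply: sphere_alg_mul; exact: sphere_alg_kern.
  apply: sphere_alg_mul; last exact: sphere_alg_weight.
  by apply: (sphere_alg_moebius (f := fun x => cokern z x * cokern w x)); apply: sphere_alg_mul; exact: sphere_alg_cokern.
- by apply: sphere_alg_mul => //; exact: sphere_alg_cst.
- move=> x Sx; have h5 := sphere_cinner_neq0 zb Sx; have h6 := cinner_neq0C h5.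
  have h7 := sphere_cinner_neq0 wb' Sx.
  have h8 := cinner_neq0C h7.
  have mz : moebius z = (fun=> 0).
    apply/funext => j; rewrite /moebius -mulrDl (_ : _ + _ = 0) ?mul0r //.
    rewrite /moebius_a /moebius_b cinner_zz subKr.
    by field; rewrite sigma_add1_neq0 s0.
  have c0 q : cinner (fun=> 0 : C) q = 0 by rewrite /cinner big1 // => j _; rewrite mul0r.
  have c0' q : cinner q (fun=> 0 : C) = 0.
    by rewrite -(cinnerC (fun=> 0) q) c0 rmorph0.
  have zz : 1 - cinner z z != 0 by rewrite cinner_zz subKr expf_neq0.
  rewrite /moebius_weight /c /kern /cokern (@moebius_r z x) // (@moebius_r w x) //.
  rewrite (@moebius_l x z) // (@moebius_l x w) //.
  rewrite !mz ?c0 ?c0' cinner_zz subKr.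
  rewrite -!exprVn -!exprMn; congr (_ ^+ _).
  by field; rewrite s0 h1 h2 h5 h6 h7 h8.
Qed.

End Moebius.

Lemma exprD_bin (F : comNzRingType) (a b : F) N :
  (a + b) ^+ N = \sum_(i < N.+1) 'C(N, i)%:R * (a ^+ (N - i) * b ^+ i).
Proof. by rewrite exprDn; apply: eq_bigr => i _; rewrite mulr_natl. Qed.

(** * Hypergeometric expansion *)

Section HypergeometricSeries.
Context {R : realType}.
Implicit Types (a b c t : R).

Lemma poch0 a : poch a 0 = 1.
Proof. by rewrite /poch big_ord0. Qed.

Lemma pochS a k : poch a k.+1 = poch a k * (a + k%:R).
Proof. by rewrite /poch big_ord_recr. Qed.

Lemma poch_nat (m k : nat) : (0 < m)%N -> poch (m%:R : R) k = ((m + k).-1)`!%:R / (m.-1)`!%:R.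
Proof.
have f0 j : j`!%:R != 0 :> R by rewrite pnatr_eq0 -lt0n fact_gt0.
move=> m0; elim: k => [|k IH]; first by rewrite poch0 addn0 divff.
have E : (m + k)`!%:R = (m%:R + k%:R) * ((m + k).-1)`!%:R :> R.
  by rewrite -natrD -natrM; case: (m) m0 => // m' _; rewrite addSn factS.
by rewrite pochS IH addnS /= E; field; rewrite f0.
Qed.

Lemma poch_neg (m k : nat) : poch (- m%:R : R) k = (-1) ^+ k * 'C(m, k)%:R * k`!%:R.
Proof.
rewrite -mulrA -natrM bin_ffact; elim: k => [|k IH]; first by rewrite poch0 ffactn0 mulr1.
rewrite pochS IH ffactnSr natrM exprS.
have [km|mk] := leqP k m; first by rewrite natrB //; ring.
by rewrite ffact_small // !(mulr0, mul0r).
Qed.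

Lemma poch_nat_gt0 (m k : nat) : (0 < m)%N -> 0 < poch (m%:R : R) k.
Proof. by move=> m0; rewrite poch_nat // divr_gt0 // ltr0n fact_gt0. Qed.

Lemma mbin_poch (m k : nat) : (0 < m)%N -> (mbin m k)%:R = poch (m%:R : R) k / k`!%:R.
Proof.
have f0 j : j`!%:R != 0 :> R by rewrite pnatr_eq0 -lt0n fact_gt0.
move=> m0; rewrite poch_nat // /mbin.
have E : 'C((m + k).-1, k)%:R * (k`!%:R * (m.-1)`!%:R) = ((m + k).-1)`!%:R :> R.
  by rewrite -!natrM (_ : m.-1 = (m + k).-1 - k)%N ?bin_fact //; lia.
by rewrite -E; field; rewrite !f0.
Qed.

Lemma poch_le (m m' k : nat) : (m <= m')%N -> (0 < m)%N -> poch (m%:R : R) k <= poch m'%:R k.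
Proof.
move=> mm m0; elim: k => [|k IH]; first by rewrite !poch0.
rewrite !pochS ler_pM //; first by rewrite ltW // poch_nat_gt0.
by rewrite lerD2r ler_nat.
Qed.

(** Because [a <= c], the quotient of the Pochhammer symbols of [a] and [c] is at most 1, and the
    series is dominated by the binomial series of exponent [b]. *)
Lemma hyp2F1_ccvg (a b c : nat) t : (0 < a)%N -> (0 < b)%N -> (a <= c)%N -> 0 <= t < 1 ->
  ccvg (fun M => \sum_(k < M.+1)
    (poch a%:R k * poch b%:R k / (poch c%:R k * k`!%:R) * t ^+ k)%:C) (hyp2F1 a%:R b%:R c%:R t)%:C.
Proof.
move=> a0 b0 ac t01; have c0 : (0 < c)%N := leq_trans a0 ac.
have /andP[t0 t1] := t01.
pose u k : R := poch a%:R k * poch b%:R k / (poch c%:R k * k`!%:R) * t ^+ k.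
have fp k : 0 < k`!%:R :> R by rewrite ltr0n fact_gt0.
have u0 k : 0 <= u k.
  by rewrite mulr_ge0 ?exprn_ge0 // divr_ge0 // mulr_ge0 // ltW // poch_nat_gt0.
have ule k : u k <= (mbin b k)%:R * t ^+ k.
  rewrite /u mbin_poch // ler_wpM2r ?exprn_ge0 // ler_pdivrMr ?mulr_gt0 ?poch_nat_gt0 //.
  rewrite (_ : _ / _ * _ = poch b%:R k * poch c%:R k); last by field; rewrite gt_eqF.
  by rewrite mulrC ler_pM2l ?poch_nat_gt0 // poch_le.
have cv : cvgn (fun N => \sum_(k < N) u k).
  apply: nondecreasing_is_cvgn.
    by apply/nondecreasing_seqP => N; rewrite big_ord_recr /= lerDl.
  exists ((1 - t) ^- b) => _ [N _ <-]; apply: le_trans (bin_sum_le b N t01).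
  rewrite /bin_sum big_ord_recr /=; apply: ler_wpDr; first by rewrite mulr_ge0 ?exprn_ge0.
  by apply: ler_sum => k _; exact: ule.
have H : (fun N => \sum_(k < N.+1) u k) @ \oo --> hyp2F1 a%:R b%:R c%:R t.
  by rewrite (cvg_shiftS (fun N => \sum_(k < N) u k)).
by apply: ccvg_ext (ccvg_real H) => M; rewrite rmorph_sum.
Qed.

Lemma ccvg_shift_series (f g : nat -> R[i]) (p : nat) (L : R[i]) :
  (forall j : nat, (j < p)%N -> g j = 0) -> (forall q, g (p + q)%N = f q) ->
  ccvg (fun M => \sum_(q < M.+1) f q) L -> ccvg (fun M => \sum_(j < M.+1) g j) L.
Proof.
move=> g0 gf; rewrite /ccvg => H.
rewrite -(cvg_shiftn p); apply: cvg_trans H; apply: near_eq_cvg; apply: nearW => M /=.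
congr (normc (_ - L)); rewrite -addSn addnC.
elim: {M} M.+1 => [|M IH]; last by rewrite addnS !big_ord_recr /= -IH gf.
by rewrite addn0 big_ord0 big1 // => b _; rewrite g0.
Qed.

End HypergeometricSeries.

Section KernelExpansion.
Context {R : realType} (n : nat) (n0 : (0 < n)%N).
Local Notation C := R[i].
Context (z w : cvec R n) (zb : in_ball z) (wb : in_ball w).
Context (l : (cvec R n -> C) -> C) (Hl : is_sphere_mean l).
Let Hs := sphere_mean_linear Hl.

Local Notation x := (cinner z z).
Local Notation u := (cinner z w).
Local Notation v := (cinner w z).
Local Notation y := (cinner w w).

Lemma coef_linear_exp (F : comNzRingType) (s t : F) c k :
  ((s%:P * 'X + t%:P) ^+ c)`_k = 'C(c, k)%:R * (s ^+ k * t ^+ (c - k)).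
Proof.
rewrite addrC exprDn coef_sum.
have E (i : 'I_c.+1) : ((t%:P ^+ (c - i) * (s%:P * 'X) ^+ i) *+ 'C(c, i))`_k =
    (k == i)%:R * ('C(c, i)%:R * (s ^+ i * t ^+ (c - i))).
  rewrite exprMn -!polyC_exp coefMn !coefCM coefXn -mulr_natl.
  by ring.
under eq_bigr do rewrite E.
have [kc|ck] := ltnP k c.+1.
  rewrite (bigD1 (Ordinal kc)) //= eqxx mul1r big1 ?addr0 // => i ik.
  by rewrite (_ : (k == i) = false) ?mul0r //; apply/negbTE; rewrite eq_sym.
rewrite bin_small // mul0r big1 // => i _.
by rewrite gtn_eqF ?mul0r // (leq_trans (ltn_ord i)).
Qed.

Lemma sphere_alg_mono4 a b c d :
  sphere_alg (fun s => cinner z s ^+ a * cinner w s ^+ b * (cinner s z ^+ c * cinner s w ^+ d)).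
Proof.
apply: sphere_alg_mul; apply: sphere_alg_mul; apply: sphere_alg_exp;
  first [exact: sphere_alg_cinner_l|exact: sphere_alg_cinner_r].
Qed.

(** Polarization of the two-vector moment at [k z + w] and [k' z + w]: both sides are polynomials in
    [k] and [k']. The summation index counts the factors [<z, z>]. *)
Lemma sphere_mean_mono4 a b c d :
  l (fun s => cinner z s ^+ a * cinner w s ^+ b * (cinner s z ^+ c * cinner s w ^+ d)) =
  if (a + b == c + d)%N then
    (mbin n (a + b))%:R^-1 / 'C(a + b, a)%:R *
      \sum_(k < a.+1) ('C(c, k)%:R * (x ^+ k * v ^+ (c - k))) *
        ('C(d, a - k)%:R * (u ^+ (a - k) * y ^+ (d - (a - k))))
  else 0.
Proof.
pose N := (a + b)%N; pose N' := (c + d)%N.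
pose m i j := l (fun s => cinner z s ^+ i * cinner w s ^+ (N - i) *
  (cinner s z ^+ j * cinner s w ^+ (N' - j))).
pose e : C := (N == N')%:R * (mbin n N)%:R^-1.
have H0 (k k' : nat) : \sum_(j < N'.+1) \sum_(i < N.+1)
     'C(N', j)%:R * 'C(N, i)%:R * k%:R ^+ i * k'%:R ^+ j * m i j =
   e * (k%:R * k'%:R * x + k%:R * u + k'%:R * v + y) ^+ N.
  pose p j := k%:R * z j + 1 * w j; pose q j := k'%:R * z j + 1 * w j.
  have pq : cinner p q = k%:R * k'%:R * x + k%:R * u + k'%:R * v + y.
    rewrite cinner_lincomb_l !cinner_lincomb_r conjc_one conjc_nat; ring.
  have := sphere_mean_mono Hl p q N N'; rewrite pq.
  have -> : (if N == N' then ('C((n + N).-1, N)%:R)^-1 *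
     (k%:R * k'%:R * x + k%:R * u + k'%:R * v + y) ^+ N else 0) =
     e * (k%:R * k'%:R * x + k%:R * u + k'%:R * v + y) ^+ N :> C.
    by rewrite /e; case: eqP => _; rewrite ?mul0r // mul1r.
  move=> <-.
  have -> : (fun s => cinner p s ^+ N * cinner s q ^+ N') = (fun s =>
     \sum_(j < N'.+1) \sum_(i < N.+1) ('C(N', j)%:R * 'C(N, i)%:R * k%:R ^+ i * k'%:R ^+ j) *
       (cinner z s ^+ i * cinner w s ^+ (N - i) * (cinner s z ^+ j * cinner s w ^+ (N' - j)))).
    apply/funext => s; rewrite cinner_lincomb_l cinner_lincomb_r conjc_one conjc_nat !mul1r.
    rewrite [k%:R * _ + _]addrC [k'%:R * _ + _]addrC [X in _ * X]exprD_bin mulr_sumr.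
    apply: eq_bigr => j _; rewrite exprD_bin mulr_suml; apply: eq_bigr => i _.
    by rewrite !exprMn; ring.
  have a4 (j : 'I_N'.+1) (i : 'I_N.+1) := sphere_alg_mono4 i (N - i) j (N' - j).
  have a5 j i : sphere_alg (fun s => ('C(N', j)%:R * 'C(N, i)%:R * k%:R ^+ i * k'%:R ^+ j) *
       (cinner z s ^+ i * cinner w s ^+ (N - i) * (cinner s z ^+ j * cinner s w ^+ (N' - j)))).
    by apply: sphere_alg_mul; [exact: sphere_alg_cst|exact: sphere_alg_mono4].
  rewrite (sup_linear_sum _ Hs); last by move=> j; apply: sphere_alg_sum => i; exact: a5.
  apply: eq_bigr => j _; rewrite (sup_linear_sum _ Hs); last by move=> i; exact: a5.
  by apply: eq_bigr => i _; rewrite (sup_linearZ Hs) //; exact: sphere_alg_mono4.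
(* Comparison of the coefficients of [k'^j], with [k] still a parameter. *)
have H1 (k : nat) j : (j < N'.+1)%N ->
    'C(N', j)%:R * \sum_(i < N.+1) 'C(N, i)%:R * k%:R ^+ i * m i j =
    e * 'C(N', j)%:R * ((x * k%:R + v) ^+ j * (u * k%:R + y) ^+ (N' - j)).
  pose g j := 'C(N', j)%:R * \sum_(i < N.+1) 'C(N, i)%:R * k%:R ^+ i * m i j.
  pose g' j := e * 'C(N', j)%:R * ((x * k%:R + v) ^+ j * (u * k%:R + y) ^+ (N' - j)).
  apply: (@poly_coef_ext C N'.+1 g g') => k'.
  transitivity (e * (k%:R * k'%:R * x + k%:R * u + k'%:R * v + y) ^+ N).
    rewrite -H0; apply: eq_bigr => i _; rewrite /g mulrAC mulr_sumr.
    by apply: eq_bigr => i' _; ring.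
  rewrite /e /g' /e; case: eqP => [->|_]; last first.
    by rewrite !mul0r big1 // => i _; rewrite !mul0r.
  have -> : k%:R * k'%:R * x + k%:R * u + k'%:R * v + y =
     (u * k%:R + y) + (x * k%:R + v) * k'%:R by ring.
  by rewrite exprD_bin mulr_sumr; apply: eq_bigr => i _; rewrite exprMn; ring.
have cN' : (c < N'.+1)%N by rewrite ltnS leq_addr.
have aN : (a < N.+1)%N by rewrite ltnS leq_addr.
(* The factor of the right side of [H1] at [j = c] that depends on [k], as a polynomial; its
   coefficient of degree [a] is the convolution sum in the statement. *)
pose P := (x%:P * 'X + v%:P) ^+ c * (u%:P * 'X + y%:P) ^+ d.
have sP : N = N' -> (size P <= N.+1)%N.
  have s1 (s t : C) j : (size ((s%:P * 'X + t%:P) ^+ j) <= j.+1)%N.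
    apply: leq_trans (size_exp_leq _ _) _; rewrite ltnS -[X in (_ <= X)%N]mul1n leq_mul2r; apply/orP; right.
    have : (size (s%:P * 'X + t%:P)%R <= 2)%N by rewrite size_MXaddC; case: ifP => // _; rewrite ltnS size_polyC_leq1.
    by case: (size _) => [|[|[|]]].
  move=> NN; apply: leq_trans (size_mul_leq _ _) _.
  have := s1 x v c; have := s1 u y d; rewrite NN /N' -/(_ ^+ c) => h1 h2.
  by rewrite -ltnS; lia.
pose g i := 'C(N', c)%:R * ('C(N, i)%:R * m i c).
pose g' i := e * 'C(N', c)%:R * P`_i.
have H2 : g a = g' a.
  apply: (@poly_coef_ext C N.+1 g g') => // k.
  transitivity ('C(N', c)%:R * \sum_(i < N.+1) 'C(N, i)%:R * k%:R ^+ i * m i c).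
    by rewrite mulr_sumr; apply: eq_bigr => i _; rewrite /g; ring.
  rewrite H1 // /g'; have [NN|NN] := eqVneq N N'; last first.
    by rewrite /e (negbTE NN) !mul0r big1 // => i _; rewrite !mul0r.
  have -> : (x * k%:R + v) ^+ c * (u * k%:R + y) ^+ (N' - c) = P.[k%:R].
    by rewrite /P !hornerE /= addKn.
  rewrite (horner_coef_wide _ (sP NN)) mulr_sumr.
  by apply: eq_bigr => i _; rewrite mulrA.
move: H2; rewrite /g /g' /m {2}/N addKn {2}/N' addKn.
have b1 : 'C(N', c)%:R != 0 :> C by rewrite pnatr_eq0 -lt0n bin_gt0 leq_addr.
have b2 : 'C(N, a)%:R != 0 :> C by rewrite pnatr_eq0 -lt0n bin_gt0 leq_addr.
rewrite [e * _]mulrC -[RHS]mulrA => H2; have E := mulfI b1 H2.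
apply: (mulfI b2); rewrite E /e -/N -/N'.
case: eqP => [NN|_]; last by rewrite !mul0r mulr0.
rewrite mul1r mulrA [_ * (_ / _)]mulrC mulfVK //; congr (_ * _).
rewrite /P coefM; apply: eq_bigr => k _.
by rewrite !coef_linear_exp.
Qed.

End KernelExpansion.

Section FiniteExpansion.
Context {R : realType} (n : nat) (n0 : (0 < n)%N).
Local Notation C := R[i].

(** The exponents of the four-fold moment are [a = k + i], [b = p + q], [c = k + p], [d = i + q],
    where [q] counts the factors [<w, w>]. On the left stand the kernel coefficients and the moment;
    on the right the part depending on [q] is isolated as the [q]-th hypergeometric coefficient. *)
Lemma expansion_coef (k i p q : nat) :
  (mbin n (p + q))%:R * (mbin n (i + q))%:R /
    ((mbin n (k + i + (p + q)))%:R * 'C(k + i + (p + q), k + i)%:R) *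
    'C(k + p, k)%:R * 'C(i + q, i)%:R =
  (k + i)`!%:R * (k + p)`!%:R / (k`!%:R * p`!%:R * i`!%:R) *
    (poch n%:R p * poch n%:R i / poch n%:R (k + p + i)) *
    (poch (p + n)%:R q * poch (i + n)%:R q / (poch (k + p + i + n)%:R q * q`!%:R)) :> R.
Proof.
have f0 j : j`!%:R != 0 :> R by rewrite pnatr_eq0 -lt0n fact_gt0.
have binE a b : 'C(a + b, a)%:R = (a + b)`!%:R / (a`!%:R * b`!%:R) :> R.
  apply: (canRL (mulfK _)); first by rewrite mulf_neq0.
  by rewrite -!natrM -[X in (_ * (_ * X`!))%N](addKn a b) bin_fact ?leq_addr.
have n1 m : (0 < m + n)%N by rewrite addn_gt0 n0 orbT.
rewrite !mbin_poch // !poch_nat // !binE.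
have -> : ((p + n + q).-1 = (n + (p + q)).-1)%N by lia.
have -> : ((i + n + q).-1 = (n + (i + q)).-1)%N by lia.
have -> : ((k + p + i + n + q).-1 = (n + (k + i + (p + q))).-1)%N by lia.
have -> : ((p + n).-1 = (n + p).-1)%N by lia.
have -> : ((i + n).-1 = (n + i).-1)%N by lia.
have -> : ((k + p + i + n).-1 = (n + (k + p + i)).-1)%N by lia.
by field; rewrite !f0.
Qed.

Context (z w : cvec R n) (zb : in_ball z) (wb : in_ball w).
Context (l : (cvec R n -> C) -> C) (Hl : is_sphere_mean l).
Let Hs := sphere_mean_linear Hl.

Local Notation x := (cinner z z).
Local Notation u := (cinner z w).
Local Notation v := (cinner w z).

(** The factorials of [k + i] and [k + p] wait for the binomials ['C(n, k + i)] and ['C(n, k + p)]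
    of the polynomial factor, with which they form, up to sign, Pochhammer symbols of [-n]. *)
Definition expansion_term (k i p : nat) : C :=
  ((k + i)`!%:R * (k + p)`!%:R / (k`!%:R * p`!%:R * i`!%:R) *
    (poch n%:R p * poch n%:R i / poch n%:R (k + p + i)))%:C *
  (x ^+ k * v ^+ p * u ^+ i) *
  (hyp2F1 (p + n)%:R (i + n)%:R (k + p + i + n)%:R (cnorm2 w))%:C.

Lemma in_ball_cnorm2 : 0 <= cnorm2 w < 1.
Proof. by rewrite cnorm2_ge0. Qed.

(** Expanding [kern w] in powers [b], the expansion of [cokern w] retains only the power
    [a + b - c]. Collecting the terms with a given number [k] of factors [<z, z>] and summing over
    [b] gives a hypergeometric series for each [k]. *)
Lemma sphere_mean_kern_mono a c :
  l (fun s => cinner z s ^+ a * cinner s z ^+ c * (kern w s * cokern w s)) =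
  \sum_(k < a.+1) if (k <= c)%N then expansion_term k (a - k) (c - k) else 0.
Proof.
have aC j p : sphere_alg (fun s => cinner p s ^+ j) by apply: sphere_alg_exp; exact: sphere_alg_cinner_l.
have aC' j p : sphere_alg (fun s => cinner s p ^+ j) by apply: sphere_alg_exp; exact: sphere_alg_cinner_r.
pose M4 b d : C := (mbin n (a + b))%:R^-1 / 'C(a + b, a)%:R *
      \sum_(k < a.+1) ('C(c, k)%:R * (x ^+ k * v ^+ (c - k))) *
        ('C(d, a - k)%:R * (u ^+ (a - k) * (cinner w w) ^+ (d - (a - k)))).
pose G b : C := if (c <= a + b)%N then (mbin n (a + b - c))%:R * M4 b (a + b - c)%N else 0.
have EG b : l (fun s => cokern w s * (cinner z s ^+ a * cinner w s ^+ b * cinner s z ^+ c)) = G b.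
  have ah : sphere_alg (fun s => cinner z s ^+ a * cinner w s ^+ b * cinner s z ^+ c).
    by apply: sphere_alg_mul => //; exact: sphere_alg_mul.
  have Em d : l (fun s => cinner s w ^+ d * (cinner z s ^+ a * cinner w s ^+ b * cinner s z ^+ c)) =
      if (a + b == c + d)%N then M4 b d else 0.
    rewrite -(sphere_mean_mono4 n0 z w Hl); congr l; apply/funext => s; ring.
  apply: (ccvg_unique (sup_linear_cokern (sup_linear_mulr Hs ah) wb)).
  rewrite /G; case: ifP => [cab|/negbT cab].
    apply: (ccvg_sum_one (b := (a + b - c)%N) (u := fun d => (mbin n d)%:R *
      l (fun s => cinner s w ^+ d * (cinner z s ^+ a * cinner w s ^+ b * cinner s z ^+ c)))).
      move=> d dn; rewrite Em ifN ?mulr0 //; apply: contra dn => /eqP E.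
      by rewrite E addKn.
    by rewrite Em subnKC // eqxx.
  apply: (@ccvg_eventually _ _ _ 0) => M _; rewrite big1 // => d _.
  rewrite Em ifN ?mulr0 //; apply: contra cab => /eqP ->; exact: leq_addr.
have af : sphere_alg (fun s => cinner z s ^+ a * cinner s z ^+ c * cokern w s).
  by apply: sphere_alg_mul; [exact: sphere_alg_mul|exact: sphere_alg_cokern].
have := sup_linear_kern (sup_linear_mulr Hs af) wb.
have -> : l (fun s => kern w s * (cinner z s ^+ a * cinner s z ^+ c * cokern w s)) =
    l (fun s => cinner z s ^+ a * cinner s z ^+ c * (kern w s * cokern w s)).
  by congr l; apply/funext => s; ring.
move=> H; apply: (ccvg_unique H).
pose tm k b : C := (mbin n b)%:R * (if (c <= a + b)%N then (mbin n (a + b - c))%:R *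
   ((mbin n (a + b))%:R^-1 / 'C(a + b, a)%:R *
   (('C(c, k)%:R * (x ^+ k * v ^+ (c - k))) *
        ('C(a + b - c, a - k)%:R * (u ^+ (a - k) * (cinner w w) ^+ (a + b - c - (a - k)))))) else 0).
apply: (ccvg_ext (u := fun M => \sum_(k < a.+1) \sum_(b < M.+1) tm k b)).
  move=> M; rewrite exchange_big /=; apply: eq_bigr => b _.
  have -> : l (fun s => cinner w s ^+ b * (cinner z s ^+ a * cinner s z ^+ c * cokern w s)) = G b.
    by rewrite -EG; congr l; apply/funext => s; ring.
  rewrite -mulr_sumr; congr (_ * _); rewrite /G /M4; case: ifP => _; last by rewrite big1.
  by rewrite -!mulr_sumr.
apply: ccvg_sum => k; have ka : (k <= a)%N by rewrite -ltnS.
case: ifP => [kc|/negbT]; last first.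
  rewrite -ltnNge => ck; apply: (@ccvg_eventually _ _ _ 0) => M _; rewrite big1 // => b _.
  by rewrite /tm (bin_small ck) !mul0r !mulr0; case: ifP; rewrite !mulr0.
move: (nat_of_ord k) ka kc => k' ka kc; set i := (a - k')%N; set p := (c - k')%N.
have Ea : a = (k' + i)%N by rewrite subnKC.
have Ec : c = (k' + p)%N by rewrite subnKC.
have hy : (p + n <= k' + p + i + n)%N by lia.
have pn : (0 < p + n)%N by rewrite addn_gt0 n0 orbT.
have in0 : (0 < i + n)%N by rewrite addn_gt0 n0 orbT.
have Hh := hyp2F1_ccvg pn in0 hy in_ball_cnorm2.
pose K : C := ((k' + i)`!%:R * (k' + p)`!%:R / (k'`!%:R * p`!%:R * i`!%:R) *
    (poch n%:R p * poch n%:R i / poch n%:R (k' + p + i)))%:C *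
  (x ^+ k' * v ^+ p * u ^+ i).
have := ccvgZ K Hh.
pose f q : C := K * (poch (p + n)%:R q * poch (i + n)%:R q /
  (poch (k' + p + i + n)%:R q * q`!%:R) * cnorm2 w ^+ q)%:C.
move=> H'; have {H'} : ccvg (fun M => \sum_(q < M.+1) f q) (expansion_term k' i p).
  by apply: ccvg_ext H' => M; rewrite mulr_sumr.
(* The terms with [b < p] vanish: then [a + b - c] is below [a - k'] and the binomial is zero, or
   else the degree condition fails. The hypergeometric index is [q = b - p]. *)
apply: (ccvg_shift_series (p := p)) => [b bp|q].
  rewrite /tm; case: ifP => cab; last by rewrite mulr0.
  have Hi : (a + b - c < a - k')%N by rewrite /p in bp; lia.
  by rewrite (bin_small Hi) !(mul0r, mulr0).
rewrite /tm (_ : (c <= a + (p + q))%N); last by lia.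
have -> : (a + (p + q) - c = i + q)%N by lia.
rewrite -/i -/p addKn Ea /f /K.
rewrite cinner_self [(_ * cnorm2 w ^+ q)%:C]rmorphM /= rmorphXn /=.
have E := congr1 (fun r : R => r%:C) (expansion_coef k' i p q).
rewrite /= [RHS]rmorphM /= in E.
transitivity (((mbin n (p + q))%:R * (mbin n (i + q))%:R /
    ((mbin n (k' + i + (p + q)))%:R * 'C(k' + i + (p + q), k' + i)%:R) *
    'C(k' + p, k')%:R * 'C(i + q, i)%:R : R)%:C *
    (x ^+ k' * v ^+ p * u ^+ i * (cnorm2 w)%:C ^+ q)); last first.
  by rewrite E cinner_self; ring.
rewrite Ec !(rmorphM, fmorphV) /= !rmorph_nat invfM !cinner_self.
by ring.
Qed.

Lemma sum_ord_shift (V : zmodType) (k : nat) (F : nat -> V) : (k <= n)%N ->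
  \sum_(a < n.+1 | (k <= a)%N) F (a - k)%N = \sum_(i < (n - k).+1) F i.
Proof.
move=> kn; transitivity (\sum_(k <= a < n.+1) F (a - k)%N).
  by rewrite big_geq_mkord.
rewrite -{1}[k]add0n big_addn subSn // big_mkord.
by apply: eq_bigr => i _; rewrite addnK.
Qed.

Lemma sphere_mean_expansion :
  l (fun s => (1 - cinner z s) ^+ n * (1 - cinner s z) ^+ n * (kern w s * cokern w s)) =
  \sum_(k < n.+1) \sum_(p < (n - k).+1) \sum_(i < (n - k).+1)
    (poch (- n%:R) (k + p) * poch (- n%:R) (k + i) * poch n%:R p * poch n%:R i
     / (k`!%:R * p`!%:R * i`!%:R * poch n%:R (k + p + i)))%:C
    * (cnorm2 z ^+ k)%:C * v ^+ p * u ^+ i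
    * (hyp2F1 (p + n)%:R (i + n)%:R (k + p + i + n)%:R (cnorm2 w))%:C.
Proof.
pose sg (a : nat) : C := 'C(n, a)%:R * (-1) ^+ a.
have am a c : sphere_alg (fun s => cinner z s ^+ a * cinner s z ^+ c * (kern w s * cokern w s)).
  apply: sphere_alg_mul; apply: sphere_alg_mul.
  - by apply: sphere_alg_exp; exact: sphere_alg_cinner_l.
  - by apply: sphere_alg_exp; exact: sphere_alg_cinner_r.
  - exact: sphere_alg_kern.
  - exact: sphere_alg_cokern.
have am' a c : sphere_alg (fun s => (sg a * sg c) *
    (cinner z s ^+ a * cinner s z ^+ c * (kern w s * cokern w s))).
  by apply: sphere_alg_mul => //; exact: sphere_alg_cst.
transitivity (\sum_(c < n.+1) \sum_(a < n.+1) sg a * sg c *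
   l (fun s => cinner z s ^+ a * cinner s z ^+ c * (kern w s * cokern w s))).
  have -> : (fun s => (1 - cinner z s) ^+ n * (1 - cinner s z) ^+ n * (kern w s * cokern w s)) =
    (fun s => \sum_(c < n.+1) \sum_(a < n.+1) (sg a * sg c) *
       (cinner z s ^+ a * cinner s z ^+ c * (kern w s * cokern w s))).
    apply/funext => s; rewrite [X in _ * X * _]exprD_bin mulr_sumr mulr_suml.
    apply: eq_bigr => c _; rewrite exprD_bin !mulr_suml; apply: eq_bigr => a _.
    by rewrite !expr1n (exprNn (cinner z s)) (exprNn (cinner s z)) /sg; ring.
  rewrite (sup_linear_sum _ Hs); last by move=> c; apply: sphere_alg_sum => a; exact: am'.
  apply: eq_bigr => c _; rewrite (sup_linear_sum _ Hs); last by move=> a; exact: am'.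
  by apply: eq_bigr => a _; rewrite (sup_linearZ Hs).
transitivity (\sum_(c < n.+1) \sum_(a < n.+1) \sum_(k < n.+1 | (k <= a)%N && (k <= c)%N)
    sg a * sg c * expansion_term k (a - k) (c - k)).
  apply: eq_bigr => c _; apply: eq_bigr => a _; rewrite sphere_mean_kern_mono -mulr_sumr.
  congr (_ * _); rewrite -big_mkcond /=.
  rewrite (big_ord_widen_cond n.+1 (fun k => (k <= c)%N)
    (fun k => expansion_term k (a - k) (c - k))); last exact: ltn_ord.
  by apply: eq_bigl => k; rewrite andbC ltnS.
(* With [k] outermost, the truncated differences [c - k] and [a - k] are exact and become the free
   indices running up to [n - k]. *)
transitivity (\sum_(k < n.+1) \sum_(c < n.+1 | (k <= c)%N) \sum_(a < n.+1 | (k <= a)%N)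
    sg (k + (a - k))%N * sg (k + (c - k))%N * expansion_term k (a - k) (c - k)).
  under eq_bigr do under eq_bigr do rewrite big_mkcond.
  under eq_bigr do rewrite exchange_big /=.
  rewrite exchange_big /=; apply: eq_bigr => k _.
  rewrite [RHS]big_mkcond; apply: eq_bigr => c _.
  case: ifP => kc; last by rewrite big1 // => a _; rewrite andbF.
  rewrite [RHS]big_mkcond; apply: eq_bigr => a _; rewrite andbT.
  by case: ifP => ka //; rewrite !subnKC.
apply: eq_bigr => k _; have kn : (k <= n)%N by rewrite -ltnS.
rewrite (sum_ord_shift (fun p => \sum_(a < n.+1 | (k <= a)%N)
    sg (k + (a - k))%N * sg (k + p)%N * expansion_term k (a - k) p)) //.
apply: eq_bigr => p _.
rewrite (sum_ord_shift (fun i => sg (k + i)%N * sg (k + p)%N * expansion_term k i p)) //.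
apply: eq_bigr => i _; rewrite /sg /expansion_term cinner_self.
rewrite !poch_neg rmorphXn /= !(rmorphM, fmorphV, rmorphXn, rmorphN1) /= !rmorph_nat.
rewrite !invfM; ring.
Qed.

End FiniteExpansion.

(** * From the normalized mean to [K_Sz] *)

Lemma conj_1Bcinner (R : realType) (n : nat) (p s : cvec R n) :
  (1 - cinner p s)^* = 1 - cinner s p.
Proof. by rewrite !conjcE cinnerC. Qed.

Lemma kern_cokern_self (R : realType) (n : nat) (p s : cvec R n) :
  kern p s * cokern p s = (sqmod (1 - cinner p s) ^- n)%:C.
Proof.
rewrite /kern /cokern -invfM -exprMn fmorphV rmorphXn /= -mulcJ.
by rewrite conj_1Bcinner.
Qed.

Theorem theorem3p3 (R : realType) (n : nat) (z w : cvec R n) :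
  (1 <= n)%N -> in_ball z -> in_ball w ->
  let t1 : R := cnorm2 z in
  let t2 : R[i] := ((cnorm2 z)%:C - cinner w z) / (1 - cinner w z) in
  let t3 : R[i] := t2^* in
  let t4 : R := 1 - (1 - cnorm2 z) * (1 - cnorm2 w) / sqmod (1 - cinner z w) in
  let rhs : R[i] :=
    (Gamma_nat R n / (2 * pi ^+ n) * (1 - cnorm2 w) ^+ n
       / (sqmod (1 - cinner z w)) ^+ n)%:C *
    \sum_(i1 < n.+1) \sum_(i2 < (n - i1).+1) \sum_(j1 < (n - i1).+1)
      ((poch (- n%:R) (i1 + i2) * poch (- n%:R) (i1 + j1)
         * poch n%:R i2 * poch n%:R j1
         / (i1`!%:R * i2`!%:R * j1`!%:R * poch n%:R (i1 + i2 + j1)))%:C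
       * (t1 ^+ i1)%:C * t2 ^+ i2 * t3 ^+ j1
       * (hyp2F1 (i2 + n)%:R (j1 + n)%:R (i1 + i2 + j1 + n)%:R t4)%:C) in
  K_Sz z w = (complex.Re rhs)%:E /\ complex.Im rhs = 0.
Proof.
move=> n0 zb wb t1 t2 t3 t4 rhs.
have [l Hl] := @sphere_mean_exists R n n0; have Hs := sphere_mean_linear Hl.
have wz : 1 - cinner w z != 0 by exact: in_ball_cinner_neq0.
have mb := moebius_ball zb wb.
have c1 : cinner (moebius z w) z = t2 by rewrite (moebius_z zb) // -cnorm2_sigma //.
have c2 : cinner z (moebius z w) = t3 by rewrite /t3 -c1 cinnerC.
have sqC : sqmod (1 - cinner w z) = sqmod (1 - cinner z w).
  by rewrite -[RHS]sqmodJ conj_1Bcinner.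
have c4 : cnorm2 (moebius z w) = t4.
  by rewrite -[LHS](subKr 1) (one_minus_moebius zb) // sqC.
pose g s := Poisson z s * Poisson w s.
pose A : R := (Gamma_nat R n / (2 * pi ^+ n)) ^+ 2 * (1 - cnorm2 z) ^+ n * (1 - cnorm2 w) ^+ n.
pose k s := kern z s * kern w s * (cokern z s * cokern w s).
have gE : (fun s => (g s)%:C) = (fun s => A%:C * k s).
  apply/funext => s; rewrite /k mulrACA !kern_cokern_self -!rmorphM /g /Poisson /A.
  by congr (_%:C); ring.
have ak : sphere_alg k.
  by apply: sphere_alg_mul; apply: sphere_alg_mul;
    [exact: sphere_alg_kern|exact: sphere_alg_kern|exact: sphere_alg_cokern|exact: sphere_alg_cokern].
have ag : sphere_alg (fun s => (g s)%:C).
  by rewrite gE; apply: sphere_alg_mul => //; exact: sphere_alg_cst.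
have gam : 0 < Gamma_nat R n by rewrite ltr0n fact_gt0.
have pi0 : 0 < 2 * pi ^+ n :> R by rewrite mulr_gt0 // exprn_gt0 // pi_gt0.
have P0 (p s : cvec R n) : in_ball p -> 0 <= Poisson p s.
  move=> pb; rewrite /Poisson divr_ge0 ?exprn_ge0 ?sqmod_ge0 //.
  rewrite mulr_ge0 ?exprn_ge0 ?subr_ge0 ?divr_ge0 //; exact: ltW.
have Kint := sphere_mean_int Hl ag (fun s _ => mulr_ge0 (P0 z s zb) (P0 w s wb)).
(* The area of the sphere. It cancels one of the two normalizing constants of the Poisson
   kernels. *)
pose B : R := 2 * pi ^+ n / (n.-1)`!%:R.
(* The power of [1 - |z|^2] in the Poisson kernel at [z] is absorbed by the constant of the change
   of variables, which explains why the prefactor involves only [1 - |w|^2] and [|1 - <z, w>|^2]. *)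
have lE : rhs = B%:C * l (fun s => (g s)%:C).
  rewrite gE (sup_linearZ Hs) // /k (sphere_mean_moebius n0 zb Hl wb).
  rewrite (sphere_mean_expansion n0 z mb Hl) c1 c2 c4 !mulrA; congr (_ * _).
  rewrite -(conj_1Bcinner w z) -[_ * (1 - cinner w z) * _]mulrA mulcJ sqC -rmorphXn /= sqr_sqrtr; last first.
    by rewrite subr_ge0 ltW.
have -> : ((1 - cnorm2 z)%:C * (sqmod (1 - cinner z w))%:C) ^+ n =
      ((1 - cnorm2 z) ^+ n * sqmod (1 - cinner z w) ^+ n)%:C.
    by rewrite rmorphM !rmorphXn exprMn.
  rewrite -fmorphV -!rmorphM sqmodJ sqC; congr (_%:C); rewrite /A /B /Gamma_nat.
  have zp : 1 - cnorm2 z != 0 by rewrite gt_eqF // subr_gt0.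
  have sp : sqmod (1 - cinner z w) != 0 by rewrite -sqC gt_eqF // sqmod_gt0.
  have pn : pi ^+ n != 0 :> R by rewrite expf_neq0 // gt_eqF // pi_gt0.
  have fn : (n.-1)`!%:R != 0 :> R by rewrite gt_eqF.
  by field; rewrite pn fn !expf_neq0.
(* The triple sum has complex terms; its reality is read off from its being the mean of a real
   function. *)
split; last first.
  by rewrite lE Im_mulc /= (sphere_mean_real Hl) mulr0 mul0r addr0.
rewrite /K_Sz Kint lE; congr (_%:E).
by rewrite Re_mulc /= mul0r subr0.
Qed.
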